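(* There is an algorithm solving the feasibility problem of 0-1 integer programs with linear equality constraints, and an algorithm solving the optimization problem of 0-1 integer programs with linear equality constraints, each running (simultaneously) in $O(m\cdot 2^{n/2}\,\mathrm{poly}(n))$ time and $O(m\cdot 2^{n/4}\,\mathrm{poly}(n))$ space, where $n$ is the number of variables and $m$ is the number of equality constraints.
   Context: Let $A$ be a real $m\times n$ matrix, $b\in\mathbb{R}^m$, $c\in\mathbb{R}^n$ (all entries are arbitrary real numbers). Feasibility problem: given $A,b$, find $x\in\{0,1\}^n$ with $Ax=b$, or report that none exists. Optimization problem: given $A,b,c$, minimize $c^Tx$ subject to $Ax=b$, $x\in\{0,1\}^n$; i.e. return the minimum value together with a minimizer, or report infeasibility (value $\infty$). Here $\mathrm{poly}(n)$ denotes some polynomial in $n$. Since entries are arbitrary reals, the model is a real-number RAM: arithmetic operations on and comparisons of two real numbers take unit time, and a real number occupies one unit of space. Standing assumption: $m\in O(\mathrm{poly}(n))$. *)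

(* Defs.v *)
From mathcomp Require Import all_boot all_order all_algebra.
From mathcomp Require Import reals exp.

Set Implicit Arguments.
Unset Strict Implicit.
Unset Printing Implicit Defensive.

Import Order.TTheory GRing.Theory Num.Theory.
Local Open Scope ring_scope.

(** * A real-number RAM

    The machine has two random access memories: [wmem], holding natural numbers
    (used for indexing and control), and [rmem], holding real numbers.  Every
    instruction takes one unit of time and every memory cell occupies one unit
    of space.  Programs are finite lists of instructions with absolute jumps,
    depend on no instance, and have only natural numbers as constants.  There is
    no conversion from reals to naturals (no rounding): comparing two reals is
    the only way in which reals influence control and addressing. *)

(* The cell [k], or the cell whose address is stored in [wmem] cell [k]. *)
Inductive operand := Dir of nat | Ind of nat.

Inductive arith := Add | Sub | Mul | Div.

(* The first operand of an assignment is its destination.  A conditional jump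
   is taken if its first operand is [<=] its second one. *)
Inductive instr :=
  | WConst of operand & nat
  | WOp of arith & operand & operand & operand
  | RConst of operand & nat
  | ROp of arith & operand & operand & operand
  | Jump of nat
  | WJumpLe of operand & operand & nat
  | RJumpLe of operand & operand & nat.

Definition program := seq instr.

(* Cells beyond the stored sequences contain 0; [set_nth] extends a sequence
   up to the cell written, so its size is 1 + the largest address ever used. *)
Record config (R : realType) := Config {
  pc : nat;
  wmem : seq nat;
  rmem : seq R }.

(* Subtraction is truncated, division is Euclidean and n %/ 0 = 0. *)
Definition warith (o : arith) (x y : nat) : nat :=
  match o with
  | Add => x + y | Sub => x - y | Mul => x * y | Div => x %/ y
  end%N.

(* Here x / 0 = 0. *)
Definition rarith (R : realType) (o : arith) (x y : R) : R :=
  match o with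
  | Add => x + y | Sub => x - y | Mul => x * y | Div => x / y
  end.

Section Semantics.
Variable R : realType.
Implicit Types c : config R.

Definition wget c (k : nat) : nat := nth 0%N (wmem c) k.
Definition rget c (k : nat) : R := nth 0 (rmem c) k.

Definition address c (o : operand) : nat :=
  match o with Dir k => k | Ind k => wget c k end.

Definition wval c (o : operand) : nat := wget c (address c o).
Definition rval c (o : operand) : R := rget c (address c o).

Definition wset c (o : operand) (v : nat) : config R :=
  Config (pc c).+1 (set_nth 0%N (wmem c) (address c o) v) (rmem c).
Definition rset c (o : operand) (v : R) : config R :=
  Config (pc c).+1 (wmem c) (set_nth 0 (rmem c) (address c o) v).
Definition goto c (l : nat) : config R := Config l (wmem c) (rmem c).

Definition exec (i : instr) c : config R :=
  match i with
  | WConst d k => wset c d k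
  | WOp o d x y => wset c d (warith o (wval c x) (wval c y))
  | RConst d k => rset c d k%:R
  | ROp o d x y => rset c d (rarith o (rval c x) (rval c y))
  | Jump l => goto c l
  | WJumpLe x y l =>
      goto c (if (wval c x <= wval c y)%N then l else (pc c).+1)
  | RJumpLe x y l =>
      goto c (if rval c x <= rval c y then l else (pc c).+1)
  end.

(* The machine halts when the program counter leaves the program. *)
Definition halted (P : program) c : bool := (size P <= pc c)%N.

Definition step (P : program) c : config R :=
  if onth P (pc c) is Some i then exec i c else c.

Definition run (P : program) (t : nat) c : config R := iter t (step P) c.

Definition space c : nat := (size (wmem c) + size (rmem c))%N.

(* Naturals are confined to the range of addresses, i.e. to words of
   log_2 (s + 1) bits when s cells are available; otherwise a single cell could
   hold an unbounded amount of integer data. *)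
Definition fits (s : nat) c : bool :=
  (space c <= s)%N && all (fun k => k <= s)%N (wmem c).

(* Started from [c], the program [P] halts after at most [t] steps, staying
   within space [s] all along, in a configuration satisfying [Q]. *)
Definition computes_within (P : program) (t s : nat) c
    (Q : config R -> Prop) : Prop :=
  [/\ halted P (run P t c),
      forall u, (u <= t)%N -> fits s (run P u c)
    & Q (run P t c)].

End Semantics.

(** * 0-1 integer programs with linear equality constraints *)

Section ZeroOne.
Variables (R : realType) (m n : nat).
Implicit Types (A : 'M[R]_(m, n)) (b : 'cV[R]_m) (c x : 'cV[R]_n).

Definition feasible A b x : Prop :=
  (forall j, x j 0 = 0 \/ x j 0 = 1) /\ A *m x = b.

Definition objective c x : R := (c^T *m x) 0 0.

Definition minimizer A b c x : Prop :=
  feasible A b x /\ forall y, feasible A b y -> objective c x <= objective c y.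

Definition col_entries k (v : 'cV[R]_k) : seq R :=
  [seq v i 0 | i <- enum 'I_k].

Definition mx_entries A : seq R :=
  [seq A i j | i <- enum 'I_m, j <- enum 'I_n].

(* Initial configurations: [wmem] holds m, n and [rmem] holds A (row by row),
   followed by b (and c). *)
Definition feasibility_input A b : config R :=
  Config 0 [:: m; n] (mx_entries A ++ col_entries b).

Definition optimization_input A b c : config R :=
  Config 0 [:: m; n] (mx_entries A ++ col_entries b ++ col_entries c).

(* The vector found in the first n cells of [rmem]. *)
Definition out_vector (f : config R) : 'cV[R]_n := \col_(j < n) rget f j.

(* [wmem] cell 0 tells whether the instance is feasible; if so, the solution is
   returned in the first n cells of [rmem]. *)
Definition feasibility_answer A b (f : config R) : Prop :=
  (wget f 0 = 1%N /\ feasible A b (out_vector f)) \/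
  (wget f 0 = 0%N /\ ~ exists x, feasible A b x).

(* Likewise, with the minimum value returned in [rmem] cell n; the value
   infinity is encoded by 0 in [wmem] cell 0. *)
Definition optimization_answer A b c (f : config R) : Prop :=
  [/\ wget f 0 = 1%N, minimizer A b c (out_vector f)
    & rget f n = objective c (out_vector f)] \/
  (wget f 0 = 0%N /\ ~ exists x, feasible A b x).

End ZeroOne.

(* t <= m 2^(n/2) p(n) and s <= m 2^(n/4) p'(n), with real exponents. *)
Definition time_bound (R : realType) (p : {poly nat}) (m n t : nat) : Prop :=
  t%:R <= m%:R * 2 `^ (n%:R / 2) * (p.[n])%:R :> R.

Definition space_bound (R : realType) (p : {poly nat}) (m n s : nat) : Prop :=
  s%:R <= m%:R * 2 `^ (n%:R / 4) * (p.[n])%:R :> R.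

(* Main.v *)
(* Split the variables into four blocks of k = ceil(n/4) and let N = 2^k.  As in
   the algorithm of Schroeppel and Shamir, the N^2 assignments of the first two
   blocks, sorted lexicographically by their vector of row sums A x, are to be
   merged with those of the last two blocks, sorted by b - A x: equal keys are
   solutions.  The sorted order is enumerated in space O(N): with the assignment of
   one block (a leaf) fixed, the assignments of its partner block come in an order
   which does not depend on the leaf, because the lexicographic order is invariant
   under translation.  Hence a successor table for each partner block, the current
   position of each of the 2N leaves and a tournament tree over the leaves suffice,
   and each of the 2N^2 steps costs O(k) comparisons of vectors, whose entries are
   recomputed from A on demand.  Within a group of equal keys the cheapest first
   half is remembered and combined with every second half. *)

Require Import Defs.
From mathcomp Require Import all_boot all_order all_algebra.
From mathcomp Require Import reals exp.
From mathcomp Require Import zify ring lra.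

Set Implicit Arguments.
Unset Strict Implicit.
Unset Printing Implicit Defensive.

Import Order.TTheory GRing.Theory Num.Theory.
Local Open Scope ring_scope.
Local Open Scope nat_scope.

(** The obstacle is that the claim concerns machine code with absolute jumps, whose space and word
    sizes must be controlled at every step. Hence a small structured language is compiled, and its
    weakest preconditions carry the bound [B] on addresses and values as side conditions. Run time
    is a syntactic function of the program, so it is estimated apart from correctness. One code
    serves all sizes, because loop bounds are ghosts and array bases are constants.

    The successor tables need no sorting: finding [2 * N] successors and [2 * N] starting positions
    by linear scans takes [O(N ^ 2)] comparisons, the order of the merge itself. A tournament tree
    with fixed leaves can replace a priority queue because a step of the merge moves a single leaf,
    so only the [k + 1] nodes above it are replayed.

    Rounding [n / 4] up to [k] costs constant factors only: [N] is at most [2 * 2 ^ (n / 4)], and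
    the positions between [n] and [4 * k] are padding that contributes nothing to any sum. *)

Inductive wexp :=
  | K of nat | V of nat | Arr of nat & wexp | Bin of arith & wexp & wexp.

Inductive cond := CLt of wexp & wexp | CRLt of nat & nat.

(* The number in [While] bounds the iterations.  It is a ghost: [compile] ignores
   it, while [time] and [wp] use it, so that a run time never has to be mentioned
   in a correctness statement. *)
Inductive cmd :=
  | Skip
  | SetS of nat & wexp
  | SetA of nat & wexp & wexp
  | SetR of nat & nat
  | OpR of arith & nat & nat & nat
  | AccR of nat & wexp
  | Store of wexp & nat
  | Seq of cmd & cmd
  | If of cond & cmd & cmd
  | While of nat & cond & cmd.

(* Cells below [rbase] of [wmem] are scalars, the four cells from [rbase] on hold
   the addresses of the real scalars (just behind the input in [rmem]), those from
   [tbase] on are temporaries, and three arrays are interleaved from [abase] on. *)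
Notation rbase := 36.
Notation tbase := 40.
Notation abase := 56.

(** Interleaving gives each array a base address independent of its length, so the code need not
    know [N]. Indices stay below [4 * N], hence addresses below [12 * N + abase]: this is the [12]
    of the space bound. *)
Definition cell (a i : nat) := abase + 3 * i + a.

Definition addr_code a d :=
  [:: WConst (Dir d.+1) 3; WOp Mul (Dir d) (Dir d) (Dir d.+1);
      WConst (Dir d.+1) (abase + a); WOp Add (Dir d) (Dir d) (Dir d.+1)].

(** The temporaries from [d] on form an evaluation stack: the result arrives in cell [d], and a
    second operand is computed in [d.+1]. The machine has no copy instruction, so a copy is a zero
    followed by an addition. *)
Fixpoint comp_wexp e d : seq instr :=
  match e with
  | K c => [:: WConst (Dir d) c]
  | V x => [:: WConst (Dir d) 0; WOp Add (Dir d) (Dir d) (Dir x)]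
  | Arr a e1 => comp_wexp e1 d ++ addr_code a d ++
      [:: WConst (Dir d.+1) 0; WOp Add (Dir d) (Ind d) (Dir d.+1)]
  | Bin o e1 e2 => comp_wexp e1 d ++ comp_wexp e2 d.+1 ++
      [:: WOp o (Dir d) (Dir d) (Dir d.+1)]
  end.

Definition comp_cond b l : seq instr :=
  match b with
  | CLt e1 e2 => (comp_wexp e1 tbase ++ comp_wexp e2 tbase.+1) ++
      [:: WJumpLe (Dir tbase.+1) (Dir tbase) l]
  | CRLt x y => [:: RJumpLe (Ind (rbase + y)) (Ind (rbase + x)) l]
  end.

Definition cond_size b := size (comp_cond b 0).

Fixpoint compile l c : seq instr :=
  match c with
  | Skip => [::]
  | SetS d e => comp_wexp e tbase ++
      [:: WConst (Dir d) 0; WOp Add (Dir d) (Dir d) (Dir tbase)]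
  | SetA a e1 e2 => comp_wexp e2 tbase ++ comp_wexp e1 tbase.+1 ++
      addr_code a tbase.+1 ++
      [:: WConst (Ind tbase.+1) 0;
          WOp Add (Ind tbase.+1) (Ind tbase.+1) (Dir tbase)]
  | SetR d k => [:: RConst (Ind (rbase + d)) k]
  | OpR o d x y =>
      [:: ROp o (Ind (rbase + d)) (Ind (rbase + x)) (Ind (rbase + y))]
  | AccR d e => comp_wexp e tbase ++
      [:: ROp Add (Ind (rbase + d)) (Ind (rbase + d)) (Ind tbase)]
  | Store e x => comp_wexp e tbase ++
      [:: RConst (Ind tbase) 0; ROp Add (Ind tbase) (Ind tbase) (Ind (rbase + x))]
  | Seq c1 c2 => let p1 := compile l c1 in p1 ++ compile (l + size p1) c2
  | If b c1 c2 =>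
      let l1 := l + cond_size b in
      let p1 := compile l1 c1 in
      let l2 := l1 + size p1 + 1 in
      let p2 := compile l2 c2 in
      comp_cond b l2 ++ p1 ++ [:: Jump (l2 + size p2)] ++ p2
  | While _ b c1 =>
      let l1 := l + cond_size b in
      let p1 := compile l1 c1 in
      comp_cond b (l1 + size p1 + 1) ++ p1 ++ [:: Jump l]
  end.

(** An upper bound read off the syntax: an [If] is charged for both branches, which avoids a
    maximum, and a [While] for one test more than its iterations. The [1] is the unconditional
    jump. *)
Fixpoint time c : nat :=
  match c with
  | Seq c1 c2 => time c1 + time c2
  | If b c1 c2 => cond_size b + (time c1 + time c2 + 1)
  | While it b c1 => it * (cond_size b + (time c1 + 1)) + cond_size b
  | _ => size (compile 0 c)
  end.

(** Keeps the evaluation stack below [abase], so that computing an expression cannot overwrite an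
    array. It is a boolean on syntax, checked once by computation for the whole program. *)
Fixpoint wexp_wf e d :=
  match e with
  | K _ => d < abase
  | V x => (d < abase) && (x < rbase)
  | Arr a e1 => [&& a < 3, d.+1 < abase & wexp_wf e1 d]
  | Bin _ e1 e2 => wexp_wf e1 d && wexp_wf e2 d.+1
  end.

Definition cond_wf b :=
  match b with
  | CLt e1 e2 => wexp_wf e1 tbase && wexp_wf e2 tbase.+1
  | CRLt x y => (x < 4) && (y < 4)
  end.

Fixpoint cmd_wf c :=
  match c with
  | Skip => true
  | SetS d e => (d < rbase) && wexp_wf e tbase
  | SetA a e1 e2 => [&& a < 3, wexp_wf e1 tbase.+1 & wexp_wf e2 tbase]
  | SetR d _ => d < 4
  | OpR _ d x y => [&& d < 4, x < 4 & y < 4]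
  | AccR d e => (d < 4) && wexp_wf e tbase
  | Store e x => (x < 4) && wexp_wf e tbase
  | Seq c1 c2 => cmd_wf c1 && cmd_wf c2
  | If b c1 c2 => [&& cond_wf b, cmd_wf c1 & cmd_wf c2]
  | While _ b c1 => cond_wf b && cmd_wf c1
  end.

Definition upd T (f : nat -> T) x v y := if y == x then v else f y.
Arguments upd T f x v y / : simpl nomatch.

Lemma updE T (f : nat -> T) x v y : upd f x v y = if y == x then v else f y.
Proof. by []. Qed.

(** * Weakest preconditions of the structured language *)

Section HighLevel.
Variable R : realType.
Variables (M B : nat).

(* Scalars, arrays, real scalars, and the part of [rmem] occupied by the input. *)
Record hst := HS {
  sv : nat -> nat; av : nat -> nat -> nat; rv : nat -> R; iv : nat -> R }.

Definition putS st x v := HS (upd (sv st) x v) (av st) (rv st) (iv st).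
Definition putA st a i v :=
  HS (sv st) (upd (av st) a (upd (av st a) i v)) (rv st) (iv st).
Definition putR st x v := HS (sv st) (av st) (upd (rv st) x v) (iv st).
Definition putI st i v := HS (sv st) (av st) (rv st) (upd (iv st) i v).

Fixpoint ev st e : nat :=
  match e with
  | K c => c
  | V x => sv st x
  | Arr a e1 => av st a (ev st e1)
  | Bin o e1 e2 => warith o (ev st e1) (ev st e2)
  end.

(** Only sums and products can leave the range of words: truncated differences and quotients are at
    most their first operand, and values read from memory are bounded by the invariant [fit]. *)
Fixpoint sf st e : Prop :=
  match e with
  | K c => c <= B
  | V _ => True
  | Arr a e1 => sf st e1 /\ cell a (ev st e1) < B
  | Bin o e1 e2 => [/\ sf st e1, sf st e2 &
      match o with Add | Mul => warith o (ev st e1) (ev st e2) <= B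
      | _ => True end]
  end.

Definition evc st b : bool :=
  match b with
  | CLt e1 e2 => ev st e1 < ev st e2
  | CRLt x y => (rv st x < rv st y)%R
  end.

Definition sfc st b : Prop :=
  match b with
  | CLt e1 e2 => sf st e1 /\ sf st e2
  | CRLt x y => True
  end.

(** Total correctness: a loop whose guard still holds when the ghost bound is used up has
    precondition [False]. Every correctness proof thereby justifies the iteration counts on which
    [time] relies. *)
Fixpoint wp c (Q : hst -> Prop) (st : hst) {struct c} : Prop :=
  match c with
  | Skip => Q st
  | SetS d e => sf st e /\ Q (putS st d (ev st e))
  | SetA a e1 e2 => [/\ sf st e1, sf st e2, cell a (ev st e1) < B &
      Q (putA st a (ev st e1) (ev st e2))]
  | SetR d k => Q (putR st d k%:R)
  | OpR o d x y => Q (putR st d (rarith o (rv st x) (rv st y)))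
  | AccR d e => [/\ sf st e, ev st e < M &
      Q (putR st d (rv st d + iv st (ev st e))%R)]
  | Store e x => [/\ sf st e, ev st e < M & Q (putI st (ev st e) (rv st x))]
  | Seq c1 c2 => wp c1 (wp c2 Q) st
  | If b c1 c2 => sfc st b /\ (if evc st b then wp c1 Q st else wp c2 Q st)
  | While it b c1 =>
      (fix loop it st := sfc st b /\
         (if evc st b then
            if it is it'.+1 then wp c1 (loop it') st else False
          else Q st)) it st
  end.

Lemma wp_while0 it b c Q st : wp (While it b c) Q st =
  (sfc st b /\ (if evc st b then
      if it is it'.+1 then wp c (wp (While it' b c) Q) st else False
    else Q st)).
Proof. by case: it. Qed.

Lemma wp_mono c (Q Q' : hst -> Prop) st :
  (forall s, Q s -> Q' s) -> wp c Q st -> wp c Q' st.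
Proof.
elim: c Q Q' st => [|d e|a e1 e2|d k|o d x y|d e|e x|c1 IH1 c2 IH2|b c1 IH1 c2 IH2|it b c IH] Q Q' st QQ'.
- exact: QQ'.
- by case=> ? /QQ'.
- by case=> ? ? ? /QQ'.
- exact: QQ'.
- exact: QQ'.
- by case=> ? ? /QQ'.
- by case=> ? ? /QQ'.
- by apply: IH1 => s; apply: IH2.
- by case=> ? H; split=> //; case: ifP H => _; [apply: IH1|apply: IH2].
- elim: it st => [|it IHit] st; rewrite !wp_while0 => -[sb H]; split=> //.
    by case: ifP H => // _; apply: QQ'.
  case: ifP H => _; last exact: QQ'.
  by apply: IH => s; apply: IHit.
Qed.

Fixpoint wmod c : seq nat :=
  match c with
  | SetS d _ => [:: d]
  | Seq c1 c2 | If _ c1 c2 => wmod c1 ++ wmod c2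
  | While _ _ c1 => wmod c1
  | _ => [::]
  end.

Fixpoint amod c : seq nat :=
  match c with
  | SetA a _ _ => [:: a]
  | Seq c1 c2 | If _ c1 c2 => amod c1 ++ amod c2
  | While _ _ c1 => amod c1
  | _ => [::]
  end.

Fixpoint rmod c : seq nat :=
  match c with
  | SetR d _ | OpR _ d _ _ | AccR d _ => [:: d]
  | Seq c1 c2 | If _ c1 c2 => rmod c1 ++ rmod c2
  | While _ _ c1 => rmod c1
  | _ => [::]
  end.

Fixpoint imod c : bool :=
  match c with
  | Store _ _ => true
  | Seq c1 c2 | If _ c1 c2 => imod c1 || imod c2
  | While _ _ c1 => imod c1
  | _ => false
  end.

Record frm c st st' : Prop := Frm {
  frmS : forall x, x \notin wmod c -> sv st' x = sv st x;
  frmA : forall a, a \notin amod c -> av st' a = av st a;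
  frmR : forall x, x \notin rmod c -> rv st' x = rv st x;
  frmI : ~~ imod c -> iv st' = iv st }.

Lemma frm_trans c1 c2 c st1 st2 st3 :
  {subset wmod c1 <= wmod c} -> {subset amod c1 <= amod c} ->
  {subset rmod c1 <= rmod c} -> (imod c1 -> imod c) ->
  {subset wmod c2 <= wmod c} -> {subset amod c2 <= amod c} ->
  {subset rmod c2 <= rmod c} -> (imod c2 -> imod c) ->
  frm c1 st1 st2 -> frm c2 st2 st3 -> frm c st1 st3.
Proof.
move=> w1 a1 r1 i1 w2 a2 r2 i2 [f1 g1 h1 Hi1] [f2 g2 h2 Hi2].
split=> [x nx|x nx|x nx|nx].
- by rewrite f2 ?(contra (w2 _)) // f1 // (contra (w1 _)).
- by rewrite g2 ?(contra (a2 _)) // g1 // (contra (a1 _)).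
- by rewrite h2 ?(contra (r2 _)) // h1 // (contra (r1 _)).
- by rewrite Hi2 ?(contra i2) // Hi1 // (contra i1).
Qed.

(** Spares specifications from listing what stays unchanged: the modified cells are read off the
    program text, and a caller recovers every other value by computation. *)
Lemma wp_frame c Q st : wp c Q st -> wp c (fun st' => Q st' /\ frm c st st') st.
Proof.
elim: c Q st => [|d e|a e1 e2|d k|o d x y|d e|e x|c1 IH1 c2 IH2|b c1 IH1 c2 IH2|it b c IH] Q st.
- by split=> //; split.
- case=> ? ?; split=> //; split=> //; split=> // z /=.
  by rewrite inE updE => /negbTE ->.
- case=> ? ? ? ?; split=> //; split=> //; split=> // z /=.
  by rewrite inE updE => /negbTE ->.
- move=> ?; split=> //; split=> // z /=.
  by rewrite inE updE => /negbTE ->.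
- move=> ?; split=> //; split=> // z /=.
  by rewrite inE updE => /negbTE ->.
- case=> ? ? ?; split=> //; split=> //; split=> // z /=.
  by rewrite inE updE => /negbTE ->.
- by case=> ? ? ?; split=> //; split=> //; split.
- move=> /IH1; apply: wp_mono => s [/IH2 H f]; apply: wp_mono H => s' [? f']; split=> //.
  by apply: frm_trans f f' => [z|z|z||z|z|z|] //=; rewrite ?mem_cat => ->; rewrite ?orbT.
- case=> ? H; split=> //; case: ifP H => _ => [/IH1|/IH2]; apply: wp_mono => s [? f];
  (split=> //; case: f => ? ? ? ?; split=> [z|z|z|] /=; rewrite ?mem_cat negb_or => /andP[]; auto).
- elim: it st => [|it IHit] st; rewrite !wp_while0 => -[sb H]; split=> //.
    by case: ifP H => // _ H; split=> //; split.
  case: ifP H => _ H; last by split=> //; split.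
  move/IH: H; apply: wp_mono => s [/IHit H f]; apply: wp_mono H => s' [? f']; split=> //.
  by apply: frm_trans f f'.
Qed.

(** The count may drop by more than one, which serves loops that are left early, such as the one in
    [p_rows]. *)
Lemma wp_while b c Q (I : nat -> hst -> Prop) it i st :
  (forall i s, i <= it -> I i s -> sfc s b /\
     (if evc s b then 0 < i /\ wp c (fun s' => exists2 j, j < i & I j s') s
      else Q s)) ->
  I i st -> i <= it -> wp (While it b c) Q st.
Proof.
move=> HI Ii iit.
have gen f : forall j s, j <= f -> j <= it -> I j s -> wp (While f b c) Q s.
  elim: f => [|f IHf] j s jf jit Ij; rewrite wp_while0;
    have [? H] := HI _ _ jit Ij; split=> //; case: ifP H => // _ [j0].
    by case: (j) j0 jf.
  by apply: wp_mono => s' [j' j'j Ij']; apply: (IHf j') => //; lia.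
exact: (gen it i).
Qed.

(** * Soundness of the compiler *)

Implicit Types (c : config R) (code P : program).

(** Bounding the two memories separately makes the invariant easy to check at a single write; the
    total space is then [B + B]. *)
Definition fit c :=
  [/\ size (wmem c) <= B, size (rmem c) <= B & all (fun k => k <= B) (wmem c)].

Lemma fit_fits c : fit c -> fits (B + B) c.
Proof.
case=> w r a; rewrite /fits /space leq_add //=.
by apply: sub_all a => k /leq_trans; apply; rewrite leq_addr.
Qed.

Lemma wget_le c x : fit c -> wget c x <= B.
Proof.
case=> _ _ /allP a; rewrite /wget.
case: (ltnP x (size (wmem c))) => h; first by apply/a/mem_nth.
by rewrite nth_default.
Qed.

Lemma wget_set c o v x :
  wget (wset c o v) x = if x == address c o then v else wget c x.
Proof. by rewrite /wget /wset /= nth_set_nth. Qed.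

Lemma rget_set c o v x :
  rget (rset c o v) x = if x == address c o then v else rget c x.
Proof. by rewrite /rget /rset /= nth_set_nth. Qed.

Lemma fit_wset c o v : fit c -> address c o < B -> v <= B -> fit (wset c o v).
Proof.
move=> fc ab vb; case: (fc) => w r /allP a; split=> //=.
  by rewrite size_set_nth geq_max ab.
apply/allP => y /(nthP 0)[i _ <-].
by rewrite nth_set_nth /=; case: eqP => // _; apply: (wget_le i fc).
Qed.

Lemma fit_rset c o v : fit c -> address c o < B -> fit (rset c o v).
Proof. by case=> w r a ab; split=> //=; rewrite size_set_nth geq_max ab. Qed.

Definition straight (i : instr) :=
  match i with Jump _ | WJumpLe _ _ _ | RJumpLe _ _ _ => false | _ => true end.

(** Follows straight-line code without a surrounding program or program counter; [along_reach] puts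
    the code back into its place. *)
Fixpoint along code c (Q : config R -> Prop) : Prop :=
  if code is i :: code' then
    [/\ straight i, fit (exec i c) & along code' (exec i c) Q]
  else Q c.

Lemma along_cat code1 code2 c Q :
  along (code1 ++ code2) c Q <-> along code1 c (fun c' => along code2 c' Q).
Proof.
elim: code1 c => //= i code1 IH c.
by split=> -[? ? H]; split=> //; apply/IH.
Qed.

(** The number of steps is only bounded by [t], because [time] overestimates. The space condition is
    recorded for every configuration passed, as the final claim demands. *)
Definition reach P c t (Q : config R -> Prop) : Prop :=
  exists2 u, u <= t & (forall v, v <= u -> fits (B + B) (run P v c)) /\ Q (run P u c).

Lemma reach0 P c t Q : fit c -> Q c -> reach P c t Q.
Proof.
move=> fc qc; exists 0 => //; split=> // v; rewrite leqn0 => /eqP ->.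
exact: fit_fits.
Qed.

Lemma reach_bind P c t1 t2 (Q1 Q : config R -> Prop) :
  reach P c t1 Q1 -> (forall c', Q1 c' -> reach P c' t2 Q) ->
  reach P c (t1 + t2) Q.
Proof.
case=> u ut [fu q] /(_ _ q)[u' ut' [fu' q']]; exists (u' + u); first lia.
split=> [v vu|]; last by rewrite /run iterD.
case: (leqP v u) => [/fu //|uv].
have -> : v = (v - u) + u by lia.
by rewrite /run iterD; apply: fu'; lia.
Qed.

Definition at_pos P l code :=
  exists p q, P = p ++ code ++ q /\ size p = l.

Lemma at_cat P l code1 code2 : at_pos P l (code1 ++ code2) ->
  at_pos P l code1 /\ at_pos P (l + size code1) code2.
Proof.
case=> p [q [-> <-]]; split; first by exists p, (code2 ++ q); rewrite !catA.
by exists (p ++ code1), q; rewrite size_cat !catA.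
Qed.

Lemma at_onth P l i code : at_pos P l (i :: code) -> onth P l = Some i.
Proof. by case=> p [q [-> <-]]; elim: p. Qed.

Lemma reach_step P c t i code (Q : config R -> Prop) :
  at_pos P (pc c) (i :: code) -> fit c -> reach P (exec i c) t Q ->
  reach P c t.+1 Q.
Proof.
move=> /at_onth Pi fc [u ut [fu q]]; exists u.+1 => //.
have runS v : run P v.+1 c = run P v (exec i c).
  by rewrite /run iterSr /step Pi.
split=> [[_|v vu]|]; last by rewrite runS.
  exact: fit_fits.
by rewrite runS; apply: fu.
Qed.

Lemma along_reach P c code t (Q Q' : config R -> Prop) :
  at_pos P (pc c) code -> fit c -> along code c Q ->
  (forall c', fit c' -> pc c' = pc c + size code -> Q c' -> reach P c' t Q') ->
  reach P c (size code + t) Q'.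
Proof.
elim: code c => [|i code IH] c Pc fc /=.
  by move=> q H; rewrite add0n; apply: H; rewrite ?addn0.
case=> si fi H H'; rewrite addSn; apply: (reach_step Pc fc).
have pci : pc (exec i c) = (pc c).+1 by case: i si {fi Pc H H'}.
apply: IH H _ => // [|c' fc' pcc' qc'].
  by rewrite pci; move: Pc; rewrite -cat1s => /at_cat[_]; rewrite addn1.
by apply: H' => //; rewrite pcc' pci addSnnS.
Qed.

(** Temporaries are left unconstrained, so evaluating an expression preserves the relation
    ([sim_w]). *)
Record sim c st : Prop := Sim {
  sim_fit : fit c;
  simS : forall x, x < rbase -> wget c x = sv st x;
  simB : forall x, x < 4 -> wget c (rbase + x) = M + x;
  simA : forall a i, a < 3 -> wget c (cell a i) = av st a i;
  simR : forall x, x < 4 -> rget c (M + x) = rv st x;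
  simI : forall i, i < M -> rget c i = iv st i }.

Hypotheses (B100 : 100 <= B) (MB : M + 4 <= B).

Lemma along_w i code c d v Q : fit c -> straight i -> exec i c = wset c d v ->
  address c d < B -> v <= B ->
  (forall c', fit c' -> rmem c' = rmem c ->
     (forall x, wget c' x = if x == address c d then v else wget c x) ->
     along code c' Q) ->
  along (i :: code) c Q.
Proof.
move=> fc si Ei ab vb H; have fi : fit (exec i c) by rewrite Ei; apply: fit_wset.
by split=> //; apply: H => // [|x]; rewrite Ei // wget_set.
Qed.

Lemma along_r i code c d v Q : fit c -> straight i -> exec i c = rset c d v ->
  address c d < B ->
  (forall c', fit c' -> wmem c' = wmem c ->
     (forall x, rget c' x = if x == address c d then v else rget c x) ->
     along code c' Q) ->
  along (i :: code) c Q.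
Proof.
move=> fc si Ei ab H; have fi : fit (exec i c) by rewrite Ei; apply: fit_rset.
by split=> //; apply: H => // [|x]; rewrite Ei // rget_set.
Qed.

Lemma along_nil c Q : Q c -> along [::] c Q.
Proof. by []. Qed.

Arguments along : simpl never.

Lemma along_wconst d k code c Q : fit c -> address c d < B -> k <= B ->
  (forall c', fit c' -> rmem c' = rmem c ->
     (forall x, wget c' x = if x == address c d then k else wget c x) ->
     along code c' Q) ->
  along (WConst d k :: code) c Q.
Proof. by move=> fc; apply: (@along_w (WConst d k) code c d k). Qed.

Lemma along_wop o d x y code c Q : fit c -> address c d < B ->
  warith o (wval c x) (wval c y) <= B ->
  (forall c', fit c' -> rmem c' = rmem c ->
     (forall z, wget c' z =
        if z == address c d then warith o (wval c x) (wval c y) else wget c z) ->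
     along code c' Q) ->
  along (WOp o d x y :: code) c Q.
Proof. by move=> fc; apply: (@along_w (WOp o d x y) code c d (warith o (wval c x) (wval c y))). Qed.

Lemma along_rconst d k code c Q : fit c -> address c d < B ->
  (forall c', fit c' -> wmem c' = wmem c ->
     (forall x, rget c' x = if x == address c d then k%:R%R else rget c x) ->
     along code c' Q) ->
  along (RConst d k :: code) c Q.
Proof. by move=> fc; apply: (@along_r (RConst d k) code c d k%:R%R). Qed.

Lemma along_rop o d x y code c Q : fit c -> address c d < B ->
  (forall c', fit c' -> wmem c' = wmem c ->
     (forall z, rget c' z =
        if z == address c d then rarith o (rval c x) (rval c y) else rget c z) ->
     along code c' Q) ->
  along (ROp o d x y :: code) c Q.
Proof. by move=> fc; apply: (@along_r (ROp o d x y) code c d (rarith o (rval c x) (rval c y))). Qed.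

Lemma addr_code_ok a d c code Q : fit c -> a < 3 -> d.+1 < abase ->
  cell a (wget c d) < B ->
  (forall c', fit c' -> rmem c' = rmem c -> wget c' d = cell a (wget c d) ->
     (forall x, x != d -> x != d.+1 -> wget c' x = wget c x) -> along code c' Q) ->
  along (addr_code a d ++ code) c Q.
Proof.
rewrite /cell => fc a3 da aB H.
apply: along_wconst => //=; [lia|lia|] => c1 f1 r1 E1.
apply: along_wop => //=; [lia| |] => [|c2 f2 r2 E2].
  by rewrite /wval /= !E1 /= eqxx ifN; lia.
apply: along_wconst => //=; [lia|lia|] => c3 f3 r3 E3.
have V : warith Add (wval c3 (Dir d)) (wval c3 (Dir d.+1)) =
  abase + 3 * wget c d + a.
  rewrite /wval /= !E3 /= eqxx ifN ?E2 /= ?eqxx; last lia.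
  by rewrite /wval /= !E1 /= eqxx ifN; lia.
apply: along_wop => //=; [lia| |] => [|c4 f4 r4 E4].
  by rewrite -[_ + _]/(warith Add _ _) V; lia.
apply: H => //; first by rewrite r4 r3 r2 r1.
  by rewrite E4 /= eqxx -V.
by move=> x xd xd1; rewrite E4 /= ifN // E3 ifN // E2 ifN // E1 ifN.
Qed.

Lemma wexp_wf_lt e d : wexp_wf e d -> d < abase.
Proof.
elim: e d => [k|x|a e IH|o e1 IH1 e2 _] d //=; first by case/andP.
  by case/and3P=> _ _ /IH.
by case/andP=> /IH1.
Qed.

Lemma comp_wexp_ok st e d c Q : fit c ->
  (forall x, x < rbase -> wget c x = sv st x) ->
  (forall a i, a < 3 -> wget c (cell a i) = av st a i) ->
  rbase + 4 <= d -> wexp_wf e d -> sf st e ->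
  (forall c', fit c' -> rmem c' = rmem c -> wget c' d = ev st e ->
     (forall x, (x < d) || (abase <= x) -> wget c' x = wget c x) -> Q c') ->
  along (comp_wexp e d) c Q.
Proof.
elim: e d c Q => [k|x|a e IH|o e1 IH1 e2 IH2] d c Q fc cS cA rd /=.
- move=> da kB H; apply: along_wconst => //=; first lia.
  move=> c1 f1 r1 E1; apply: H => //; first by rewrite E1 eqxx.
  by move=> x xd; rewrite E1 ifN //; lia.
- move=> /andP[da xr] _ H.
  apply: along_wconst => //=; first lia.
  move=> c1 f1 r1 E1.
  have E : warith Add (wval c1 (Dir d)) (wval c1 (Dir x)) = sv st x.
    by rewrite /wval /= !E1 eqxx ifN ?cS //; lia.
  apply: along_wop => //=; first lia.
    by rewrite -[_ + _]/(warith Add _ _) E -cS //; apply: wget_le.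
  move=> c2 f2 r2 E2; apply: H => //; rewrite ?r2 ?E2 ?eqxx // => y yd.
  by rewrite E2 ifN ?E1 ?ifN //; lia.
- move=> /and3P[a3 da wf] [se aB] H; apply/along_cat.
  apply: (IH) => // c1 f1 r1 E1 O1.
  apply: addr_code_ok => //; first by rewrite E1.
  move=> c2 f2 r2 E2 O2.
  apply: along_wconst => //=; first lia.
  move=> c3 f3 r3 E3.
  have V : warith Add (wval c3 (Ind d)) (wval c3 (Dir d.+1)) = av st a (ev st e).
    rewrite /wval /= !E3 eqxx (_ : d == d.+1 = false); last lia.
    rewrite E2 E1 ifN; last by rewrite /cell; lia.
    by rewrite addn0 O2 ?O1 ?cA // /cell; lia.
  apply: along_wop => //=; first lia.
    by rewrite -[_ + _]/(warith Add _ _) V -cA //; apply: wget_le.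
  move=> c4 f4 r4 E4; apply: H => //; rewrite ?r4 ?r3 ?r2 ?r1 ?E4 ?eqxx // => y yd.
  rewrite E4 ifN ?E3 ?ifN ?O2 ?O1 //; lia.
- move=> /andP[wf1 wf2] [s1 s2 oB] H; apply/along_cat.
  apply: IH1 => // c1 f1 r1 E1 O1; apply/along_cat.
  apply: IH2 => //; first by move=> x xr; rewrite O1 ?cS //; lia.
  - by move=> a i a3; rewrite O1 ?cA // /cell; lia.
  - lia.
  move=> c2 f2 r2 E2 O2.
  have da := wexp_wf_lt wf1.
  have V : warith o (wval c2 (Dir d)) (wval c2 (Dir d.+1)) =
      warith o (ev st e1) (ev st e2).
    by rewrite /wval /= E2 O2 ?E1 //; lia.
  apply: along_wop => //=; first lia.
    (* Difference and quotient remain; both are at most the first operand, which is a stored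
       word. *)
    rewrite V; case: o oB {H V} => //= _; rewrite -E1.
      by apply: leq_trans (wget_le _ f1); apply: leq_subr.
    by apply: leq_trans (wget_le d f1); apply: leq_div.
  move=> c3 f3 r3 E3; apply: H => //; rewrite ?r3 ?r2 ?r1 ?E3 ?eqxx // => x xd.
  by rewrite E3 ifN ?O2 ?O1 //; lia.
Qed.

Lemma sim_w c st c' :
  sim c st -> fit c' -> rmem c' = rmem c ->
  (forall x, (x < tbase) || (abase <= x) -> wget c' x = wget c x) -> sim c' st.
Proof.
case=> _ hS hB hA hR hI f' r' O; split=> // [x xr|x xr|a i a3|x xr|i iM].
- by rewrite O ?hS //; lia.
- by rewrite O ?hB //; lia.
- by rewrite O ?hA // /cell; lia.
- by rewrite /rget r'; apply: hR.
- by rewrite /rget r'; apply: hI.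
Qed.

Lemma sim_comp_wexp c st e d Q : sim c st ->
  tbase <= d -> wexp_wf e d -> sf st e ->
  (forall c', sim c' st -> wget c' d = ev st e ->
     (forall x, (x < d) -> wget c' x = wget c x) -> Q c') ->
  along (comp_wexp e d) c Q.
Proof.
move=> sc td wf se H; case: (sc) => fc hS hB hA hR hI.
apply: (comp_wexp_ok fc hS hA) => // c' f' r' E O; apply: H => //.
  by apply: sim_w f' r' _ => // x xd; apply: O; lia.
by move=> x xd; apply: O; rewrite xd.
Qed.

Lemma sim_putR c st x v c' : sim c st -> x < 4 -> fit c' -> wmem c' = wmem c ->
  (forall y, rget c' y = if y == M + x then v else rget c y) ->
  sim c' (putR st x v).
Proof.
case=> _ hS hB hA hR hI x4 f' w' E.
split=> // [y yr|y yr|a i a3|y yr|i iM] /=; rewrite /wget ?w'.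
- exact: hS.
- exact: hB.
- exact: hA.
- by rewrite E eqn_add2l updE; case: eqP => // _; apply: hR.
- by rewrite E ifN ?hI //; lia.
Qed.

Lemma sim_putI c st i v c' : sim c st -> i < M -> fit c' -> wmem c' = wmem c ->
  (forall y, rget c' y = if y == i then v else rget c y) ->
  sim c' (putI st i v).
Proof.
case=> _ hS hB hA hR hI x4 f' w' E.
split=> // [y yr|y yr|a j a3|y yr|j iM] /=; rewrite /wget ?w'.
- exact: hS.
- exact: hB.
- exact: hA.
- by rewrite E ifN ?hR //; lia.
- by rewrite E updE; case: eqP => // _; apply: hI.
Qed.

Definition prim p : bool :=
  match p with Seq _ _ | If _ _ _ | While _ _ _ => false | _ => true end.

Lemma sim_radr c st x : sim c st -> x < 4 -> address c (Ind (rbase + x)) = M + x.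
Proof. by move=> s x4; rewrite /= (simB s). Qed.

Lemma prim_ok p Q st l c : prim p -> cmd_wf p -> sim c st -> wp p Q st ->
  along (compile l p) c (fun c' => exists2 st', sim c' st' & Q st').
Proof.
case: p => [|d e|a e1 e2|d k|o d x y|d e|e x|? ?|? ? ?|? ? ?] // _ /=.
- by move=> _ sc q; apply: along_nil; exists st.
- move=> /andP[dr wf] sc [se q]; apply/along_cat.
  apply: (sim_comp_wexp sc) => // c1 s1 E1 O1; have f1 := sim_fit s1.
  apply: along_wconst => //=; first lia.
  move=> c2 f2 r2 E2.
  have V : warith Add (wval c2 (Dir d)) (wval c2 (Dir tbase)) = ev st e.
    by rewrite /wval /= !E2 eqxx ifN //; lia.
  apply: along_wop => //=; first lia.
    by rewrite -[_ + _]/(warith Add _ _) V -E1; apply: (wget_le _ (sim_fit s1)).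
  move=> c3 f3 r3; rewrite [_ + _]V => E3.
  apply: along_nil; exists (putS st d (ev st e)) => //; case: s1 => _ hS hB hA hR hI.
  split=> // [x xr|x xr|a i a3|x xr|i iM] /=.
  + by rewrite updE E3 E2; case: eqP => // _; apply: hS.
  + by rewrite E3 E2 !ifN ?hB //; lia.
  + by rewrite E3 E2 !ifN ?hA // /cell; lia.
  + by rewrite /rget r3 r2; apply: hR.
  + by rewrite /rget r3 r2; apply: hI.
- move=> /and3P[a3 wf1 wf2] sc [se1 se2 aB q]; apply/along_cat.
  apply: (sim_comp_wexp sc) => // c1 s1 E1 O1; apply/along_cat.
  apply: (sim_comp_wexp s1) => // c2 s2 E2 O2.
  apply: addr_code_ok => //; [exact: sim_fit s2|by rewrite E2|].
  rewrite E2 => c3 f3 r3 E3 O3.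
  (* The cell cleared through the pointer is not the pointer itself, since arrays start beyond the
     temporaries. *)
  have cE : tbase.+1 == cell a (ev st e1) = false by rewrite /cell; lia.
  apply: along_wconst => //=; first by rewrite E3.
  rewrite E3 => c4 f4 r4 E4.
  have A4 : wget c4 tbase.+1 = cell a (ev st e1) by rewrite E4 cE.
  have V : warith Add (wval c4 (Ind tbase.+1)) (wval c4 (Dir tbase)) = ev st e2.
    rewrite /wval [address _ _]A4 /= !E4 eqxx add0n.
    by rewrite O3 // O2.
  apply: along_wop => //=; first by rewrite A4.
    by rewrite -[_ + _]/(warith Add _ _) V -E1; apply: (wget_le _ (sim_fit s1)).
  move=> c5 f5 r5; rewrite [_ + _]V A4 => E5.
  apply: along_nil; exists (putA st a (ev st e1) (ev st e2)) => //; case: s2 => _ hS hB hA hR hI.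
  split=> // [x xr|x xr|b i b3|x xr|i iM] /=.
  + by rewrite E5 E4 !ifN ?O3 ?hS // /cell; lia.
  + by rewrite E5 E4 !ifN ?O3 ?hB // /cell; lia.
  + rewrite E5 E4 !updE; case: (eqVneq b a) => [->|ba].
      rewrite updE /cell eqn_add2r eqn_add2l eqn_mul2l /=; case: eqP => // _.
      by rewrite O3 ?hA // /cell; lia.
    rewrite !ifN; first by rewrite O3 ?hA // /cell; lia.
      by rewrite /cell; lia.
    by rewrite /cell; lia.
  + by rewrite /rget r5 r4 r3; apply: hR.
  + by rewrite /rget r5 r4 r3; apply: hI.
- move=> d4 sc q; have A := sim_radr sc d4; have fc := sim_fit sc.
  apply: along_rconst => //.
    by rewrite A; lia.
  rewrite A => c1 f1 w1 E1; apply: along_nil; exists (putR st d k%:R) => //.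
  exact: sim_putR E1.
- move=> /and3P[d4 x4 y4] sc q; have A := sim_radr sc d4; have fc := sim_fit sc.
  apply: along_rop => //.
    by rewrite A; lia.
  have V : rarith o (rval c (Ind (rbase + x))) (rval c (Ind (rbase + y))) =
      rarith o (rv st x) (rv st y).
    by rewrite /rval !(sim_radr sc) // !(simR sc).
  rewrite A V => c1 f1 w1 E1; apply: along_nil.
  exists (putR st d (rarith o (rv st x) (rv st y))) => //.
  exact: sim_putR E1.
- move=> /andP[d4 wf] sc [se eM q]; apply/along_cat.
  apply: (sim_comp_wexp sc) => // c1 s1 E1 O1; have f1 := sim_fit s1.
  have A := sim_radr s1 d4.
  apply: along_rop => //; first by rewrite A; lia.
  have V : rarith Add (rval c1 (Ind (rbase + d))) (rval c1 (Ind tbase)) =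
      (rv st d + iv st (ev st e))%R.
    by rewrite /rval A /= E1 (simR s1) // (simI s1).
  rewrite A V => c2 f2 w2 E2; apply: along_nil.
  exists (putR st d (rv st d + iv st (ev st e))%R) => //.
  exact: sim_putR E2.
- move=> /andP[x4 wf] sc [se eM q]; apply/along_cat.
  apply: (sim_comp_wexp sc) => // c1 s1 E1 O1; have f1 := sim_fit s1.
  apply: along_rconst => //=; first by rewrite E1; lia.
  rewrite E1 => c2 f2 w2 E2.
  have s2 : sim c2 (putI st (ev st e) 0%R) by apply: sim_putI E2.
  have A2 : address c2 (Ind tbase) = ev st e by rewrite /= /wget w2.
  apply: along_rop => //; first by rewrite A2; lia.
  have V : rarith Add (rval c2 (Ind tbase)) (rval c2 (Ind (rbase + x))) = rv st x.
    by rewrite /rval A2 (sim_radr s2) //= E2 eqxx (simR s2) //= add0r.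
  rewrite A2 V => c3 f3 w3 E3; apply: along_nil.
  exists (putI st (ev st e) (rv st x)) => //.
  apply: (sim_putI s1 eM f3); first by rewrite w3.
  by move=> y; rewrite E3 E2; case: eqP.
Qed.

Lemma comp_prim p l : prim p -> compile l p = compile 0 p.
Proof. by case: p. Qed.

Lemma size_comp_cond b l : size (comp_cond b l) = cond_size b.
Proof. by case: b => [e1 e2|x y]; rewrite /cond_size /= ?size_cat. Qed.

Lemma reach_mono P c t t' (Q : config R -> Prop) :
  t <= t' -> reach P c t Q -> reach P c t' Q.
Proof. by move=> tt' [u ut H]; exists u => //; apply: leq_trans tt'. Qed.

Lemma cond_reach P c b st l t (Q : config R -> Prop) :
  sim c st -> cond_wf b -> sfc st b -> at_pos P (pc c) (comp_cond b l) ->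
  (forall c', sim c' st ->
     pc c' = (if evc st b then pc c + cond_size b else l) -> reach P c' t Q) ->
  reach P c (cond_size b + t) Q.
Proof.
case: b => [e1 e2|x y] sc /=; last first.
  move=> /andP[x4 y4] _ Pc H; apply: (reach_step Pc (sim_fit sc)).
  apply: H; first by case: sc => *; split.
  rewrite /= /rval !(sim_radr sc) // !(simR sc) // leNgt addn1.
  by rewrite if_neg.
move=> /andP[wf1 wf2] [se1 se2]; rewrite /cond_size /= size_cat /=.
set code := comp_wexp _ _ ++ comp_wexp _ _ => Pc H.
have /at_cat[Pc1 Pc2] := Pc; rewrite -addnA add1n.
apply: (@along_reach P c code _ (fun c' => [/\ sim c' st,
  wget c' tbase = ev st e1 & wget c' tbase.+1 = ev st e2])) => //.
- exact: sim_fit sc.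
- apply/along_cat; apply: (sim_comp_wexp sc) => // c1 s1 E1 O1.
  by apply: (sim_comp_wexp s1) => // c2 s2 E2 O2; split=> //; rewrite O2.
move=> c' f' pc' [s' E1 E2]; rewrite -pc' in Pc2.
apply: (reach_step Pc2 f'); apply: H; first by case: s' => *; split.
rewrite /= /wval /= E1 E2 pc' leqNgt if_neg size_cat.
by rewrite /= addn1 addnS.
Qed.

Lemma at_jump P c l t (Q : config R -> Prop) code st :
  at_pos P (pc c) (Jump l :: code) -> sim c st ->
  (forall c', sim c' st -> pc c' = l -> reach P c' t Q) -> reach P c t.+1 Q.
Proof.
move=> Pc sc H; apply: (reach_step Pc (sim_fit sc)).
by apply: H => //; case: sc => *; split.
Qed.

Lemma prim_reach p Q st P c l : prim p -> cmd_wf p -> wp p Q st ->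
  pc c = l -> at_pos P l (compile l p) -> sim c st ->
  reach P c (time p) (fun c' => pc c' = l + size (compile l p) /\
                        exists2 st', sim c' st' & Q st').
Proof.
move=> pp wf H <-; rewrite !(comp_prim _ pp) => Pc sc.
have -> : time p = size (compile 0 p) + 0 by rewrite addn0; case: (p) pp.
apply: (along_reach Pc (sim_fit sc) (prim_ok 0 pp wf sc H)) => c' f' pc' q'.
exact: reach0.
Qed.

(** Structural induction, with the position [l] general because jumps are absolute. For a loop, an
    inner induction on the ghost bound returns to the same [l] after each pass. *)
Theorem wp_sound p Q st P c l : cmd_wf p -> wp p Q st ->
  pc c = l -> at_pos P l (compile l p) -> sim c st ->
  reach P c (time p) (fun c' => pc c' = l + size (compile l p) /\
                        exists2 st', sim c' st' & Q st').
Proof.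
elim: p Q st c l => [|d e|a e1 e2|d k|o d x y|d e|e x|p1 IH1 p2 IH2|b p1 IH1 p2 IH2|it b p IH] Q st c l;
  try exact: prim_reach.
- move=> /= /andP[wf1 wf2] H pcl /at_cat[Pc1 Pc2] sc.
  apply: (reach_bind (IH1 _ _ _ _ wf1 H pcl Pc1 sc)) => c1 [pc1 [st1 s1 H1]].
  move: (IH2 _ _ _ _ wf2 H1 pc1 Pc2 s1).
  by rewrite size_cat addnA.
- move=> /= /and3P[wfb wf1 wf2] [sb H] pcl; set l1 := l + cond_size b.
  set l2 := l1 + _ + 1 => /at_cat[Pb]; rewrite size_comp_cond => /at_cat[P1].
  move=> Pj; have := Pj; rewrite -cat1s => /at_cat[_ P2] sc; rewrite -pcl in Pb.
  apply: (cond_reach sc wfb sb Pb) => c1 s1; rewrite pcl.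
  rewrite !size_cat size_comp_cond /=; case: ifP H => _ H pc1.
    apply: (@reach_mono _ _ (time p1 + 1)); first lia.
    apply: (reach_bind (IH1 _ _ _ _ wf1 H pc1 P1 s1)) => c2 [pc2 [st2 s2 H2]].
    rewrite -pc2 in Pj; apply: (at_jump Pj s2) => c3 s3 pc3.
    apply: reach0; [exact: sim_fit s3|split; last by exists st2].
    by rewrite pc3 /l2; lia.
  apply: (@reach_mono _ _ (time p2)); first lia.
  have P2' : at_pos P l2 (compile l2 p2) by exact: P2.
  move: (IH2 _ _ _ _ wf2 H pc1 P2' s1).
  set e1 := _ + size _; set e2 := _ + (_ + _).
  by have -> : e1 = e2 by rewrite /e1 /e2 /l2; lia.
- move=> /= /andP[wfb wf] H pcl; set l1 := l + cond_size b.
  set code1 := compile l1 p; set l2 := l1 + _ + 1 => /at_cat[Pb].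
  rewrite size_comp_cond => /at_cat[P1 Pj].
  have -> : l + size (comp_cond b l2 ++ code1 ++ [:: Jump l]) = l2.
    by rewrite !size_cat size_comp_cond /l2 /l1 /=; lia.
  change (wp (While it b p) Q st) in H.
  elim: it st c H pcl => [|it IHit] st c; rewrite wp_while0 => -[sb H] pcl sc;
    rewrite -pcl in Pb.
    rewrite mul0n add0n -[cond_size b]addn0.
    apply: (cond_reach sc wfb sb Pb) => c1 s1; case: ifP H => // _ H pc1.
    by apply: reach0; [exact: sim_fit s1|split=> //; exists st].
  rewrite mulSn -!addnA; apply: (cond_reach sc wfb sb Pb) => c1 s1; rewrite pcl.
  case: ifP H => _ H pc1.
    apply: (reach_bind (IH _ _ _ _ wf H pc1 P1 s1)) => c2 [pc2 [st2 s2 H2]].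
    rewrite add1n; rewrite -pc2 in Pj; apply: (at_jump Pj s2) => c3 s3 pc3.
    exact: IHit H2 pc3 s3.
  by apply: reach0; [exact: sim_fit s1|split=> //; exists st].
Qed.

(** A halted machine no longer changes, so an execution that ends early can be prolonged to exactly
    [t] steps without affecting space or result. *)
Lemma reach_computes P c t (Q Q' : config R -> Prop) :
  reach P c t Q -> (forall c', Q c' -> size P <= pc c' /\ Q' c') ->
  computes_within P t (B + B) c Q'.
Proof.
case=> u ut [fu q] /(_ _ q)[sz q'].
have stop v : run P v (run P u c) = run P u c.
  by elim: v => //= v IH; rewrite {1}/run /= -/(run _ _ _) IH /step onth_default.
have runE v : u <= v -> run P v c = run P u c.
  by move=> uv; rewrite -[in RHS](stop (v - u)) /run -iterD subnK.
split; rewrite ?runE //.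
by move=> v vt; case: (leqP v u) => [/fu //|/ltnW /runE ->]; apply: fu.
Qed.

End HighLevel.

(** * Sort keys *)

Section Lex.
Variable R : realType.
Implicit Types f g : nat -> R.

Definition lexseq p f : seqlexi R := mkseq f p.

(** The form in which the row loop [p_rows] detects a difference; [lexseqP] ties it to the library
    order on sequences, which supplies totality and transitivity. *)
Definition first_lt p f g := exists i, [/\ i < p, forall j, j < i -> f j = g j & (f i < g i)%R].

Lemma lexseqS p f : lexseq p.+1 f = f 0 :: lexseq p (f \o succn).
Proof. by rewrite /lexseq /mkseq /= (iotaDl 1 0) -map_comp. Qed.

Lemma lexseqP p f g : (lexseq p f < lexseq p g)%O <-> first_lt p f g.
Proof.
elim: p f g => [|p IH] f g.
  by split=> [|[i []]//]; rewrite ltxx.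
rewrite !lexseqS ltxi_cons; split.
  case/andP; rewrite le_eqVlt => /orP[/eqP e|l _]; last by exists 0.
  rewrite e lexx /= => /IH[i [ip eqi lti]]; exists i.+1; split=> // -[|j] //.
  exact: eqi.
case=> -[|i] [ip eqi lti]; first by rewrite ltW //= leNgt lti.
rewrite eqi // lexx /=; apply/IH; exists i; split=> // j ji; exact: (eqi j.+1).
Qed.

Lemma eq_lexseq p f g : (forall i, i < p -> f i = g i) -> lexseq p f = lexseq p g.
Proof.
move=> fg; rewrite /lexseq /mkseq; apply/eq_in_map => i.
by rewrite mem_iota => /andP[_]; apply: fg.
Qed.

Lemma lexseq_inj p f g i : lexseq p f = lexseq p g -> i < p -> f i = g i.
Proof.
by move=> e ip; rewrite -(nth_mkseq 0%R f ip) -(nth_mkseq 0%R g ip) -!/(lexseq _ _) e.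
Qed.

End Lex.

Section Maths.
Variables (R : realType) (m n k : nat) (f : nat -> R).
Let N := 2 ^ k.

Definition bit (h i : nat) : bool := odd (h %/ 2 ^ i).

(** The guard [j + i < n] implements the padding of the variables to [4 * k] positions. *)
Definition bitsum c base j h : R :=
  (\sum_(i < c) if bit h i && (j + i < n)%N then f (base + (j + i))%N else 0)%R.

Notation bsum := (bitsum k).

Definition raw base l q : R :=
  (bsum base (l %/ N * (2 * k))%N (l - l %/ N * N)%N +
   bsum base (l %/ N * (2 * k) + k)%N q)%R.

(* A leaf [l] and an index [q < N] stand for a partial assignment: for [l < N] the
   bits of [l] and [q] are the first two quarters of the variables, otherwise
   those of [l - N] and [q] are the last two.  A full assignment is a solution iff
   its two halves have the same keys. *)
Definition key l q r : R :=
  (if (0 < l %/ N)%N then f (m * n + r)%N - raw (r * n)%N l q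
   else raw (r * n)%N l q)%R.

Definition cost l q : R := raw (m * n + m) l q.

(* [q = N] encodes an exhausted leaf, which comes last.  Ties between equal keys
   are broken by the leaf, so that first halves precede second halves. *)
Definition skey_at l q i : R :=
  if i == 0 then ((q %/ N)%:R)%R
  else if i <= m then (if q < N then key l q i.-1 else 0%R)
  else if i == m.+1 then (l%:R)%R else (q%:R)%R.

Definition skey l q := lexseq m.+3 (skey_at l q).
Definition keys l q := lexseq m (key l q).

Lemma N_gt0 : 0 < N. Proof. by rewrite expn_gt0. Qed.

Lemma skey_at_row l q r : r < m -> q < N -> skey_at l q r.+1 = key l q r.
Proof. by move=> rm qN; rewrite /skey_at /= rm qN. Qed.
Lemma skey_at_leaf l q : skey_at l q m.+1 = l%:R%R.
Proof. by rewrite /skey_at /= ltnn eqxx. Qed.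
Lemma skey_at_idx l q : skey_at l q m.+2 = q%:R%R.
Proof. by rewrite /skey_at /= ifN ?ifN //; lia. Qed.
Lemma divNE q : q <= N -> q %/ N = (q == N).
Proof.
rewrite leq_eqVlt => /orP[/eqP ->|qN]; first by rewrite divnn N_gt0 eqxx.
by rewrite divn_small //; move: qN; case: eqP => // ->; rewrite ltnn.
Qed.

Lemma skey_inj l q l' q' : skey l q = skey l' q' -> l = l' /\ q = q'.
Proof.
move=> e; have := lexseq_inj e (leqnn _); have := lexseq_inj e (leqnSn _).
by rewrite !skey_at_leaf !skey_at_idx => /eqP + /eqP; rewrite !eqr_nat => /eqP + /eqP.
Qed.

Lemma skey_exh l q l' q' : q %/ N < q' %/ N -> (skey l q < skey l' q')%O.
Proof. by move=> h; apply/lexseqP; exists 0; split=> //; rewrite /skey_at /= ltr_nat. Qed.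

Lemma skey_first l q l' q' : q < N -> q' < N -> first_lt m (key l q) (key l' q') ->
  (skey l q < skey l' q')%O.
Proof.
move=> qN q'N [i [im e lt]]; apply/lexseqP; exists i.+1; split; first lia.
  move=> [|j] ji; first by rewrite /skey_at /= !divn_small.
  by rewrite !skey_at_row ?e //; lia.
by rewrite !skey_at_row.
Qed.

(** Agreement on the first [m.+1] coordinates of [skey_at]. For two exhausted leaves the row
    coordinates are all [0], so nothing is asked of them. *)
Definition tied l q l' q' := q %/ N = q' %/ N /\ (q < N -> forall r, r < m -> key l q r = key l' q' r).

Lemma tied_row l q l' q' i : tied l q l' q' -> i <= m -> skey_at l q i = skey_at l' q' i.
Proof.
case=> e H im; rewrite /skey_at; case: eqP => [_|/eqP i0]; first by rewrite e.
rewrite im; move: H; case: (ltnP q N) => qN H.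
  rewrite H //; last lia.
  by rewrite ifT // ltnNge -divn_gt0 ?N_gt0 // -e divn_small.
by rewrite ifF //; apply/negbTE; rewrite -leqNgt -divn_gt0 ?N_gt0 // -e divn_gt0 ?N_gt0.
Qed.

Lemma skey_tied_leaf l q l' q' : tied l q l' q' -> l < l' -> (skey l q < skey l' q')%O.
Proof.
move=> t ll; apply/lexseqP; exists m.+1; split; first lia.
  by move=> j jm; apply: tied_row.
by rewrite !skey_at_leaf ltr_nat.
Qed.

Lemma skey_tied_idx l q q' : tied l q l q' -> (skey l q < skey l q')%O = (q < q').
Proof.
move=> t; case: (ltngtP q q') => qq; last by rewrite qq ltxx.
  apply/lexseqP; exists m.+2; split=> //; last by rewrite !skey_at_idx ltr_nat.
  move=> j; rewrite ltnS leq_eqVlt ltnS => /orP[/eqP ->|]; first by rewrite !skey_at_leaf.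
  exact: tied_row.
apply: lt_gtF; apply/lexseqP; exists m.+2; split=> //; last by rewrite !skey_at_idx ltr_nat.
move=> j; rewrite ltnS leq_eqVlt ltnS => /orP[/eqP ->|]; first by rewrite !skey_at_leaf.
by move=> jm; apply/esym/tied_row.
Qed.

Lemma skey_keys l q l' q' : q < N -> q' < N -> (skey l q <= skey l' q')%O ->
  (keys l q <= keys l' q')%O.
Proof.
move=> qN q'N; apply: contraTT; rewrite -!ltNge => /lexseqP.
by apply: skey_first.
Qed.

Lemma keys_eq l q l' q' r : keys l q = keys l' q' -> r < m -> key l q r = key l' q' r.
Proof. by move=> e; apply: lexseq_inj. Qed.

Lemma skey_leaf l q l' q' : q < N -> q' < N -> keys l q = keys l' q' -> l < l' ->
  (skey l q < skey l' q')%O.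
Proof.
move=> qN q'N e; apply: skey_tied_leaf; split; first by rewrite !divn_small.
by move=> _ r; apply: keys_eq.
Qed.

(* Within a side, two keys with a common leaf differ by a quantity which does
   not depend on the leaf. *)
Lemma skey_translate l l' q q' : l %/ N = l' %/ N -> q <= N -> q' <= N ->
  (skey l q < skey l q')%O -> (skey l' q < skey l' q')%O.
Proof.
move=> ll qN q'N /lexseqP[i [im e lt]]; apply/lexseqP.
(* In a difference at a common leaf the contribution of the fixed block cancels, for keys [A x] as
   well as for [b - A x]. Coordinate [m.+1] holds the leaf and is treated apart. *)
have dif j : q %/ N = q' %/ N -> j != m.+1 ->
    (skey_at l q j - skey_at l q' j = skey_at l' q j - skey_at l' q' j)%R.
  move=> dq /negbTE jm; rewrite /skey_at jm; case: eqP => // _; case: ifP => _ //.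
  have -> : (q < N) = (q' < N).
    by move: dq; rewrite !divNE // !ltn_neqAle qN q'N; do 2 case: eqP.
  by case: ifP => // _; rewrite /key /raw ll; case: ifP => _; ring.
have tr j : q %/ N = q' %/ N -> skey_at l q j = skey_at l q' j -> skey_at l' q j = skey_at l' q' j.
  move=> dq ej; case: (eqVneq j m.+1) => [->|jm]; first by rewrite !skey_at_leaf.
  by apply/eqP; rewrite -subr_eq0 -dif // ej subrr.
case: (posnP i) => [i0|i0].
  by exists i; split=> //; move: lt; rewrite i0.
have dq : q %/ N = q' %/ N.
  by have := e _ i0; rewrite /skey_at /= => /eqP; rewrite eqr_nat => /eqP.
exists i; split=> // [j ji|]; first by apply: tr => //; apply: e.
(* With a common leaf, the first difference cannot be at the leaf coordinate. *)
case: (eqVneq i m.+1) => [im1|im1]; first by move: lt; rewrite im1 !skey_at_leaf ltxx.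
by rewrite -subr_lt0 -dif // subr_lt0.
Qed.

(** * Assignments as four binary words *)

Lemma bitS h i : bit h i.+1 = bit (h %/ 2) i.
Proof. by rewrite /bit expnS divnMA. Qed.

Lemma bitsum0 c base j : bitsum c base j 0 = 0%R.
Proof. by rewrite /bitsum big1 // => i _; rewrite /bit div0n. Qed.

Lemma bitsumS c base j h : bitsum c.+1 base j h =
  ((if odd h && (j < n)%N then f (base + j)%N else 0) + bitsum c base j.+1 (h %/ 2))%R.
Proof.
rewrite /bitsum big_ord_recl /= /bit expn0 divn1 addn0; congr (_ + _)%R.
by apply: eq_bigr => i _; rewrite -/(bit _ _) -/(bit _ _) /bump add1n bitS addSnnS.
Qed.

Lemma bits_of c (x : nat -> bool) :
  exists2 h, h < 2 ^ c & forall i, i < c -> bit h i = x i.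
Proof.
elim: c x => [|c IH] x; first by exists 0.
have [h hc hx] := IH (x \o succn); exists (x 0 + 2 * h).
  by rewrite expnS; case: (x 0); lia.
move=> [|i] ic; first by rewrite /bit expn0 divn1 oddD oddM; case: (x 0).
rewrite bitS -[RHS](hx i) //; congr bit.
by rewrite mulnC divnDr ?dvdn_mull // mulnK //; case: (x 0).
Qed.

Definition xof a0 a1 a2 a3 j := bit (nth 0 [:: a0; a1; a2; a3] (j %/ k)) (j %% k).

Definition xsum base (x : nat -> bool) : R :=
  (\sum_(j < n) if x j then f (base + j)%N else 0)%R.

Hypothesis nk : n <= 4 * k.

Lemma xsum_xof base a0 a1 a2 a3 : xsum base (xof a0 a1 a2 a3) =
  (bsum base 0 a0 + bsum base k a1 + (bsum base (2 * k)%N a2 + bsum base (3 * k)%N a3))%R.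
Proof.
pose G j : R := if xof a0 a1 a2 a3 j && (j < n) then f (base + j) else 0%R.
(* Extended by the padding positions, the sum can be cut into four blocks of equal length. *)
have -> : xsum base (xof a0 a1 a2 a3) = (\sum_(0 <= j < 4 * k) G j)%R.
  rewrite (big_cat_nat (leq0n _) nk) /= [X in (_ + X)%R]big_nat_cond.
  rewrite [X in (_ + X)%R]big1 ?addr0; last first.
    by move=> j; rewrite andbT /G leqNgt => /andP[/negbTE -> _]; rewrite andbF.
  rewrite big_mkord; apply: eq_bigr => j _.
  by rewrite /G ltn_ord andbT.
have blk g a : g < 4 -> nth 0 [:: a0; a1; a2; a3] g = a ->
    (\sum_(g * k <= j < g * k + k) G j)%R = bsum base (g * k) a.
  move=> g4 <-; rewrite -{1}[g * k]add0n big_addn addKn big_mkord.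
  apply: eq_bigr => i _; rewrite /G /xof addnC.
  have k0 : 0 < k by case: (k) i => // -[].
  by rewrite divnMDl // divn_small // addn0 modnMDl modn_small.
rewrite (@big_cat_nat _ _ _ (2 * k)) //=; [|lia].
rewrite (@big_cat_nat _ _ _ k 0 (2 * k)) //=; [|lia].
rewrite (@big_cat_nat _ _ _ (3 * k) (2 * k) (4 * k)) //=; [|lia|lia].
have := blk 0 a0 isT erefl; rewrite mul0n add0n => ->.
have := blk 1 a1 isT erefl; rewrite mul1n addnn -mul2n => ->.
have := blk 2 a2 isT erefl; rewrite -[X in 2 * k + X]mul1n -mulnDl => ->.
by have := blk 3 a3 isT erefl; rewrite -[X in 3 * k + X]mul1n -mulnDl => ->.
Qed.

Lemma raw0 base l q : l < N -> raw base l q = (bsum base 0 l + bsum base k q)%R.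
Proof. by move=> lN; rewrite /raw divn_small // mul0n subn0 add0n. Qed.

Lemma side1 l : N <= l -> l < 2 * N -> l %/ N = 1.
Proof.
move=> Nl lN; apply/eqP; rewrite eqn_leq divn_gt0 ?N_gt0 // Nl andbT.
by rewrite -ltnS ltn_divLR ?N_gt0.
Qed.

Lemma raw1 base l q : N <= l -> l < 2 * N ->
  raw base l q = (bsum base (2 * k) (l - N)%N + bsum base (3 * k) q)%R.
Proof.
move=> Nl lN; rewrite /raw side1 // !mul1n; congr (_ + bitsum _ _ _ _)%R; lia.
Qed.

Lemma keys_match l q l' q' : l < N -> N <= l' -> l' < 2 * N ->
  keys l q = keys l' q' <->
  (forall r, r < m -> xsum (r * n) (xof l q (l' - N) q') = f (m * n + r)).
Proof.
move=> lN Nl' l'N.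
have kE r : (key l q r = key l' q' r) <->
    (xsum (r * n) (xof l q (l' - N) q') = f (m * n + r)).
  rewrite xsum_xof -raw0 // -raw1 // /key divn_small //= side1 //=; split.
    by move=> ->; rewrite subrK.
  by move=> <-; rewrite addrK.
split=> [e r rm|e]; first by apply/kE/keys_eq.
by apply: eq_lexseq => r rm; apply/kE/e.
Qed.

Lemma cost_match l q l' q' : l < N -> N <= l' -> l' < 2 * N ->
  (cost l q + cost l' q')%R = xsum (m * n + m) (xof l q (l' - N) q').
Proof. by move=> lN Nl' l'N; rewrite xsum_xof /cost raw0 // raw1. Qed.

Lemma xof_onto (x : nat -> bool) : exists l q l' q',
  [/\ l < N, q < N, N <= l' < 2 * N, q' < N &
      forall j, j < n -> xof l q (l' - N) q' j = x j].
Proof.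
have [a0 h0 e0] := bits_of k x.
have [a1 h1 e1] := bits_of k (fun i => x (k + i)).
have [a2 h2 e2] := bits_of k (fun i => x (2 * k + i)).
have [a3 h3 e3] := bits_of k (fun i => x (3 * k + i)).
exists a0, a1, (a2 + N), a3; split=> //; first by rewrite leq_addl mul2n -addnn ltn_add2r.
move=> j jn; have k0 : 0 < k by lia.
rewrite addnK /xof {3}(divn_eq j k).
have jk := ltn_pmod j k0; have : j %/ k < 4 by rewrite ltn_divLR //; lia.
by case: (j %/ k) => [|[|[|[|]]]] //= _; rewrite ?e0 ?e1 ?e2 ?e3 ?mul1n.
Qed.

Definition isnext l p b := [/\ b <= N, (skey l p < skey l b)%O &
  forall q, q <= N -> (skey l p < skey l q)%O -> (skey l b <= skey l q)%O].

(** Translation is used both ways: an index strictly between [p] and [b] at [l'] would also lie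
    between them at [l]. This is what lets one table per side serve all [N] leaves of the side. *)
Lemma isnext_translate l l' p b : l %/ N = l' %/ N -> p < N ->
  isnext l p b -> isnext l' p b.
Proof.
move=> ll pN [bN pb H]; have pN' := ltnW pN; split=> //.
  exact: skey_translate pb.
move=> q qN pq; rewrite leNgt; apply/negP => qb.
have := H _ qN (skey_translate (esym ll) pN' qN pq).
by rewrite leNgt (skey_translate (esym ll) qN bN qb).
Qed.

(** * The merge *)

Section Merge.
Variables (cur : nat -> nat) (el eq b : nat).
Hypotheses (eqE : eq = cur el) (el2N : el < 2 * N) (eqN : eq < N).
Hypothesis emin : forall l, l < 2 * N -> (skey el eq <= skey l (cur l))%O.
Hypothesis eb : isnext el eq b.

(** No record of the output is kept: what has been enumerated is recovered from the current
    positions alone. *)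
Definition done (cur : nat -> nat) l q :=
  [/\ l < 2 * N, q < N & (skey l q < skey l (cur l))%O].

Let cur' := upd cur el b.

(** Nothing lies strictly between a position and its successor, so a pop enumerates one pair, and
    injectivity of [skey] identifies it. *)
Lemma done_step l q : done cur' l q <-> done cur l q \/ l = el /\ q = eq.
Proof.
case: eb => bN pb nb; rewrite /done /cur' updE; case: eqP => [->|ne]; last first.
  by split; [left|case=> // -[]].
split=> [[_ qN qb]|[[_ qN lt]|[_ ->]]]; last by [].
  have : (skey el q <= skey el eq)%O.
    by rewrite leNgt; apply/negP => /(nb _ (ltnW qN)); rewrite leNgt qb.
  by rewrite le_eqVlt => /orP[/eqP/skey_inj[_ ->]|]; [right|left; rewrite -eqE].
by split=> //; apply: lt_trans pb; rewrite eqE.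
Qed.

Lemma lt_cur' l : l < 2 * N -> (skey el eq < skey l (cur' l))%O.
Proof.
move=> lN; rewrite /cur' updE; case: eqP => [->|ne]; first by case: eb.
by rewrite lt_neqAle emin // andbT; apply/eqP => /skey_inj[/esym].
Qed.

Lemma le_cur' l : l < 2 * N -> (skey l (cur l) <= skey l (cur' l))%O.
Proof.
move=> lN; rewrite /cur' updE; case: eqP => [->|] //.
by rewrite -eqE ltW //; case: eb.
Qed.

(* If [hm] is set, [(ml, mq)] is the cheapest first half among those with the
   largest key enumerated so far. *)
Definition memI cur hm ml mq :=
  (forall l q, l < N -> done cur l q -> 0 < hm /\
     ((keys l q < keys ml mq)%O \/
      keys l q = keys ml mq /\ (cost ml mq <= cost l q)%R)) /\
  (0 < hm -> [/\ ml < N, mq < N &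
     forall l, l < 2 * N -> (skey ml mq < skey l (cur l))%O]).

(* If [hb] is set, [(l0, q0)] and [(l1, q1)] form a cheapest solution, of cost
   [c], among those whose second half has been enumerated. *)
Definition bestI cur hb l0 q0 l1 q1 (c : R) :=
  (forall l q l' q', N <= l -> done cur l q -> l' < N -> q' < N ->
     keys l' q' = keys l q -> 0 < hb /\ (c <= cost l' q' + cost l q)%R) /\
  (0 < hb -> [/\ hb = 1, l0 < N /\ q0 < N, N <= l1 < 2 * N /\ q1 < N,
     keys l0 q0 = keys l1 q1 & c = (cost l0 q0 + cost l1 q1)%R]).

Lemma memI_new hm ml mq : memI cur hm ml mq -> el < N ->
  (0 < hm -> keys ml mq = keys el eq -> (cost el eq <= cost ml mq)%R) ->
  memI cur' 1 el eq.
Proof.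
move=> [m1 m2] elN H; split=> [l q lN /done_step[]|_].
- move=> dl; have [hm0 m3] := m1 _ _ lN dl; split=> //.
  have [mlN mqN mlt] := m2 hm0.
  have : (keys ml mq <= keys el eq)%O.
    by apply: skey_keys => //; rewrite ltW // eqE; apply: mlt.
  rewrite le_eqVlt => /orP[/eqP e|lt]; last first.
    by left; case: m3 => [/lt_trans|[->]] //; apply.
  rewrite -e; case: m3 => [|[-> le]]; [by left|right].
  by split=> //; apply: le_trans le; apply: H.
- by case=> -> ->; split=> //; right.
- by split=> // l; apply: lt_cur'.
Qed.

Lemma memI_keep hm ml mq : memI cur hm ml mq ->
  (el < N -> [/\ 0 < hm, keys ml mq = keys el eq & (cost ml mq <= cost el eq)%R]) ->
  memI cur' hm ml mq.
Proof.
move=> [m1 m2] H; split=> [l q lN /done_step[|[le qe]]|hm0].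
- exact: m1.
- by rewrite le qe in lN *; have [-> -> le'] := H lN; split=> //; right.
- have [mlN mqN mlt] := m2 hm0; split=> // l lN.
  exact: lt_le_trans (mlt _ lN) (le_cur' lN).
Qed.

Lemma bestI_keep hb l0 q0 l1 q1 c : bestI cur hb l0 q0 l1 q1 c ->
  (forall l' q', N <= el -> l' < N -> q' < N -> keys l' q' = keys el eq ->
     0 < hb /\ (c <= cost l' q' + cost el eq)%R) ->
  bestI cur' hb l0 q0 l1 q1 c.
Proof.
move=> [b1 b2] H; split=> // l q l' q' Nl /done_step[|[le qe]]; first exact: b1.
by rewrite le qe in Nl *; apply: H.
Qed.

(** The crux of the merge. Ties are broken by the leaf, and leaves of first halves are smaller, so
    every first half matching the popped second half has been enumerated before. The remembered key
    is therefore at least the popped one, and by the order of popping at most it: the memory holds a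
    cheapest match. *)
Lemma done_match hm ml mq l' q' : memI cur hm ml mq -> N <= el -> l' < N -> q' < N ->
  keys l' q' = keys el eq ->
  [/\ 0 < hm, keys ml mq = keys el eq & (cost ml mq <= cost l' q')%R].
Proof.
move=> [m1 m2] Nel l'N q'N e.
have l'2N : l' < 2 * N by lia.
have d' : done cur l' q'.
  split=> //; apply: lt_le_trans (emin l'2N); apply: skey_leaf => //.
  exact: leq_trans Nel.
have [hm0 m3] := m1 _ _ l'N d'; have [mlN mqN mlt] := m2 hm0.
have : (keys ml mq <= keys el eq)%O.
  by apply: skey_keys => //; rewrite ltW // eqE; apply: mlt.
by rewrite -e; case: m3 => [lt|[-> ?]] //; rewrite leNgt lt.
Qed.

Lemma bestI_none hm ml mq hb l0 q0 l1 q1 c : memI cur hm ml mq ->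
  bestI cur hb l0 q0 l1 q1 c -> ~ (0 < hm /\ keys ml mq = keys el eq) ->
  bestI cur' hb l0 q0 l1 q1 c.
Proof.
move=> mI bI H; apply: bestI_keep => // l' q' Nel l'N q'N e.
by have [h1 h2 _] := done_match mI Nel l'N q'N e; case: H.
Qed.

Lemma bestI_worse hm ml mq hb l0 q0 l1 q1 c : memI cur hm ml mq ->
  bestI cur hb l0 q0 l1 q1 c -> 0 < hb ->
  (c <= cost ml mq + cost el eq)%R -> bestI cur' hb l0 q0 l1 q1 c.
Proof.
move=> mI bI hb0 le; apply: bestI_keep => // l' q' Nel l'N q'N e.
have [_ _ le'] := done_match mI Nel l'N q'N e; split=> //.
by apply: le_trans le _; rewrite lerD2r.
Qed.

Lemma bestI_new hm ml mq hb l0 q0 l1 q1 c : memI cur hm ml mq ->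
  bestI cur hb l0 q0 l1 q1 c -> 0 < hm -> N <= el -> keys ml mq = keys el eq ->
  (0 < hb -> (cost ml mq + cost el eq <= c)%R) ->
  bestI cur' 1 ml mq el eq (cost ml mq + cost el eq)%R.
Proof.
move=> mI [b1 b2] hm0 Nel e H; case: (mI) => _ /(_ hm0)[mlN mqN _].
split=> [l q l' q' Nl /done_step[d|[-> ->]] l'N q'N e'|_]; last 2 first.
- have [_ _ le'] := done_match mI Nel l'N q'N e'; split=> //.
  by rewrite lerD2r.
- by split=> //; rewrite Nel.
have [hb0 le] := b1 _ _ _ _ Nl d l'N q'N e'; split=> //.
by apply: le_trans le; apply: H.
Qed.

End Merge.

Lemma memI0 cur ml mq : (forall l q, ~ done cur l q) -> memI cur 0 ml mq.
Proof. by move=> nd; split=> // l q _ /nd. Qed.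

Lemma bestI0 cur l0 q0 l1 q1 c : (forall l q, ~ done cur l q) ->
  bestI cur 0 l0 q0 l1 q1 c.
Proof. by move=> nd; split=> // l q l' q' _ /nd. Qed.

Definition solution x := forall r, r < m -> xsum (r * n) x = f (m * n + r).

Lemma eq_xsum base x y : (forall j, j < n -> x j = y j) -> xsum base x = xsum base y.
Proof. by move=> xy; apply: eq_bigr => j _; rewrite xy. Qed.

(** With all leaves exhausted every second half has been enumerated, and [xof_onto] splits any
    solution into two halves with equal keys; so each solution has been taken into account. *)
Lemma bestI_final cur hb l0 q0 l1 q1 c : bestI cur hb l0 q0 l1 q1 c ->
  (forall l, l < 2 * N -> N <= cur l) ->
  hb = 1 /\ [/\ solution (xof l0 q0 (l1 - N) q1),
      c = xsum (m * n + m) (xof l0 q0 (l1 - N) q1) &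
      forall x, solution x -> (c <= xsum (m * n + m) x)%R] \/
  hb = 0 /\ forall x, ~ solution x.
Proof.
move=> [b1 b2] all; have opt x : solution x -> 0 < hb /\ (c <= xsum (m * n + m) x)%R.
  move=> sx; have [l [q [l' [q' [lN qN /andP[Nl' l'N] q'N xE]]]]] := xof_onto x.
  rewrite -(eq_xsum _ xE) -cost_match //; apply: b1 => //.
    by split=> //; apply: skey_exh; rewrite divn_small // divn_gt0 ?N_gt0 ?all.
  by apply/keys_match => // r rm; rewrite (eq_xsum _ xE) sx.
case: (posnP hb) => [hb0|hb0]; [right|left].
  by split=> // x /opt; rewrite hb0; case.
have [-> [l0N q0N] [/andP[Nl1 l1N] q1N] e cE] := b2 hb0; split=> //; split.
- by apply/keys_match.
- by rewrite cE; apply: cost_match.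
- by move=> x /opt[].
Qed.

(** The variant of the merge loop. The sentinel is not counted, so its bound is [2 * N * N]; a pop
    that exhausts a leaf still decreases it, by the pair just popped. *)
Definition remaining (cur : nat -> nat) : nat :=
  \sum_(l < 2 * N) \sum_(q < N) (skey l (cur l) <= skey l q)%O.

Lemma remaining_le cur : remaining cur <= 2 * N * N.
Proof.
rewrite /remaining -[X in _ <= X * _]card_ord -sum_nat_const.
apply: leq_sum => l _; rewrite -[X in _ <= X]card_ord -sum1_card.
by apply: leq_sum => q _; case: (_ <= _)%O.
Qed.

Lemma remaining_step cur el eq b : eq = cur el -> el < 2 * N -> eq < N ->
  isnext el eq b -> remaining (upd cur el b) < remaining cur.
Proof.
move=> eqE elN eqN [bN pb nb]; rewrite /remaining.
have le l : (\sum_(q < N) (skey l (upd cur el b l) <= skey l q)%O <=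
             \sum_(q < N) (skey l (cur l) <= skey l q)%O)%N.
  apply: leq_sum => q _; rewrite updE; case: eqP => // ->; rewrite -eqE.
  by case: (boolP (skey el b <= _)%O) => // h; rewrite (le_trans (ltW pb) h).
rewrite (bigD1 (Ordinal elN)) //= [X in _ < X](bigD1 (Ordinal elN)) //=.
rewrite -addSn leq_add //; last by apply: leq_sum => l _; apply: le.
(* The term of the popped pair drops from one to zero, and no other term grows. *)
rewrite (bigD1 (Ordinal eqN)) //= [X in _ < X](bigD1 (Ordinal eqN)) //=.
rewrite updE eqxx -eqE lexx leNgt pb /= add0n add1n ltnS.
apply: leq_sum => q _.
by case: (boolP (skey el b <= _)%O) => // h; rewrite (le_trans (ltW pb) h).
Qed.

(** * The tournament tree *)

Section Tree.

Definition elt (T cur : nat -> nat) x := skey (T x) (cur (T x)).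
Definition node T cur x :=
  (elt T cur x <= elt T cur (2 * x))%O /\ (elt T cur x <= elt T cur (2 * x).+1)%O.
(* Nodes are numbered as in a binary heap: the children of [x] are [2 * x] and
   [2 * x + 1], and [2 * N + l] is the leaf [l]; [T x] is the winner below [x]. *)
Definition onpath i x := exists d, i %/ 2 ^ d = x.
Definition anc (T : nat -> nat) x := onpath (2 * N + T x) x.

Lemma onpath_refl i : onpath i i.
Proof. by exists 0; rewrite expn0 divn1. Qed.

Lemma onpath_half i x : onpath i x <-> x = i \/ onpath (i %/ 2) x.
Proof.
split=> [[[|d] <-]|[->|[d <-]]].
- by left; rewrite expn0 divn1.
- by right; exists d; rewrite expnS divnMA.
- exact: onpath_refl.
- by exists d.+1; rewrite expnS divnMA.
Qed.

Lemma onpath_double i x e : e < 2 -> onpath i (2 * x + e) -> onpath (i %/ 2) x.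
Proof.
move=> e2 [d e_]; exists d; rewrite -divnMA mulnC divnMA e_.
by rewrite mulnC divnMDl // divn_small // addn0.
Qed.

Lemma anc_leaf T l : T (2 * N + l) = l -> anc T (2 * N + l).
Proof. by move=> e; exists 0; rewrite e expn0 divn1. Qed.

Lemma anc_upd T x e y : e < 2 -> anc T (2 * x + e) -> y = x \/ anc T y ->
  anc (upd T x (T (2 * x + e))) y.
Proof.
move=> e2 ax ay; rewrite /anc updE; case: eqP => [->|ne]; last by case: ay.
by apply/onpath_half; right; exact: onpath_double ax.
Qed.

(** A winner recorded at a node is a leaf below that node. If [x] is not above leaf [l], none of the
    winners at [x] and at its two children is [l], so moving [l] is invisible at [x]. *)
Lemma anc_not l T cur b x : 0 < x -> x < 2 * N -> ~ onpath ((2 * N + l) %/ 2) x ->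
  (forall y, 0 < y -> y < 4 * N -> anc T y) ->
  [/\ elt T (upd cur l b) x = elt T cur x,
      elt T (upd cur l b) (2 * x) = elt T cur (2 * x) &
      elt T (upd cur l b) (2 * x).+1 = elt T cur (2 * x).+1].
Proof.
move=> x0 xN nx an; have N0 := N_gt0.
have ne y : T y != l -> elt T (upd cur l b) y = elt T cur y.
  by rewrite /elt updE => /negbTE ->.
have [d0 e0] := an x x0 ltac:(lia).
split; apply: ne; apply/eqP => Tl; apply: nx.
- rewrite Tl in e0; case: d0 e0 => [|d] e; last by exists d; rewrite -divnMA -expnS.
  by move: e; rewrite expn0 divn1; lia.
- have [d] := an (2 * x) ltac:(lia) ltac:(lia); rewrite Tl -[2 * x]addn0 => e.
  by apply: (@onpath_double _ _ 0) => //; exists d.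
- have [d] := an (2 * x).+1 ltac:(lia) ltac:(lia); rewrite Tl -[(2 * x).+1]addn1 => e.
  by apply: (@onpath_double _ _ 1) => //; exists d.
Qed.

Lemma node_cur T cur l b x : 0 < x -> x < 2 * N ->
  ~ onpath ((2 * N + l) %/ 2) x ->
  (forall y, 0 < y -> y < 4 * N -> anc T y) ->
  node T cur x -> node T (upd cur l b) x.
Proof.
move=> x0 xN nx an; rewrite /node.
by have [-> -> ->] := anc_not cur b x0 xN nx an.
Qed.

Lemma elt_upd T cur x w y :
  elt (upd T x w) cur y = if y == x then skey w (cur w) else elt T cur y.
Proof. by rewrite /elt updE; case: eqP. Qed.

Lemma node_other T cur x w y : y <> x -> y <> x %/ 2 -> node T cur y ->
  node (upd T x w) cur y.
Proof.
by move=> yx yx2; rewrite /node !elt_upd !ifN //; apply/eqP; lia.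
Qed.

Lemma node_fixed T cur x w : 0 < x ->
  (skey w (cur w) <= elt T cur (2 * x))%O -> (skey w (cur w) <= elt T cur (2 * x).+1)%O ->
  node (upd T x w) cur x.
Proof.
move=> x0 w1 w2; rewrite /node !elt_upd eqxx !ifN //; apply/eqP; lia.
Qed.

(** Induction from a node to its parent: each local condition carries the bound one level further
    down. *)
Lemma root_min T cur l : l < 2 * N ->
  (forall l, l < 2 * N -> T (2 * N + l) = l) ->
  (forall x, 0 < x -> x < 2 * N -> node T cur x) ->
  (elt T cur 1 <= skey l (cur l))%O.
Proof.
move=> lN Tl nd; have N0 := N_gt0; have Tl' := Tl l lN.
have min x : 0 < x -> x < 4 * N -> (elt T cur 1 <= elt T cur x)%O.
  elim/ltn_ind: x => -[|[|x]] // IH _ xN.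
  have [h1 h2] := nd (x.+2 %/ 2) ltac:(lia) ltac:(lia).
  apply: le_trans (IH (x.+2 %/ 2) _ _ _) _; try lia.
  case: (boolP (odd x)) => ox.
    by rewrite (_ : elt T cur x.+2 = elt T cur (2 * (x.+2 %/ 2)).+1) //; congr elt; lia.
  by rewrite (_ : elt T cur x.+2 = elt T cur (2 * (x.+2 %/ 2))) //; congr elt; lia.
have := min (2 * N + l) ltac:(lia) ltac:(lia); by rewrite [X in (_ <= X)%O]/elt Tl'.
Qed.

End Tree.

End Maths.

Arguments wp : simpl never.

(** * The program *)

Notation "e1 +^ e2" := (Bin Add e1 e2) (at level 50, left associativity).
Notation "e1 -^ e2" := (Bin Defs.Sub e1 e2) (at level 50, left associativity).
Notation "e1 *^ e2" := (Bin Mul e1 e2) (at level 40, left associativity).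
Notation "e1 /^ e2" := (Bin Div e1 e2) (at level 40, left associativity).
Notation "c1 ;; c2" := (Seq c1 c2) (at level 90, right associativity).

Notation vm := 0 (only parsing).
Notation vn := 1 (only parsing).
Notation vk := 2 (only parsing).
Notation vN := 3 (only parsing).
Notation vupd := 4 (only parsing).
Notation vbase := 5 (only parsing).
Notation vh := 6 (only parsing).
Notation vj := 7 (only parsing).
Notation vel := 8 (only parsing).
Notation veq := 9 (only parsing).
Notation vs := 10 (only parsing).
Notation vr := 11 (only parsing).
Notation vl1 := 12 (only parsing).
Notation vq1 := 13 (only parsing).
Notation vl2 := 14 (only parsing).
Notation vq2 := 15 (only parsing).
Notation vres := 16 (only parsing).
Notation vp := 17 (only parsing).
Notation vq := 18 (only parsing).
Notation vb := 19 (only parsing).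
Notation vx := 20 (only parsing).
Notation vta := 21 (only parsing).
Notation vtb := 22 (only parsing).
Notation vcl := 23 (only parsing).
Notation vcq := 24 (only parsing).
Notation vhm := 25 (only parsing).
Notation vml := 26 (only parsing).
Notation vmq := 27 (only parsing).
Notation vhb := 28 (only parsing).
Notation vl3 := 29 (only parsing).
Notation vq3 := 30 (only parsing).
Notation vl4 := 31 (only parsing).
Notation vq4 := 32 (only parsing).
Notation vi := 33 (only parsing).
Notation vl := 34 (only parsing).
Notation vpp := 35 (only parsing).
Notation rX := 0 (only parsing).
Notation rY := 1 (only parsing).
Notation rC := 2 (only parsing).
Notation rZ := 3 (only parsing).
Notation anxt := 0 (only parsing).
Notation acur := 1 (only parsing).
Notation atree := 2 (only parsing).

Section Program.
Variables gm gk gN : nat.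

Definition parity e := e -^ K 2 *^ (e /^ K 2).

(** The product of the parity with a truncated difference encodes the conjunction of a set bit and
    [j < n]. *)
Definition p_add :=
  While gk (CLt (K 0) (V vh))
    (If (CLt (K 0) (parity (V vh) *^ (V vn -^ V vj)))
       (AccR rX (V vbase +^ V vj)) Skip ;;
     SetS vh (V vh /^ K 2) ;;
     SetS vj (V vj +^ K 1)).

(** Adds to [rX] without clearing it, so that [p_side1] can accumulate the costs of two halves. *)
Definition p_val :=
  SetS vs (V vel /^ V vN) ;;
  SetS vh (V vel -^ V vs *^ V vN) ;;
  SetS vj (V vs *^ (K 2 *^ V vk)) ;;
  p_add ;;
  SetS vh (V veq) ;;
  SetS vj (V vs *^ (K 2 *^ V vk) +^ V vk) ;;
  p_add.

Definition p_key :=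
  SetS vbase (V vr *^ V vn) ;;
  SetR rX 0 ;;
  p_val ;;
  If (CLt (K 0) (V vs))
    (OpR Defs.Sub rX rZ rX ;; AccR rX (V vm *^ V vn +^ V vr)) Skip.

(** The result is [2] for a tie, [1] for less and [0] for greater. Starting at row [m] when the
    first index is exhausted skips the loop, and setting [vr] to [m] leaves it. *)
Definition p_rows :=
  SetS vr ((V vq1 /^ V vN) *^ V vm) ;;
  SetS vres (K 2) ;;
  While gm (CLt (V vr) (V vm))
    (SetS vel (V vl1) ;; SetS veq (V vq1) ;; p_key ;;
     OpR Add rY rX rZ ;;
     SetS vel (V vl2) ;; SetS veq (V vq2) ;; p_key ;;
     If (CRLt rY rX) (SetS vres (K 1) ;; SetS vr (V vm))
       (If (CRLt rX rY) (SetS vres (K 0) ;; SetS vr (V vm))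
          (SetS vr (V vr +^ K 1)))).

Definition p_less :=
  If (CLt (V vq1 /^ V vN) (V vq2 /^ V vN)) (SetS vres (K 1))
    (If (CLt (V vq2 /^ V vN) (V vq1 /^ V vN)) (SetS vres (K 0))
       (p_rows ;;
        If (CLt (K 1) (V vres))
          (If (CLt (V vl1) (V vl2)) (SetS vres (K 1))
             (If (CLt (V vl2) (V vl1)) (SetS vres (K 0))
                (If (CLt (V vq1) (V vq2)) (SetS vres (K 1))
                   (SetS vres (K 0)))))
          Skip)).

(** [vpp = N] stands for no lower bound, so that one scan serves both for the first position of a
    leaf and for the successor of a position. The sum in the guard encodes a disjunction. *)
Definition p_minq :=
  SetS vb (V vN) ;;
  SetS vq (K 0) ;;
  While gN (CLt (V vq) (V vN))
    (SetS vl1 (V vl) ;; SetS vq1 (V vpp) ;; SetS vl2 (V vl) ;; SetS vq2 (V vq) ;;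
     p_less ;;
     If (CLt (K 0) (V vres +^ V vpp /^ V vN))
       (SetS vq1 (V vq) ;; SetS vq2 (V vb) ;; p_less ;;
        If (CLt (K 0) (V vres)) (SetS vb (V vq)) Skip)
       Skip ;;
     SetS vq (V vq +^ K 1)).

(** The counter has two roles: as a leaf, it gets a starting position; as a side together with an
    index, it gets a successor, computed at the smallest leaf of the side as representative. *)
Definition p_init :=
  SetS vp (K 0) ;;
  While (2 * gN) (CLt (V vp) (K 2 *^ V vN))
    (SetS vl (V vp) ;; SetS vpp (V vN) ;; p_minq ;; SetA acur (V vp) (V vb) ;;
     SetS vl ((V vp /^ V vN) *^ V vN) ;; SetS vpp (V vp -^ V vl) ;; p_minq ;;
     SetA anxt (V vp) (V vb) ;;
     SetA atree (K 2 *^ V vN +^ V vp) (V vp) ;;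
     SetS vp (V vp +^ K 1)).

Definition p_fix :=
  SetS vta (Arr atree (K 2 *^ V vx)) ;;
  SetS vtb (Arr atree (K 2 *^ V vx +^ K 1)) ;;
  SetS vl1 (V vtb) ;; SetS vq1 (Arr acur (V vtb)) ;;
  SetS vl2 (V vta) ;; SetS vq2 (Arr acur (V vta)) ;;
  p_less ;;
  If (CLt (K 0) (V vres)) (SetA atree (V vx) (V vtb)) (SetA atree (V vx) (V vta)).

Definition p_build :=
  SetS vx (K 2 *^ V vN) ;;
  While (2 * gN) (CLt (K 1) (V vx)) (SetS vx (V vx -^ K 1) ;; p_fix).

Definition p_cost l q :=
  SetS vbase (V vm *^ V vn +^ V vm) ;; SetS vel l ;; SetS veq q ;; p_val.

(** The memory is replaced unless it holds the same key at no greater cost: a smaller key cannot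
    match anything still to come. *)
Definition p_side0 :=
  SetS vupd (K 1) ;;
  If (CLt (K 0) (V vhm))
    (SetS vl1 (V vml) ;; SetS vq1 (V vmq) ;; SetS vl2 (V vcl) ;; SetS vq2 (V vcq) ;;
     p_rows ;;
     If (CLt (K 1) (V vres))
       (SetR rX 0 ;; p_cost (V vcl) (V vcq) ;; OpR Add rY rX rZ ;;
        SetR rX 0 ;; p_cost (V vml) (V vmq) ;;
        If (CRLt rY rX) Skip (SetS vupd (K 0)))
       Skip)
    Skip ;;
  If (CLt (K 0) (V vupd))
    (SetS vhm (K 1) ;; SetS vml (V vcl) ;; SetS vmq (V vcq)) Skip.

Definition p_side1 :=
  If (CLt (K 0) (V vhm))
    (SetS vl1 (V vml) ;; SetS vq1 (V vmq) ;; SetS vl2 (V vcl) ;; SetS vq2 (V vcq) ;;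
     p_rows ;;
     If (CLt (K 1) (V vres))
       (SetR rX 0 ;; p_cost (V vml) (V vmq) ;; p_cost (V vcl) (V vcq) ;;
        If (CLt (K 0) (V vhb))
          (If (CRLt rX rC) (SetS vupd (K 1)) (SetS vupd (K 0))) (SetS vupd (K 1)) ;;
        If (CLt (K 0) (V vupd))
          (OpR Add rC rX rZ ;; SetS vhb (K 1) ;;
           SetS vl3 (V vml) ;; SetS vq3 (V vmq) ;;
           SetS vl4 (V vcl) ;; SetS vq4 (V vcq))
          Skip)
       Skip)
    Skip.

(** [vx] starts at the parent of the popped leaf; only ancestors of that leaf may have lost their
    winner. *)
Definition p_pop :=
  SetA acur (V vcl) (Arr anxt (V vcl /^ V vN *^ V vN +^ V vcq)) ;;
  SetS vx ((V vcl +^ K 2 *^ V vN) /^ K 2) ;;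
  While (gk + 1) (CLt (K 0) (V vx)) (p_fix ;; SetS vx (V vx /^ K 2)).

Definition p_main :=
  While (2 * gN * gN) (CLt (Arr acur (Arr atree (K 1))) (V vN))
    (SetS vcl (Arr atree (K 1)) ;; SetS vcq (Arr acur (V vcl)) ;;
     If (CLt (V vcl) (V vN)) p_side0 p_side1 ;;
     p_pop).

Definition p_bits h j :=
  SetS vh h ;; SetS vj j ;; SetS vi (K 0) ;;
  While gk (CLt (V vi) (V vk))
    (If (CLt (V vj) (V vn))
       (If (CLt (K 0) (parity (V vh))) (SetR rX 1) (SetR rX 0) ;;
        Store (V vj) rX)
       Skip ;;
     SetS vh (V vh /^ K 2) ;; SetS vj (V vj +^ K 1) ;; SetS vi (V vi +^ K 1)).

(** The input may be overwritten, because the minimum is already held in [rC]. Assigning [vm] last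
    puts the flag into cell [0], where the answer is expected. *)
Definition p_out :=
  If (CLt (K 0) (V vhb))
    (p_bits (V vl3) (K 0) ;;
     p_bits (V vq3) (V vk) ;;
     p_bits (V vl4 -^ V vN) (K 2 *^ V vk) ;;
     p_bits (V vq4) (K 3 *^ V vk) ;;
     Store (V vn) rC)
    Skip ;;
  SetS vm (V vhb).

Definition p_setup :=
  SetS vk ((V vn +^ K 3) /^ K 4) ;;
  SetS vN (K 1) ;;
  SetS vi (K 0) ;;
  While gk (CLt (V vi) (V vk)) (SetS vN (K 2 *^ V vN) ;; SetS vi (V vi +^ K 1)).

Definition p_all := p_setup ;; p_init ;; p_build ;; p_main ;; p_out.

End Program.

Lemma p_all_wf gm gk gN : cmd_wf (p_all gm gk gN).
Proof. by vm_compute. Qed.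

(** Ghosts vanish in compilation: a single machine program serves all instances, while the analysis
    uses bounds that fit the instance. *)
Lemma comp_p_all gm gk gN l : compile l (p_all gm gk gN) = compile l (p_all 0 0 0).
Proof. by vm_compute. Qed.

(** * Proof rules for the constructors of the language *)

Section Rules.
Variable R : realType.
Variables M B : nat.
Implicit Types (s : hst R) (Q : hst R -> Prop).
Notation wp := (@wp R M B).

Lemma wp_skip Q s : Q s -> wp Skip Q s. Proof. by []. Qed.
Lemma wp_putS d e Q s : sf B s e -> Q (putS s d (ev s e)) -> wp (SetS d e) Q s.
Proof. by []. Qed.
Lemma wp_putA a e1 e2 Q s : sf B s e1 -> sf B s e2 -> cell a (ev s e1) < B ->
  Q (putA s a (ev s e1) (ev s e2)) -> wp (SetA a e1 e2) Q s.
Proof. by []. Qed.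
Lemma wp_putR d k Q s : Q (putR s d k%:R%R) -> wp (SetR d k) Q s.
Proof. by []. Qed.
Lemma wp_opR o d x y Q s : Q (putR s d (rarith o (rv s x) (rv s y))) ->
  wp (OpR o d x y) Q s.
Proof. by []. Qed.
Lemma wp_accR d e Q s : sf B s e -> ev s e < M ->
  Q (putR s d (rv s d + iv s (ev s e))%R) -> wp (AccR d e) Q s.
Proof. by []. Qed.
Lemma wp_store e x Q s : sf B s e -> ev s e < M ->
  Q (putI s (ev s e) (rv s x)) -> wp (Store e x) Q s.
Proof. by []. Qed.
Lemma wp_seq c1 c2 Q s : wp c1 (wp c2 Q) s -> wp (c1 ;; c2) Q s.
Proof. by []. Qed.
Lemma wp_if b c1 c2 Q s : sfc B s b -> (evc s b -> wp c1 Q s) ->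
  (~~ evc s b -> wp c2 Q s) -> wp (If b c1 c2) Q s.
Proof. by move=> sb h1 h2; split=> //; case: ifP => [|/negbT]. Qed.

Lemma wp_call c Q0 Q s : wp c Q0 s ->
  (forall s', Q0 s' -> frm c s s' -> Q s') -> wp c Q s.
Proof. by move=> /wp_frame H HQ; apply: wp_mono H => s' [h f]; apply: HQ. Qed.
End Rules.

Ltac vc := repeat lazymatch goal with
  | |- @wp _ _ _ (Seq _ _) _ _ => apply: wp_seq
  | |- @wp _ _ _ (SetS _ _) _ _ => apply: wp_putS
  | |- @wp _ _ _ (SetR _ _) _ _ => apply: wp_putR
  | |- @wp _ _ _ (OpR _ _ _ _) _ _ => apply: wp_opR
  | |- @wp _ _ _ Skip _ _ => apply: wp_skip
  end.

Ltac safe E := rewrite /= ?E //;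
  repeat match goal with
  | |- and3 _ _ _ => split | |- _ /\ _ => split | |- True => exact I end;
  try lia.

Lemma parityE h : h - 2 * (h %/ 2) = odd h.
Proof. lia. Qed.

(** * Correctness of the program *)

Section Comparison.
Variable R : realType.
Variables (m n k M B : nat) (f : nat -> R).
Hypotheses (nk : n <= 4 * k) (ME : M = m * n + m + n) (k_le : 4 * k <= n + 3).
Let N := 2 ^ k.
Hypothesis BE : 12 * N + M + 200 <= B.
Implicit Types (s : hst R).
Notation wp := (@wp R M B).
Notation skey := (skey m n k f).

Record inp s : Prop := Inp {
  inp_m : sv s vm = m; inp_n : sv s vn = n; inp_k : sv s vk = k;
  inp_N : sv s vN = N; inp_Z : rv s rZ = 0%R;
  inp_f : forall i, i < M -> iv s i = f i }.

(** Brings bit positions, which are at most [4 * k], within the word bound, which is expressed by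
    [N]. *)
Lemma kN : k < N. Proof. exact: ltn_expl. Qed.

Lemma inp_frm c s s' : [&& vm \notin wmod c, vn \notin wmod c, vk \notin wmod c,
    vN \notin wmod c, rZ \notin rmod c & ~~ imod c] ->
  frm c s s' -> inp s -> inp s'.
Proof.
move=> /and5P[c0 c1 c2 c3 /andP[c4 c5]] F [*].
by split; rewrite ?(frmS F) ?(frmR F) ?(frmI F).
Qed.

Lemma p_addP s base j h : inp s -> sv s vbase = base -> sv s vj = j -> sv s vh = h ->
  h < N -> j + k <= 4 * k -> base + n <= M ->
  wp (p_add k) (fun s' => rv s' rX = (rv s rX + bitsum n f k base j h)%R) s.
Proof.
move=> Is sb sj sh hN jk bM; have kN' := kN; rewrite /p_add.
(* The count is the number of bits still to be read; [sv s' vh < 2 ^ c] makes the remaining word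
   vanish within [k] rounds. *)
apply: (wp_while (I := fun c s' => [/\ inp s', sv s' vbase = base, sv s' vh < 2 ^ c,
   sv s' vj + c <= 4 * k & (rv s' rX + bitsum n f c base (sv s' vj) (sv s' vh))%R =
    (rv s rX + bitsum n f k base j h)%R])
   (i := k)) => //; last by rewrite sb sj sh.
move=> c s' ck [I' sb' hc jc E]; split=> //=.
have inpE := (inp_m I', inp_n I', inp_k I', inp_N I').
case: posnP => [h0|h0]; first by rewrite -E h0 bitsum0 addr0.
case: c ck hc jc E => [|c] ck hc jc E; first by rewrite expn0 in hc; lia.
have cN : 2 ^ c.+1 <= N by rewrite leq_exp2l.
split=> //; apply: wp_seq; apply: wp_if.
- safe inpE.
  by rewrite parityE; case: (odd _); rewrite ?mul1n ?mul0n; lia.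
- rewrite /= inpE parityE muln_gt0 subn_gt0 => /andP[oh jn].
  apply: wp_accR; [by safe inpE|by safe inpE; lia|].
  vc; [by safe inpE|by safe inpE|].
  exists c => //; split=> /=.
  + by case: I' => *; split.
  + by [].
  + by rewrite ltn_divLR // -expnSr.
  + lia.
  by rewrite -E bitsumS addn1 jn; case: (odd _) oh => // _; rewrite sb' (inp_f I') ?addrA //; lia.
rewrite /= inpE parityE muln_gt0 subn_gt0 => no.
apply: wp_skip; vc; [by safe inpE|by safe inpE|].
exists c => //; split=> /=.
- by case: I' => *; split.
- by [].
- by rewrite ltn_divLR // -expnSr.
- lia.
by rewrite -E bitsumS addn1; case: (odd _) no => /= [/negbTE ->|_]; rewrite add0r.
Qed.

Lemma p_valP s base l q : inp s -> sv s vbase = base -> sv s vel = l -> sv s veq = q ->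
  l < 2 * N -> q < N -> base + n <= M ->
  wp (p_val k) (fun s' => rv s' rX = (rv s rX + raw n k f base l q)%R /\
                         sv s' vs = l %/ N) s.
Proof.
move=> Is sb sl sq lN qN bM; have kN' := kN.
have inpE := (inp_m Is, inp_n Is, inp_k Is, inp_N Is).
have s1 : l %/ N <= 1 by rewrite -ltnS ltn_divLR ?N_gt0.
have mN : l %/ N * N <= l by apply: leq_divM.
have lm : l - l %/ N * N < N by rewrite {1}(divn_eq l N) addKn ltn_pmod ?N_gt0.
have sk : l %/ N * (2 * k) + 2 * k <= 4 * k by case: (l %/ N) s1 => [|[]] //; lia.
rewrite /p_val; vc; [by safe inpE; rewrite ?sl; lia|by safe inpE; rewrite ?sl; lia|by safe inpE; rewrite ?sl; lia|].
apply: (wp_call (p_addP (base := base) (j := l %/ N * (2 * k)) (h := l - l %/ N * N) _ _ _ _ _ _ _)) => //=.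
- by case: Is => *; split.
- by rewrite !inpE sl.
- by rewrite !inpE sl.
- lia.
move=> s2 X2 F2; have I2 : inp s2 by apply: (inp_frm _ F2) => //; case: Is => *; split.
have inp2 := (inp_m I2, inp_n I2, inp_k I2, inp_N I2).
have s2s : sv s2 vs = l %/ N by rewrite (frmS F2) //= !inpE sl.
have s2q : sv s2 veq = q by rewrite (frmS F2).
vc; [by safe inp2|by safe inp2; rewrite ?s2s; lia|].
apply: (wp_call (p_addP (base := base) (j := l %/ N * (2 * k) + k) (h := q) _ _ _ _ _ _ _)) => //=.
- by case: I2 => *; split.
- by rewrite (frmS F2).
- by rewrite !inp2 s2s.
- lia.
move=> s3 X3 F3; split; last by rewrite (frmS F3).
by rewrite X3 X2 /= /raw addrA.
Qed.

Lemma p_keyP s l q r : inp s -> sv s vr = r -> sv s vel = l -> sv s veq = q ->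
  l < 2 * N -> q < N -> r < m ->
  wp (p_key k) (fun s' => rv s' rX = key m n k f l q r) s.
Proof.
move=> Is sr sl sq lN qN rm; have kN' := kN.
have inpE := (inp_m Is, inp_n Is, inp_k Is, inp_N Is).
have rn : r * n + n <= m * n by rewrite addnC -mulSn leq_mul2r rm orbT.
rewrite /p_key; vc; first by safe inpE; rewrite ?sr; lia.
apply: (wp_call (p_valP (base := r * n) (l := l) (q := q) _ _ _ _ _ _ _)) => //=.
- by case: Is => *; split.
- by rewrite !inpE sr.
- lia.
move=> s2 [X2 S2] F2; have I2 : inp s2 by apply: (inp_frm _ F2) => //; case: Is => *; split.
have inp2 := (inp_m I2, inp_n I2, inp_k I2, inp_N I2).
have s2r : sv s2 vr = r by rewrite (frmS F2).
apply: wp_if; first by safe inp2.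
  rewrite /= S2 => l0; vc; apply: wp_accR; [by safe inp2; rewrite ?s2r; lia|..].
    by rewrite /= !inp2 s2r; lia.
  rewrite /= !inp2 s2r (inp_Z I2) (inp_f I2); last lia.
  by rewrite X2 /key l0 mulr0n !add0r addrC.
rewrite /= S2 -leqNgt leqn0 => /eqP l0; apply: wp_skip.
by rewrite X2 /key l0 mulr0n add0r.
Qed.

Lemma p_rowsP s l1 q1 l2 q2 : inp s ->
  sv s vl1 = l1 -> sv s vq1 = q1 -> sv s vl2 = l2 -> sv s vq2 = q2 ->
  l1 < 2 * N -> q1 <= N -> l2 < 2 * N -> q2 <= N -> q1 %/ N = q2 %/ N ->
  wp (p_rows m k) (fun s' =>
    [\/ sv s' vres = 2 /\ tied m n k f l1 q1 l2 q2,
        sv s' vres = 1 /\ (skey l1 q1 < skey l2 q2)%O /\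
          keys m n k f l1 q1 <> keys m n k f l2 q2 |
        sv s' vres = 0 /\ (skey l2 q2 < skey l1 q1)%O /\
          keys m n k f l1 q1 <> keys m n k f l2 q2]) s.
Proof.
move=> Is sl1 sq1 sl2 sq2 l1N q1N l2N q2N qq; have kN' := kN.
have inpE := (inp_m Is, inp_n Is, inp_k Is, inp_N Is).
have N0 := N_gt0 k; have mM : q1 %/ N * m <= m by rewrite divNE //; case: eqP => _; rewrite ?mul1n.
pose lt1 := (skey l1 q1 < skey l2 q2)%O /\ keys m n k f l1 q1 <> keys m n k f l2 q2.
pose lt2 := (skey l2 q2 < skey l1 q1)%O /\ keys m n k f l1 q1 <> keys m n k f l2 q2.
rewrite /p_rows; vc; [by safe inpE; rewrite ?sq1; lia|by safe inpE|].
(* For proper indices the count is the number of rows left, and a decided comparison jumps to row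
   [m] with count [0]. Exhausted indices enter with [vr = m], and the guard fails at once. *)
apply: (wp_while (I := fun c s' => [/\ inp s',
   [/\ sv s' vl1 = l1, sv s' vq1 = q1, sv s' vl2 = l2 & sv s' vq2 = q2],
   sv s' vr + c = q1 %/ N * m + m &
   [\/ sv s' vres = 2 /\ (q1 < N -> forall r, r < sv s' vr -> r < m ->
          key m n k f l1 q1 r = key m n k f l2 q2 r),
        sv s' vr = m /\ sv s' vres = 1 /\ lt1 |
        sv s' vr = m /\ sv s' vres = 0 /\ lt2]])
   (i := m)) => //; last first.
  split=> //=.
  - by case: Is => *; split.
  - by rewrite !inpE sq1.
  by apply: Or31; rewrite !inpE sq1; split=> // q1lt r; rewrite divn_small.
move=> c s' cm [I' [e1 e2 e3 e4] ec D]; have inp' := (inp_m I', inp_n I', inp_k I', inp_N I').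
split; first by safe inp'.
rewrite /= inp'; case: ifP => rm; last first.
  case: D => [[-> D]|[_ [-> D]]|[_ [-> D]]]; [apply: Or31|exact: Or32|exact: Or33].
  by split=> //; split=> // q1lt r rm'; apply: D => //; lia.
(* An exhausted index would give [vr + c >= 2 * m] with [c <= m], against the guard [vr < m]. *)
have q1lt : q1 < N.
  rewrite ltnNge -divn_gt0 //; case: (posnP (q1 %/ N)) => // h; exfalso.
  move: (leq_pmull m h) ec cm rm; move: (q1 %/ N * m) (sv s' vr) => z y; clear; lia.
have q2lt : q2 < N by rewrite ltnNge -divn_gt0 // -qq divn_small.
rewrite divn_small // mul0n add0n in ec.
case: D => [[res D]|[h _]|[h _]]; [|lia|lia].
split; first lia.
vc; [by safe inp'|by safe inp'|].
apply: (wp_call (p_keyP (r := sv s' vr) (l := l1) (q := q1) _ _ _ _ _ _ _)) => //=.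
  by case: I' => *; split.
move=> s2 X2 F2; have I2 : inp s2 by apply: (inp_frm _ F2) => //; case: I' => *; split.
have inp2 := (inp_m I2, inp_n I2, inp_k I2, inp_N I2).
vc; [by safe inp2|by safe inp2|].
apply: (wp_call (p_keyP (r := sv s' vr) (l := l2) (q := q2) _ _ _ _ _ _ _)) => //=.
- by case: I2 => *; split.
- by rewrite (frmS F2).
- by rewrite (frmS F2).
- by rewrite (frmS F2).
move=> s3 X3 F3; have I3 : inp s3 by apply: (inp_frm _ F3) => //; case: I2 => *; split.
have inp3 := (inp_m I3, inp_n I3, inp_k I3, inp_N I3).
have Y3 : rv s3 rY = key m n k f l1 q1 (sv s' vr).
  by rewrite (frmR F3) //= X2 (inp_Z I2) addr0.
have keep x : x \notin [:: vbase; vh; vj; vel; veq; vs] -> sv s3 x = sv s' x.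
  rewrite !inE !negb_or => /and5P[x1 x2 x3 x4 /andP[x5 x6]].
  rewrite (frmS F3) /= ?updE ?ifN //; last by rewrite !inE !negb_or x1 x2 x3 x6.
  by rewrite (frmS F2) /= ?updE ?ifN //; rewrite !inE !negb_or x1 x2 x3 x6.
have [k1 k2 k3 k4] : [/\ sv s3 vl1 = l1, sv s3 vq1 = q1, sv s3 vl2 = l2 & sv s3 vq2 = q2].
  by rewrite !keep.
have kr : sv s3 vr = sv s' vr by rewrite keep.
have kres : sv s3 vres = 2 by rewrite keep.
apply: wp_if => //=; rewrite Y3 X3 => cmp1.
  vc; [by safe inp3|by safe inp3|]; exists 0; first lia.
  split=> //=; [by case: I3 => *; split|by rewrite inp3 divn_small // mul0n addn0|].
  apply: Or32; rewrite inp3; split=> //; split=> //.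
  have fl : first_lt m (key m n k f l1 q1) (key m n k f l2 q2).
    by exists (sv s' vr); split=> // j jr; apply: D => //; lia.
  split; first exact: skey_first.
  by move=> e; have /lexseqP := fl; rewrite -/(keys m n k f l1 q1) e ltxx.
apply: wp_if => //=; rewrite Y3 X3 => cmp2.
  vc; [by safe inp3|by safe inp3|]; exists 0; first lia.
  split=> //=; [by case: I3 => *; split|by rewrite inp3 divn_small // mul0n addn0|].
  apply: Or33; rewrite inp3; split=> //; split=> //.
  have fl : first_lt m (key m n k f l2 q2) (key m n k f l1 q1).
    by exists (sv s' vr); split=> // j jr; apply/esym/D => //; lia.
  split; first exact: skey_first.
  by move=> e; have /lexseqP := fl; rewrite -/(keys m n k f l1 q1) e ltxx.
vc; first by safe inp3.
exists (c.-1); first lia.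
split=> //=; [by case: I3 => *; split|by rewrite kr divn_small //; lia|].
apply: Or31; split=> // _ r; rewrite kr addn1 ltnS leq_eqVlt => /orP[/eqP ->|rr] rm'.
  by apply/eqP; rewrite eq_le !leNgt cmp1 cmp2.
exact: D.
Qed.

Lemma p_lessP s l1 q1 l2 q2 : inp s ->
  sv s vl1 = l1 -> sv s vq1 = q1 -> sv s vl2 = l2 -> sv s vq2 = q2 ->
  l1 < 2 * N -> q1 <= N -> l2 < 2 * N -> q2 <= N ->
  wp (p_less m k) (fun s' => sv s' vres = (skey l1 q1 < skey l2 q2)%O) s.
Proof.
move=> Is sl1 sq1 sl2 sq2 l1N q1N l2N q2N.
have inpE := (inp_m Is, inp_n Is, inp_k Is, inp_N Is).
rewrite /p_less; apply: wp_if; rewrite /= ?inpE ?sq1 ?sq2 // => h1.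
  by vc; [safe inpE|rewrite /= skey_exh].
apply: wp_if; rewrite /= ?inpE ?sq1 ?sq2 // => h2.
  by vc; [safe inpE|rewrite /= lt_gtF // skey_exh].
vc; apply: (wp_call (p_rowsP Is sl1 sq1 sl2 sq2 l1N q1N l2N q2N _)); first lia.
move=> s2 H F2; have I2 : inp s2 by apply: (inp_frm _ F2).
have inp2 := (inp_m I2, inp_n I2, inp_k I2, inp_N I2).
have [k1 k2 k3 k4] : [/\ sv s2 vl1 = l1, sv s2 vq1 = q1, sv s2 vl2 = l2 & sv s2 vq2 = q2].
  by rewrite !(frmS F2).
apply: wp_if; first by safe inp2.
  case: H => [[_ t] _|[/= -> _] //|[/= -> _] //].
  have t' : tied m n k f l2 q2 l1 q1.
    case: t => e t; split=> // q2lt r rm; apply/esym/t => //.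
    by rewrite ltnNge -divn_gt0 ?N_gt0 // e divn_small.
  apply: wp_if => //; rewrite /= k1 k3 => c1.
    by vc; [safe inp2|rewrite /= (skey_tied_leaf t)].
  apply: wp_if => //; rewrite /= k1 k3 => c2.
    by vc; [safe inp2|rewrite /= lt_gtF // (skey_tied_leaf t')].
  have e12 : l1 = l2 by lia.
  rewrite -e12 in t *.
  by apply: wp_if => //; rewrite /= k2 k4 => c3;
    vc; [safe inp2|rewrite /= (skey_tied_idx t) ?c3 ?(negbTE c3)|safe inp2|rewrite /= (skey_tied_idx t) ?c3 ?(negbTE c3)].
rewrite /= -leqNgt => le1; vc.
case: H => [[e _]|[-> [-> _]] //|[-> [h _]]]; first by rewrite e in le1.
by rewrite lt_gtF.
Qed.

End Comparison.

(** * Initialization: starting positions, successor tables and the tree *)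

Section Initialization.
Variable R : realType.
Variables (m n k M B : nat) (f : nat -> R).
Hypotheses (nk : n <= 4 * k) (ME : M = m * n + m + n) (k_le : 4 * k <= n + 3).
Let N := 2 ^ k.
Hypothesis BE : 12 * N + M + 200 <= B.
Implicit Types (s : hst R).
Notation wp := (@wp R M B).
Notation skey := (skey m n k f).
Notation inp := (@inp R m n k M f).
Let lessP := @p_lessP R m n k M B f nk ME k_le BE.

Definition cand l pp q := pp = N \/ (skey l pp < skey l q)%O.

(** Invariant of the scan after [q] indices; [b = N] is the value before any candidate has been
    met. *)
Definition minq l pp q b := [/\ b <= N, b = N \/ cand l pp b &
  forall q', q' < q -> cand l pp q' -> (skey l b <= skey l q')%O].

Lemma p_minqP s l pp : inp s -> sv s vl = l -> sv s vpp = pp -> l < 2 * N -> pp <= N ->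
  wp (p_minq m k N) (fun s' => minq l pp N (sv s' vb)) s.
Proof.
move=> Is sl sp lN pN; have inpE := (inp_m Is, inp_n Is, inp_k Is, inp_N Is).
rewrite /p_minq; vc; [by safe inpE|by safe inpE|].
apply: (wp_while (I := fun c s' => [/\ inp s', sv s' vl = l, sv s' vpp = pp,
   sv s' vq + c = N & minq l pp (sv s' vq) (sv s' vb)]) (i := N)) => //; last first.
  split=> //=; first by case: Is => *; split.
  by rewrite inpE; split=> //; left.
move=> c s' cN [I' el ep eq [b1 b2 b3]].
have inp' := (inp_m I', inp_n I', inp_k I', inp_N I').
split; first by safe inp'.
rewrite /= inp'; case: ifP => qN; last by have -> : N = sv s' vq by lia.
split; first lia.
vc; [by safe inp'|by safe inp'|by safe inp'|by safe inp'|].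
apply: (wp_call (lessP (l1 := l) (q1 := pp) (l2 := l) (q2 := sv s' vq) _ _ _ _ _ _ _ _ _)) => //=.
- by case: I' => *; split.
- exact: ltnW.
move=> s2 X2 F2; have I2 : inp s2 by apply: (inp_frm _ F2) => //; case: I' => *; split.
have inp2 := (inp_m I2, inp_n I2, inp_k I2, inp_N I2).
have [k1 k2 k3 k4] : [/\ sv s2 vl = l, sv s2 vpp = pp, sv s2 vq = sv s' vq & sv s2 vb = sv s' vb].
  by rewrite !(frmS F2).
have fin s4 : inp s4 -> sv s4 vl = l -> sv s4 vpp = pp -> sv s4 vq = sv s' vq ->
    minq l pp (sv s' vq).+1 (sv s4 vb) ->
    wp (SetS vq (V vq +^ K 1)) (fun s5 => exists2 j, j < c &
      [/\ inp s5, sv s5 vl = l, sv s5 vpp = pp,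
      sv s5 vq + j = N & minq l pp (sv s5 vq) (sv s5 vb)]) s4.
  move=> I4 e1 e2 e3 H; have inp4 := (inp_m I4, inp_n I4, inp_k I4, inp_N I4).
  vc; first by safe inp4.
  exists c.-1; first lia; split=> //=; first by case: I4 => *; split.
    by rewrite e3; lia.
  by rewrite e3 addn1.
have candE : 0 < sv s2 vres + sv s2 vpp %/ sv s2 vN <-> cand l pp (sv s' vq).
  rewrite X2 k2 inp2 divNE // /cand -/N; case: eqP => [e|ne].
    by rewrite addn1; split=> // _; left.
  by rewrite addn0 lt0b; split=> [|[]]; [right| |].
vc; apply: wp_if; first by safe inp2; rewrite X2 k2 divNE //; case: eqP; case: (_ < _)%O; lia.
  move/candE => cq.
  vc; [by safe inp2|by safe inp2|].
  apply: (wp_call (lessP (l1 := l) (q1 := sv s' vq) (l2 := l) (q2 := sv s' vb) _ _ _ _ _ _ _ _ _)) => //=.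
  - by case: I2 => *; split.
  - by rewrite (frmS F2).
  - by rewrite (frmS F2).
  - exact: ltnW.
  move=> s3 X3 F3; have I3 : inp s3 by apply: (inp_frm _ F3) => //; case: I2 => *; split.
  have inp3 := (inp_m I3, inp_n I3, inp_k I3, inp_N I3).
  have [h1 h2 h3 h4] : [/\ sv s3 vl = l, sv s3 vpp = pp, sv s3 vq = sv s' vq & sv s3 vb = sv s' vb].
    by rewrite !(frmS F3).
  apply: wp_if; first by safe inp3.
    rewrite /= X3 lt0b => lt; apply: wp_putS; first by safe inp3.
    apply: fin => //=; first by case: I3 => *; split.
    rewrite h3; split; [exact: ltnW|by right|].
    move=> q'; rewrite ltnS leq_eqVlt => /orP[/eqP -> //|q'q cq'].
    exact: le_trans (ltW lt) (b3 _ q'q cq').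
  rewrite /= X3 lt0b -leNgt => ge; apply: wp_skip.
  apply: fin => //; rewrite h4; split=> // q'; rewrite ltnS leq_eqVlt => /orP[/eqP ->//|].
  exact: b3.
move/negP/candE => ncq; apply: wp_skip; apply: fin => //; rewrite k4; split=> // q'.
by rewrite ltnS leq_eqVlt => /orP[/eqP ->|]; [|apply: b3].
Qed.

Definition start (cur : nat -> nat) l :=
  cur l <= N /\ forall q, q < N -> (skey l (cur l) <= skey l q)%O.
Definition nxt_ok (nxt : nat -> nat) p :=
  isnext m n k f (p %/ N * N) (p - p %/ N * N) (nxt p).

(** The scan covers proper indices only. The sentinel has the largest key of its leaf, so it never
    needs to be tried, and it is the right default answer. *)
Lemma minq_next l pp b : pp < N -> minq l pp N b -> isnext m n k f l pp b.
Proof.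
move=> pN [b1 b2 b3]; have N0 := N_gt0 k.
have ltN q : q < N -> (skey l q < skey l N)%O.
  by move=> qN; apply: skey_exh; rewrite divn_small // divnn N0.
split=> //; first by case: b2 => [->|[e|]] //; [apply: ltN|rewrite e ltnn in pN].
move=> q; rewrite leq_eqVlt => /orP[/eqP -> _|qN lt]; last by apply: b3 => //; right.
by move: b1; rewrite leq_eqVlt => /orP[/eqP ->|/ltN/ltW].
Qed.

Lemma p_initP s : inp s ->
  wp (p_init m k N) (fun s' => [/\ forall l, l < 2 * N -> start (av s' acur) l,
     forall p, p < 2 * N -> nxt_ok (av s' anxt) p &
     forall l, l < 2 * N -> av s' atree (2 * N + l) = l]) s.
Proof.
move=> Is; have inpE := (inp_m Is, inp_n Is, inp_k Is, inp_N Is); have N0 := N_gt0 k.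
rewrite /p_init; vc; first by safe inpE.
apply: (wp_while (I := fun c s' => [/\ inp s', sv s' vp + c = 2 * N,
  forall l, l < sv s' vp -> start (av s' acur) l,
  forall p, p < sv s' vp -> nxt_ok (av s' anxt) p &
  forall l, l < sv s' vp -> av s' atree (2 * N + l) = l]) (i := 2 * N)) => //; last first.
  by split=> //=; case: Is => *; split.
move=> c s' cN [I' ep i1 i2 i3].
have inp' := (inp_m I', inp_n I', inp_k I', inp_N I').
split; first by safe inp'.
rewrite /= inp'; case: ifP => pN; last first.
  by have e : sv s' vp = 2 * N; [lia|rewrite e in i1 i2 i3].
split; first lia.
vc; [by safe inp'|by safe inp'|].
apply: (wp_call (p_minqP (l := sv s' vp) (pp := N) _ _ _ _ _)) => //=.
- by case: I' => *; split.
- by rewrite inp'.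
move=> s2 [x1 x2 x3] F2; have I2 : inp s2 by apply: (inp_frm _ F2) => //; case: I' => *; split.
have inp2 := (inp_m I2, inp_n I2, inp_k I2, inp_N I2).
have p2 : sv s2 vp = sv s' vp by rewrite (frmS F2).
vc; apply: wp_putA; [by safe inp2|by safe inp2|by rewrite /cell /= p2; lia|].
have d1 : sv s' vp %/ N <= 1 by rewrite -ltnS ltn_divLR.
have d2 : sv s' vp %/ N * N <= sv s' vp by apply: leq_divM.
have d3 : sv s' vp - sv s' vp %/ N * N < N by rewrite {1}(divn_eq (sv s' vp) N) addKn ltn_pmod.
vc; [by safe inp2; rewrite p2; lia|by safe inp2|].
apply: (wp_call (p_minqP (l := sv s' vp %/ N * N) (pp := sv s' vp - sv s' vp %/ N * N) _ _ _ _ _)) => //=.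
- by case: I2 => *; split.
- by rewrite p2 inp2.
- by rewrite p2 inp2.
- lia.
- exact: ltnW.
move=> s3 X3 F3; have I3 : inp s3 by apply: (inp_frm _ F3) => //; case: I2 => *; split.
have inp3 := (inp_m I3, inp_n I3, inp_k I3, inp_N I3).
have p3 : sv s3 vp = sv s' vp by rewrite (frmS F3).
vc; apply: wp_putA; [by safe inp3|by safe inp3|by rewrite /cell /= p3; lia|].
vc; apply: wp_putA; [by safe inp3; rewrite p3; lia|by safe inp3|by rewrite /cell /= p3 inp3; lia|].
vc; first by safe inp3; rewrite p3; lia.
have C3 : av s3 acur = upd (av s' acur) (sv s' vp) (sv s2 vb).
  by rewrite (frmA F3) //= p2 (frmA F2).
have N3 : av s3 anxt = av s' anxt by rewrite (frmA F3) //= (frmA F2).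
have T3 : av s3 atree = av s' atree by rewrite (frmA F3) //= (frmA F2).
exists c.-1; first lia; split=> /=.
- by case: I3 => *; split.
- by rewrite p3; lia.
- rewrite p3 C3 addn1 => l; rewrite ltnS leq_eqVlt /start updE => /orP[/eqP ->|lp].
    by rewrite eqxx; split=> // q qN; apply: x3 => //; left.
  by rewrite ifN; [apply: i1|lia].
- rewrite p3 N3 addn1 => p; rewrite ltnS leq_eqVlt /nxt_ok updE => /orP[/eqP ->|pp].
    by rewrite eqxx; apply: minq_next.
  by rewrite ifN; [apply: i2|lia].
rewrite p3 T3 inp3 addn1 => l; rewrite ltnS leq_eqVlt updE => /orP[/eqP ->|lp].
  by rewrite eqxx.
by rewrite ifN; [apply: i3|lia].
Qed.

Lemma p_fixP s x : inp s -> sv s vx = x -> 0 < x -> x < 2 * N ->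
  (forall y, x < y -> y < 4 * N -> av s atree y < 2 * N) ->
  (forall l, l < 2 * N -> av s acur l <= N) ->
  wp (p_fix m k) (fun s' => exists e, let T := av s atree in let w := T (2 * x + e) in
     [/\ e < 2, av s' atree = upd T x w,
      (skey w (av s acur w) <= elt m n k f T (av s acur) (2 * x))%O &
      (skey w (av s acur w) <= elt m n k f T (av s acur) (2 * x).+1)%O]) s.
Proof.
move=> Is sx x0 xN TN CN; have inpE := (inp_m Is, inp_n Is, inp_k Is, inp_N Is).
have N0 := N_gt0 k.
rewrite /p_fix; vc.
- by safe inpE; rewrite ?sx /cell; lia.
- by safe inpE; rewrite ?sx /cell; lia.
- by safe inpE.
- by safe inpE; rewrite sx /cell; have := TN (2 * x + 1); lia.
- by safe inpE.
- by safe inpE; rewrite sx /cell; have := TN (2 * x); lia.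
apply: (wp_call (lessP (l1 := av s atree (2 * x + 1)) (q1 := av s acur (av s atree (2 * x + 1)))
  (l2 := av s atree (2 * x)) (q2 := av s acur (av s atree (2 * x))) _ _ _ _ _ _ _ _ _)) => //=.
- by case: Is => *; split.
- by rewrite sx.
- by rewrite sx.
- by rewrite sx.
- by rewrite sx.
- by apply: TN; lia.
- by apply/CN/TN; lia.
- by apply: TN; lia.
- by apply/CN/TN; lia.
move=> s2 X2 F2; have I2 : inp s2 by apply: (inp_frm _ F2) => //; case: Is => *; split.
have inp2 := (inp_m I2, inp_n I2, inp_k I2, inp_N I2).
have [k1 k2 k3] : [/\ sv s2 vx = x, sv s2 vta = av s atree (2 * x) & sv s2 vtb = av s atree (2 * x + 1)].
  by rewrite !(frmS F2) //= sx.
have T2 : av s2 atree = av s atree by rewrite (frmA F2).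
apply: wp_if; first by safe inp2.
  rewrite /= X2 lt0b => lt; vc; apply: wp_putA; [by safe inp2|by safe inp2|by rewrite /cell /= k1; lia|].
  by rewrite addn1 in lt k3; exists 1; rewrite /= T2 k1 k3 addn1 /elt; split=> //; rewrite ltW.
rewrite /= X2 lt0b -leNgt => ge; vc; apply: wp_putA; [by safe inp2|by safe inp2|by rewrite /cell /= k1; lia|].
by rewrite addn1 in ge; exists 0; rewrite /= T2 k1 k2 addn0 /elt; split.
Qed.

(** Winners are meaningful on [DT], and the node condition holds on [DN]. Building keeps both equal
    to the nodes from [vx] on; popping keeps [DT] full and takes from [DN] the path still to be
    replayed. *)
Definition tree_inv (DT DN : nat -> Prop) T cur :=
  [/\ forall l, l < 2 * N -> T (2 * N + l) = l,
      forall y, 0 < y -> y < 4 * N -> DT y -> T y < 2 * N /\ anc k T y &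
      forall y, 0 < y -> y < 2 * N -> DN y -> node m n k f T cur y].

(** Replaying the match at [x] repairs [x] and can spoil only the parent [x %/ 2], whence the
    condition on [DN']. Building and popping share this step. *)
Lemma tree_inv_fix (DT DN DT' DN' : nat -> Prop) T cur x e : 0 < x -> x < 2 * N -> e < 2 ->
  DT (2 * x + e) -> (forall y, DT' y -> y = x \/ DT y) ->
  (forall y, DN' y -> y = x \/ (y <> x %/ 2 /\ DN y)) ->
  tree_inv DT DN T cur -> let w := T (2 * x + e) in
  (skey w (cur w) <= elt m n k f T cur (2 * x))%O ->
  (skey w (cur w) <= elt m n k f T cur (2 * x).+1)%O ->
  tree_inv DT' DN' (upd T x w) cur.
Proof.
move=> x0 xN e2 De HT HN [t1 t2 t3] w w1 w2; have N0 := N_gt0 k.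
have [wN aw] : T (2 * x + e) < 2 * N /\ anc k T (2 * x + e) by apply: t2 => //; lia.
split=> [l lN|y y0 yN /HT Dy|y y0 yN /HN Dy].
- by rewrite updE ifN ?t1 //; lia.
- split; last by apply: anc_upd => //; case: Dy => [|/(t2 _ y0 yN)[]]; [left|right].
  by rewrite updE; case: eqP => // ne; case: Dy => // /(t2 _ y0 yN)[].
case: (eqVneq y x) => [->|/eqP ne]; first exact: node_fixed.
by case: Dy => // -[ne2 /(t3 _ y0 yN)]; apply: node_other.
Qed.

Lemma p_buildP s : inp s -> (forall l, l < 2 * N -> av s atree (2 * N + l) = l) ->
  (forall l, l < 2 * N -> av s acur l <= N) ->
  wp (p_build m k N) (fun s' => [/\ av s' acur = av s acur, av s' anxt = av s anxt &
    tree_inv (fun=> True) (fun=> True) (av s' atree) (av s acur)]) s.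
Proof.
move=> Is Tl CN; have inpE := (inp_m Is, inp_n Is, inp_k Is, inp_N Is).
have N0 := N_gt0 k.
rewrite /p_build; vc; first by safe inpE.
apply: (wp_while (I := fun c s' => [/\ inp s', 0 < sv s' vx <= c.+1, sv s' vx <= 2 * N,
  av s' acur = av s acur /\ av s' anxt = av s anxt &
  tree_inv (leq (sv s' vx)) (leq (sv s' vx)) (av s' atree) (av s acur)]) (i := 2 * N)) => //; last first.
  split=> //=; [by case: Is => *; split|by rewrite inpE; lia|by rewrite inpE|].
  rewrite inpE; split=> // y y0 yN le; last lia.
  have -> : y = 2 * N + (y - 2 * N) by lia.
  rewrite Tl; last lia.
  by split; [lia|apply: anc_leaf; apply: Tl; lia].
move=> c s' cN [I' x1 x2 [C' N'] TI].
have inp' := (inp_m I', inp_n I', inp_k I', inp_N I').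
split; first by safe inp'.
rewrite /=; case: ifP => x3; last first.
  split=> //; have e1 : sv s' vx = 1 by lia.
  rewrite e1 in TI.
  by case: TI => t1 t2 t3; split=> // y y0 yN _; [apply: t2|apply: t3].
split; first lia.
vc; first by safe inp'.
apply: (wp_call (p_fixP (x := sv s' vx - 1) _ _ _ _ _ _)) => //=.
- by case: I' => *; split.
- lia.
- lia.
- by case: TI => t1 t2 t3 y yx yN; have [] := t2 y ltac:(lia) yN ltac:(lia).
- by rewrite C'.
move=> s2 [e [e2 T2 w1 w2]] F2; have I2 : inp s2 by apply: (inp_frm _ F2) => //; case: I' => *; split.
have x2' : sv s2 vx = sv s' vx - 1 by rewrite (frmS F2).
exists c.-1; first lia; rewrite x2' T2; split=> //; try lia.
  by rewrite !(frmA F2).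
rewrite C' in w1 w2.
apply: tree_inv_fix TI w1 w2 => //; lia.
Qed.

End Initialization.

(** * One step of the merge *)

Section MergeSteps.
Variable R : realType.
Variables (m n k M B : nat) (f : nat -> R).
Hypotheses (nk : n <= 4 * k) (ME : M = m * n + m + n) (k_le : 4 * k <= n + 3).
Let N := 2 ^ k.
Hypothesis BE : 12 * N + M + 200 <= B.
Implicit Types (s : hst R).
Notation wp := (@wp R M B).
Notation skey := (skey m n k f).
Notation inp := (@inp R m n k M f).
Notation memI := (memI m n k f).
Notation bestI := (bestI m n k f).
Notation tree_inv := (tree_inv m n k f).
Notation keys := (keys m n k f).
Notation cost := (cost m n k f).
Let rowsP := @p_rowsP R m n k M B f nk ME k_le BE.
Let fixP := @p_fixP R m n k M B f nk ME k_le BE.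

Lemma p_costP s x y l q : inp s -> sv s x = l -> sv s y = q -> x != vbase ->
  y != vbase -> y != vel -> l < 2 * N -> q < N ->
  wp (p_cost k (V x) (V y)) (fun s' => rv s' rX = (rv s rX + cost l q)%R) s.
Proof.
move=> Is sx sy xb yb ye lN qN; have inpE := (inp_m Is, inp_n Is, inp_k Is, inp_N Is).
rewrite /p_cost; vc; [by safe inpE|by safe inpE|by safe inpE|].
apply: (wp_call (@p_valP R m n k M B f nk ME k_le BE _ (m * n + m) l q _ _ _ _ _ _ _)) => //=.
- by case: Is => *; split.
- by rewrite !inpE.
- by rewrite !updE (negbTE xb).
- by rewrite !updE (negbTE yb) (negbTE ye).
- lia.
by move=> s2 [X2 _] _; rewrite X2.
Qed.

Lemma rows_keys s' l1 q1 l2 q2 :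
  [\/ sv s' vres = 2 /\ tied m n k f l1 q1 l2 q2,
      sv s' vres = 1 /\ (skey l1 q1 < skey l2 q2)%O /\ keys l1 q1 <> keys l2 q2 |
      sv s' vres = 0 /\ (skey l2 q2 < skey l1 q1)%O /\ keys l1 q1 <> keys l2 q2] ->
  q1 < N -> 1 < sv s' vres <-> keys l1 q1 = keys l2 q2.
Proof.
move=> H q1N; case: H => [[-> [_ t]]|[-> [_ ne]]|[-> [_ ne]]] //.
by split=> // _; apply: eq_lexseq => r; apply: t.
Qed.

Section Pop.
Variables (cur : nat -> nat) (el eq b : nat).
Hypotheses (eqE : eq = cur el) (el2N : el < 2 * N) (eqN : eq < N).
Hypothesis emin : forall l, l < 2 * N -> (skey el eq <= skey l (cur l))%O.
Hypothesis eb : isnext m n k f el eq b.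
Hypothesis curN : forall l, l < 2 * N -> cur l <= N.

Lemma p_side0P s : inp s -> sv s vcl = el -> sv s vcq = eq -> el < N ->
  memI cur (sv s vhm) (sv s vml) (sv s vmq) ->
  wp (p_side0 m k) (fun s' => memI (upd cur el b) (sv s' vhm) (sv s' vml) (sv s' vmq)) s.
Proof.
move=> Is sl sq elN mI; have inpE := (inp_m Is, inp_n Is, inp_k Is, inp_N Is).
(* The common end of all paths through the first conditional: the last two hypotheses say when
   replacing, respectively keeping, the remembered half is right. *)
have fin s' : inp s' -> sv s' vcl = el -> sv s' vcq = eq ->
    [/\ sv s' vhm = sv s vhm, sv s' vml = sv s vml & sv s' vmq = sv s vmq] ->
    (0 < sv s' vupd -> 0 < sv s vhm -> keys (sv s vml) (sv s vmq) = keys el eq ->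
       (cost el eq <= cost (sv s vml) (sv s vmq))%R) ->
    (~~ (0 < sv s' vupd) -> [/\ 0 < sv s vhm, keys (sv s vml) (sv s vmq) = keys el eq &
       (cost (sv s vml) (sv s vmq) <= cost el eq)%R]) ->
    wp (If (CLt (K 0) (V vupd))
     (SetS vhm (K 1) ;; SetS vml (V vcl) ;; SetS vmq (V vcq)) Skip)
     (fun s' => memI (upd cur el b) (sv s' vhm) (sv s' vml) (sv s' vmq)) s'.
  move=> I' e1 e2 [e3 e4 e5] h1 h2; have inp' := (inp_m I', inp_n I', inp_k I', inp_N I').
  apply: wp_if => /= [|u|u]; first by safe inp'.
    vc; [by safe inp'|by safe inp'|by safe inp'|].
    by rewrite /= e1 e2; exact: (memI_new eqE el2N eqN emin eb mI elN (h1 u)).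
  vc; rewrite e3 e4 e5; by apply: (memI_keep eqE el2N eqN eb mI) => _; apply: h2.
rewrite /p_side0; vc; first by safe inpE.
apply: wp_if; rewrite /= ?inpE; first by safe inpE.
  move=> hm0; have [_ /(_ hm0)[mlN mqN mlt]] := mI.
  vc; [by safe inpE|by safe inpE|by safe inpE|by safe inpE|].
  apply: (wp_call (rowsP (l1 := sv s vml) (q1 := sv s vmq) (l2 := el) (q2 := eq)
    _ _ _ _ _ _ _ _ _ _)) => //=; try lia.
  - by case: Is => *; split.
  - by rewrite !divn_small.
  move=> s2 X2 F2; have I2 : inp s2 by apply: (inp_frm _ F2) => //; case: Is => *; split.
  have inp2 := (inp_m I2, inp_n I2, inp_k I2, inp_N I2).
  have [k1 k2 k3 k4 k5] : [/\ sv s2 vcl = el, sv s2 vcq = eq, sv s2 vml = sv s vml,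
     sv s2 vmq = sv s vmq & sv s2 vhm = sv s vhm] by rewrite !(frmS F2).
  have k6 : sv s2 vupd = 1 by rewrite !(frmS F2).
  have kE := rows_keys X2 mqN.
  apply: wp_if; rewrite /= ?inp2; first by safe inp2.
    move/kE => ke; vc.
    apply: (wp_call (p_costP (x := vcl) (y := vcq) (l := el) (q := eq) _ _ _ _ _ _ _ _)) => //=.
      by case: I2 => *; split.
    move=> s3 X3 F3; have I3 : inp s3 by apply: (inp_frm _ F3) => //; case: I2 => *; split.
    vc; apply: (wp_call (p_costP (x := vml) (y := vmq) (l := sv s vml) (q := sv s vmq) _ _ _ _ _ _ _ _)) => //=.
    - by case: I3 => *; split.
    - by rewrite (frmS F3).
    - by rewrite (frmS F3).
    - lia.
    move=> s4 X4 F4; have I4 : inp s4 by apply: (inp_frm _ F4) => //; case: I3 => *; split.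
    have inp4 := (inp_m I4, inp_n I4, inp_k I4, inp_N I4).
    have Y4 : rv s4 rY = cost el eq.
      by rewrite (frmR F4) //= X3 (inp_Z I3) /= mulr0n addr0 add0r.
    have keep x : x \notin [:: vbase; vh; vj; vel; veq; vs] -> sv s4 x = sv s2 x.
      by move=> xn; rewrite (frmS F4) //= ?(frmS F3) //=;
        move: xn; rewrite !inE !negb_or => /and5P[-> -> -> -> /andP[-> ->]].
    rewrite mulr0n add0r in X4.
    apply: wp_if => //=; rewrite Y4 X4 => cmp; vc; last first.
    - apply: fin => //=; [by case: I4 => *; split|by rewrite keep|by rewrite keep|by rewrite !keep|].
      by move=> _; split=> //; rewrite leNgt.
    - by safe inp4.
    apply: fin => //; [by rewrite keep|by rewrite keep|by rewrite !keep|..].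
      by move=> _ _ _; apply: ltW.
    by rewrite keep // k6.
  move/negP => nk2; vc; apply: fin => //; first by move=> _ _ /kE.
  by rewrite k6.
rewrite -leqNgt leqn0 => /eqP hm0; vc; apply: fin => //=; first by case: Is => *; split.
by rewrite hm0.
Qed.

Lemma p_side1P s : inp s -> sv s vcl = el -> sv s vcq = eq -> N <= el ->
  memI cur (sv s vhm) (sv s vml) (sv s vmq) ->
  bestI cur (sv s vhb) (sv s vl3) (sv s vq3) (sv s vl4) (sv s vq4) (rv s rC) ->
  wp (p_side1 m k) (fun s' => bestI (upd cur el b)
    (sv s' vhb) (sv s' vl3) (sv s' vq3) (sv s' vl4) (sv s' vq4) (rv s' rC)) s.
Proof.
move=> Is sl sq Nel mI bI; have inpE := (inp_m Is, inp_n Is, inp_k Is, inp_N Is).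
rewrite /p_side1; apply: wp_if; rewrite /= ?inpE; first by safe inpE.
  move=> hm0; have [_ /(_ hm0)[mlN mqN mlt]] := mI.
  vc; [by safe inpE|by safe inpE|by safe inpE|by safe inpE|].
  apply: (wp_call (rowsP (l1 := sv s vml) (q1 := sv s vmq) (l2 := el) (q2 := eq)
    _ _ _ _ _ _ _ _ _ _)) => //=; try lia.
  - by case: Is => *; split.
  - by rewrite !divn_small.
  move=> s2 X2 F2; have I2 : inp s2 by apply: (inp_frm _ F2) => //; case: Is => *; split.
  have inp2 := (inp_m I2, inp_n I2, inp_k I2, inp_N I2).
  have [k1 k2 k3 k4 k5] : [/\ sv s2 vcl = el, sv s2 vcq = eq, sv s2 vml = sv s vml,
     sv s2 vmq = sv s vmq & sv s2 vhb = sv s vhb] by rewrite !(frmS F2).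
  have [j1 j2 j3 j4] : [/\ sv s2 vl3 = sv s vl3, sv s2 vq3 = sv s vq3, sv s2 vl4 = sv s vl4 &
     sv s2 vq4 = sv s vq4] by rewrite !(frmS F2).
  have j5 : rv s2 rC = rv s rC by rewrite (frmR F2).
  have kE := rows_keys X2 mqN.
  apply: wp_if; rewrite /= ?inp2; first by safe inp2.
    move/kE => ke; vc.
    apply: (wp_call (p_costP (x := vml) (y := vmq) (l := sv s vml) (q := sv s vmq) _ _ _ _ _ _ _ _)) => //=.
    - by case: I2 => *; split.
    - lia.
    move=> s3 X3 F3; have I3 : inp s3 by apply: (inp_frm _ F3) => //; case: I2 => *; split.
    vc; apply: (wp_call (p_costP (x := vcl) (y := vcq) (l := el) (q := eq) _ _ _ _ _ _ _ _)) => //=.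
    - by rewrite (frmS F3).
    - by rewrite (frmS F3).
    move=> s4 X4 F4; have I4 : inp s4 by apply: (inp_frm _ F4).
    have inp4 := (inp_m I4, inp_n I4, inp_k I4, inp_N I4).
    have keep x : x \notin [:: vbase; vh; vj; vel; veq; vs] -> sv s4 x = sv s2 x.
      by move=> xn; rewrite (frmS F4) //= ?(frmS F3) //=;
        move: xn; rewrite !inE !negb_or => /and5P[-> -> -> -> /andP[-> ->]].
    have C4 : rv s4 rC = rv s rC by rewrite (frmR F4) //= (frmR F3).
    rewrite X3 mulr0n add0r in X4.
    set c' := (cost (sv s vml) (sv s vmq) + cost el eq)%R in X4.
    have fin u : (if 0 < u then 0 < sv s vhb -> (c' <= rv s rC)%R
                  else 0 < sv s vhb /\ (rv s rC <= c')%R) ->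
      wp (If (CLt (K 0) (V vupd))
          (OpR Add rC rX rZ ;; SetS vhb (K 1) ;;
           SetS vl3 (V vml) ;; SetS vq3 (V vmq) ;;
           SetS vl4 (V vcl) ;; SetS vq4 (V vcq)) Skip)
        (fun s' => bestI (upd cur el b)
          (sv s' vhb) (sv s' vl3) (sv s' vq3) (sv s' vl4) (sv s' vq4) (rv s' rC))
        (putS s4 vupd u).
      move=> Hu; apply: wp_if => //= u0; rewrite ?u0 ?(negbTE u0) in Hu; vc; try by safe inp4.
        rewrite /= !keep // k1 k2 k3 k4 X4 (inp_Z I4) addr0.
        exact: (bestI_new nk eqE el2N eqN emin eb mI bI hm0 Nel ke Hu).
      rewrite /= !keep // k5 j1 j2 j3 j4 C4.
      have [hb0 le] := Hu.
      exact: (bestI_worse nk eqE el2N eqN emin eb mI bI hb0 le).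
    vc; apply: wp_if => //=; rewrite keep // k5 => hb0; last first.
      vc; first by safe inp4.
      by apply: fin => /= hb0'; rewrite hb0' in hb0.
    apply: wp_if => //=; rewrite X4 C4 => cmp; vc; try by safe inp4.
      by apply: fin => _; apply: ltW.
    by apply: fin; split=> //; rewrite leNgt.
  move/negP => nk2; vc; rewrite k5 j1 j2 j3 j4 j5.
  apply: (bestI_none nk eqE el2N eqN emin eb mI bI) => -[_].
  by move=> /kE.
move=> hm0; vc.
apply: (bestI_none nk eqE el2N eqN emin eb mI bI) => -[hm1 _].
by rewrite hm1 in hm0.
Qed.

Lemma p_popP s : inp s -> sv s vcl = el -> sv s vcq = eq -> av s acur = cur ->
  b = av s anxt (el %/ N * N + eq) ->
  tree_inv (fun=> True) (fun=> True) (av s atree) cur ->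
  wp (p_pop m k) (fun s' => av s' acur = upd cur el b /\
     tree_inv (fun=> True) (fun=> True) (av s' atree) (upd cur el b)) s.
Proof.
move=> Is sl sq sc sb TI; have inpE := (inp_m Is, inp_n Is, inp_k Is, inp_N Is).
have N0 := N_gt0 k.
have d1 : el %/ N <= 1 by rewrite -ltnS ltn_divLR.
have d2 : el %/ N * N <= el by apply: leq_divM.
have d3 : el %/ N * N + eq < 2 * N.
  by case: (el %/ N) d1 => [|[]] //; rewrite ?mul0n ?mul1n; lia.
rewrite /p_pop; vc; apply: wp_putA.
- by safe inpE.
- by safe inpE; rewrite ?sl ?sq /cell; lia.
- by rewrite /cell /= sl; lia.
vc; first by safe inpE; rewrite ?sl; lia.
(* Nodes off the path from [vx] to the root are in order. The path starts at [(2 * N + el) %/ 2],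
   which is below [2 ^ (k + 1)]; hence [k + 1] rounds suffice. *)
apply: (wp_while (I := fun c s' => [/\ inp s', sv s' vx < 2 * N, sv s' vx < 2 ^ c,
  av s' acur = upd cur el b &
  tree_inv (fun=> True) (fun y => ~ onpath (sv s' vx) y) (av s' atree) (upd cur el b)])
  (i := k + 1)) => //; last first.
  split=> //=.
  - by case: Is => *; split.
  - by rewrite sl inpE; lia.
  - by rewrite sl inpE addn1 expnS -/N; lia.
  - by rewrite sc sl inpE sq -sb.
  case: TI => t1 t2 t3; rewrite sl inpE addnC; split=> // y y0 yN ny.
  by apply: node_cur => //; [move=> z z0 zN; have [] := t2 z z0 zN|apply: t3].
move=> c s' cN [I' xN xc C' TI'].
have inp' := (inp_m I', inp_n I', inp_k I', inp_N I').
split; first by safe inp'.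
rewrite /=; case: ifP => x0; last first.
  split=> //; case: TI' => t1 t2 t3; split=> // y y0 yN _; apply: t3 => // -[d].
  by have -> : sv s' vx = 0; [lia|rewrite div0n => e; rewrite -e in y0].
case: c cN xc => [|c] cN xc; first by rewrite expn0 in xc; lia.
split=> //; vc.
apply: (wp_call (fixP (x := sv s' vx) _ _ _ _ _ _)) => //=.
- by case: TI' => t1 t2 t3 y yx yN; have [] := t2 y ltac:(lia) yN I.
- rewrite C' => l lN; rewrite updE; case: eqP => // _; last exact: curN.
  by case: eb.
move=> s2 [e [e2 T2 w1 w2]] F2; have I2 : inp s2 by apply: (inp_frm _ F2).
have inp2 := (inp_m I2, inp_n I2, inp_k I2, inp_N I2).
have x2 : sv s2 vx = sv s' vx by rewrite (frmS F2).
vc; first by safe inp2.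
exists c => //; split=> //=.
- by case: I2 => *; split.
- by rewrite x2; lia.
- by rewrite x2 ltn_divLR // -expnSr.
- by rewrite (frmA F2).
rewrite x2 T2; rewrite C' in w1 w2.
apply: tree_inv_fix TI' w1 w2 => // [y _|y ny]; first by right.
case: (eqVneq y (sv s' vx)) => [|ne]; [by left|right].
split=> [e'|op]; first by apply: ny; rewrite e'; apply: onpath_refl.
by case/onpath_half: op => // e'; rewrite e' eqxx in ne.
Qed.

End Pop.

End MergeSteps.

(** * The whole program *)

Section Correctness.
Variable R : realType.
Variables (m n k M B : nat) (f : nat -> R).
Hypotheses (nk : n <= 4 * k) (ME : M = m * n + m + n) (k_le : 4 * k <= n + 3).
Let N := 2 ^ k.
Hypothesis BE : 12 * N + M + 200 <= B.
Implicit Types (s : hst R).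
Notation wp := (@wp R M B).
Notation skey := (skey m n k f).
Notation inp := (@inp R m n k M f).
Notation memI := (memI m n k f).
Notation bestI := (bestI m n k f).
Notation tree_inv := (tree_inv m n k f).

Lemma p_mainP s : inp s -> (forall l, l < 2 * N -> av s acur l <= N) ->
  (forall p, p < 2 * N -> nxt_ok m n k f (av s anxt) p) ->
  tree_inv (fun=> True) (fun=> True) (av s atree) (av s acur) ->
  memI (av s acur) (sv s vhm) (sv s vml) (sv s vmq) ->
  bestI (av s acur) (sv s vhb) (sv s vl3) (sv s vq3) (sv s vl4) (sv s vq4) (rv s rC) ->
  wp (p_main m k N) (fun s' => (forall l, l < 2 * N -> N <= av s' acur l) /\
    bestI (av s' acur) (sv s' vhb) (sv s' vl3) (sv s' vq3) (sv s' vl4) (sv s' vq4) (rv s' rC)) s.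
Proof.
move=> Is CN NX TI mI bI; have N0 := N_gt0 k.
rewrite /p_main.
apply: (wp_while (I := fun c s' => [/\ inp s',
  (forall l, l < 2 * N -> av s' acur l <= N) /\ remaining m n k f (av s' acur) <= c,
  av s' anxt = av s anxt /\ tree_inv (fun=> True) (fun=> True) (av s' atree) (av s' acur),
  memI (av s' acur) (sv s' vhm) (sv s' vml) (sv s' vmq) &
  bestI (av s' acur) (sv s' vhb) (sv s' vl3) (sv s' vq3) (sv s' vl4) (sv s' vq4) (rv s' rC)])
  (i := 2 * N * N)) => //; last by split=> //; split=> //; apply: remaining_le.
move=> c s' _ {mI bI TI CN} [I' [CN muc] [NX' TI] mI bI].
have inp' := (inp_m I', inp_n I', inp_k I', inp_N I').
have [t1 t2 t3] := TI.
have [T1 _] := t2 1 isT ltac:(lia) I.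
set el := av s' atree 1 in T1; set eq := av s' acur el.
have emin l : l < 2 * N -> (skey el eq <= skey l (av s' acur l))%O.
  by move=> lN; apply: (root_min nk lN t1) => y y0 yN; apply: t3.
split; first by safe inp'; rewrite /cell; lia.
rewrite /= inp' -/el -/eq; case: ifP => eqN; last first.
  (* The root is minimal and exhausted leaves come last, so an exhausted root means that all leaves
     are exhausted. *)
  split=> // l lN; rewrite leqNgt; apply/negP => ClN.
  have := emin l lN; rewrite leNgt skey_exh // divn_small // divn_gt0 // leqNgt.
  by rewrite eqN.
have d1 : el %/ N <= 1 by rewrite -ltnS ltn_divLR.
have dN : el %/ N * N + eq < 2 * N.
  by case: (el %/ N) d1 => [|[]] //; rewrite ?mul0n ?mul1n; lia.
set b := av s anxt (el %/ N * N + eq).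
have dE : (el %/ N * N + eq) %/ N = el %/ N by rewrite divnMDl // (divn_small eqN) addn0.
(* The entry was computed for the representative leaf [el %/ N * N]; translation carries it over to
   [el]. *)
have eb : isnext m n k f el eq b.
  have := NX _ dN; rewrite /nxt_ok -/N dE addKn; apply: isnext_translate => //.
  by rewrite mulnK.
have mu0 := remaining_step erefl T1 eqN eb.
split; first lia.
vc; [by safe inp'; rewrite /cell; lia|by safe inp'; rewrite -/el /cell; lia|].
set s1 := putS _ vcq _.
have I1 : inp s1 by case: I' => *; split.
have [e1 e2] : sv s1 vcl = el /\ sv s1 vcq = eq by [].
apply: (wp_call (Q0 := fun s2 => [/\ memI (upd (av s' acur) el b) (sv s2 vhm) (sv s2 vml) (sv s2 vmq) &
  bestI (upd (av s' acur) el b) (sv s2 vhb) (sv s2 vl3) (sv s2 vq3) (sv s2 vl4) (sv s2 vq4) (rv s2 rC)])).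
  apply: wp_if; first by safe inp'.
    rewrite /= inp' -/el => elN.
    apply: (wp_call (p_side0P nk ME k_le BE erefl T1 eqN emin eb I1 e1 e2 elN mI)) => s2 m2 F2.
    split=> //; rewrite !(frmS F2) // (frmR F2) //=.
    by apply: bestI_keep => // l' q' Nel; rewrite leqNgt elN in Nel.
  rewrite /= inp' -/el -leqNgt => Nel.
  apply: (wp_call (p_side1P nk ME k_le BE erefl T1 eqN emin eb I1 e1 e2 Nel mI bI)) => s2 b2 F2.
  split=> //; rewrite !(frmS F2) //=.
  by apply: (memI_keep erefl T1 eqN eb mI) => elN; rewrite leqNgt elN in Nel.
move=> s2 [m2 b2] F2; have I2 : inp s2 by apply: (inp_frm _ F2).
have [C2 N2 T2] : [/\ av s2 acur = av s' acur, av s2 anxt = av s anxt & av s2 atree = av s' atree].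
  by rewrite !(frmA F2).
apply: (wp_call (p_popP nk ME k_le BE erefl T1 eqN eb CN I2 _ _ C2 _ _)).
- by rewrite (frmS F2).
- by rewrite (frmS F2).
- by rewrite N2.
- by rewrite T2.
move=> s3 [C3 T3] F3; have I3 : inp s3 by apply: (inp_frm _ F3).
exists (remaining m n k f (upd (av s' acur) el b)); first lia.
rewrite C3 !(frmS F3) // (frmR F3) // (frmA F3) //; split=> //.
split=> // l lN; rewrite updE; case: eqP => // _; last exact: CN.
by case: eb.
Qed.

(** The state [putS s vh a] occurs because [j] is evaluated after [vh] has been assigned. The test
    [i < n] drops the padding bits. *)
Lemma p_bitsP s h j a j0 : sv s vn = n -> sv s vk = k ->
  sf B s h -> sf B (putS s vh a) j -> ev s h = a -> ev (putS s vh a) j = j0 ->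
  a <= N -> j0 + k <= 4 * k ->
  wp (p_bits k h j) (fun s' => forall i, iv s' i =
    if (j0 <= i < j0 + k) && (i < n) then (bit a (i - j0))%:R%R else iv s i) s.
Proof.
move=> sn sk sfh sfj ea ej aN jk; have kN' := kN k; have N0 := N_gt0 k.
rewrite /p_bits; vc; [by []|by rewrite ea|by []|].
apply: (wp_while (I := fun c s' => [/\ sv s' vn = n /\ sv s' vk = k, sv s' vi + c = k,
  sv s' vj = j0 + sv s' vi, sv s' vh = a %/ 2 ^ sv s' vi &
  forall i, iv s' i = if (j0 <= i < j0 + sv s' vi) && (i < n) then (bit a (i - j0))%:R%R
                      else iv s i]) (i := k)) => //; last first.
  split=> //=; first by rewrite addn0 ea ej.
    by rewrite divn1.
  by move=> i; rewrite addn0; case: ifP => //; lia.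
move=> c s' ck [[e1 e2] e3 e4 e5 e6].
have hN : sv s' vh <= N by rewrite e5; apply: leq_trans (leq_div _ _) aN.
split; first by safe e1.
rewrite /= e2; case: ifP => ik; last first.
  by move=> i; rewrite e6; have -> : sv s' vi = k by lia.
split; first lia.
have fin s5 : sv s5 vn = n -> sv s5 vk = k -> sv s5 vi = sv s' vi -> sv s5 vj = sv s' vj ->
  sv s5 vh = sv s' vh ->
  (forall i, iv s5 i = if (j0 <= i < j0 + (sv s' vi).+1) && (i < n) then (bit a (i - j0))%:R%R
                      else iv s i) ->
  wp (SetS vh (V vh /^ K 2) ;; SetS vj (V vj +^ K 1) ;; SetS vi (V vi +^ K 1))
   (fun s' => exists2 j, j < c & [/\ sv s' vn = n /\ sv s' vk = k, sv s' vi + j = k,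
  sv s' vj = j0 + sv s' vi, sv s' vh = a %/ 2 ^ sv s' vi &
  forall i, iv s' i = if (j0 <= i < j0 + sv s' vi) && (i < n) then (bit a (i - j0))%:R%R
                      else iv s i]) s5.
  move=> h1 h2 h3 h4 h5 h6; vc; [by safe h1|by safe h1; rewrite h4; lia|by safe h1; rewrite h3; lia|].
  exists c.-1; first lia; split=> //=.
  - by rewrite h3; lia.
  - by rewrite h3 h4 e4; lia.
  - by rewrite h3 h5 e5 addn1 expnSr divnMA.
  by move=> i; rewrite h6 h3 addn1.
vc; apply: wp_if; first by safe e1.
  rewrite /= e1 => jn; vc.
  apply: (wp_call (Q0 := fun s2 => rv s2 rX = (bit a (sv s' vi))%:R%R)).
    apply: wp_if; first by safe e1; lia.
      by rewrite /= parityE => o; vc; rewrite /= /bit -e5; case: (odd _) o.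
    by rewrite /= parityE => o; vc; rewrite /= /bit -e5; case: (odd _) o.
  move=> s2 X2 F2; have j2 : sv s2 vj = sv s' vj by rewrite (frmS F2).
  apply: wp_store; [by []|by rewrite /= j2; lia|].
  apply: fin; rewrite /= ?(frmS F2) //.
  move=> i; rewrite updE X2 (frmI F2) // e6 e4; case: eqP => [->|ne].
    by rewrite addKn -e4 jn andbT ifT // e4; lia.
  by rewrite (_ : i < j0 + (sv s' vi).+1 = (i < j0 + sv s' vi)) //; lia.
rewrite /= e1 => jn; apply: wp_skip; apply: fin => // i; rewrite e6; do 2 case: ifP => //; lia.
Qed.

Lemma p_outP s : inp s -> 0 < m -> (0 < sv s vhb ->
    [/\ sv s vl3 < N, sv s vq3 < N, N <= sv s vl4 < 2 * N & sv s vq4 < N]) ->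
  wp (p_out k) (fun s' => sv s' vm = sv s vhb /\ (0 < sv s vhb ->
    (forall i, i < n -> iv s' i =
       (xof k (sv s vl3) (sv s vq3) (sv s vl4 - N) (sv s vq4) i)%:R%R) /\
    iv s' n = rv s rC)) s.
Proof.
move=> Is m0 H; have inpE := (inp_m Is, inp_n Is, inp_k Is, inp_N Is).
have kN' := kN k; have N0 := N_gt0 k.
(* Cell [n], which receives the minimum, lies in the input region because [m] is positive. *)
have nM : n < M by rewrite ME; lia.
rewrite /p_out; vc; apply: wp_if; first by safe inpE.
  move=> /= hb; have {H} [b1 b2 /andP[b3 b4] b5] := H hb.
  vc; apply: (wp_call (p_bitsP (a := sv s vl3) (j0 := 0) _ _ _ _ _ _ _ _)); rewrite /= ?inpE //; try lia.
  move=> s2 X2 F2; have e2 := (frmS F2).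
  have [n2 k2] : sv s2 vn = n /\ sv s2 vk = k by rewrite !e2 // !inpE.
  vc; apply: (wp_call (p_bitsP (a := sv s vq3) (j0 := k) _ _ _ _ _ _ _ _)); rewrite /= ?n2 ?k2 ?e2 //; try lia.
  move=> s3 X3 F3; have e3 := (frmS F3).
  have [n3 k3 N3] : [/\ sv s3 vn = n, sv s3 vk = k & sv s3 vN = N] by rewrite !e3 // n2 k2 e2 // inpE.
  vc; apply: (wp_call (p_bitsP (a := sv s vl4 - N) (j0 := 2 * k) _ _ _ _ _ _ _ _));
    rewrite /= ?n3 ?k3 ?N3 ?e3 ?e2 //; try by safe n3; lia.
  move=> s4 X4 F4; have e4 := (frmS F4).
  have [n4 k4] : sv s4 vn = n /\ sv s4 vk = k by rewrite !e4.
  vc; apply: (wp_call (p_bitsP (a := sv s vq4) (j0 := 3 * k) _ _ _ _ _ _ _ _));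
    rewrite /= ?n4 ?k4 ?e4 ?e3 ?e2 //; try by safe n4; lia.
  move=> s5 X5 F5; have e5 := (frmS F5).
  have [n5 h5 C5] : [/\ sv s5 vn = n, sv s5 vhb = sv s vhb & rv s5 rC = rv s rC].
    by rewrite !e5 // !e4 // !e3 // !e2 // inpE (frmR F5) // (frmR F4) // (frmR F3) // (frmR F2).
  apply: wp_store; [by []|by rewrite /= n5|]; vc; first by [].
  rewrite /= n5 h5 C5 updE eqxx; split=> // _; split=> // i ni.
  rewrite updE ifN; last lia.
  (* The four writes, last one first: the blocks are disjoint, so the one containing [i] is the
     quotient of [i] by [k]. *)
  rewrite X5 X4 X3 X2 ni !andbT /xof.
  have k0 : 0 < k by lia.
  have blk g : g * k <= i < g * k + k -> i %/ k = g /\ i %% k = i - g * k.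
    move=> /andP[g1 g2]; have -> : i = g * k + (i - g * k) by lia.
    by rewrite divnMDl // modnMDl divn_small ?modn_small ?addn0 //; lia.
  case: ifP => [c4|c4].
    by have [-> ->] := blk 3 c4.
  case: ifP => [c3|c3].
    by have [-> ->] := blk 2 ltac:(lia).
  case: ifP => [c2|c2].
    by have [|-> ->] := blk 1; [lia|rewrite mul1n].
  by have [|-> ->] := blk 0; [lia|rewrite /= ifT ?mul0n //; lia].
rewrite /= => hb; vc; first by [].
by split=> // hb'; rewrite hb' in hb.
Qed.

Lemma p_setupP s : k = (n + 3) %/ 4 -> sv s vm = m -> sv s vn = n -> rv s rZ = 0%R ->
  (forall i, i < M -> iv s i = f i) -> wp (p_setup k) inp s.
Proof.
move=> kE sm sn sz si; have kN' := kN k; have N0 := N_gt0 k.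
rewrite /p_setup; vc; [by safe sn; lia|by safe sn|by safe sn|].
apply: (wp_while (I := fun c s' => [/\ sv s' vm = m /\ sv s' vn = n,
  sv s' vk = k /\ sv s' vN = 2 ^ sv s' vi, sv s' vi + c = k, rv s' rZ = 0%R &
  forall i, i < M -> iv s' i = f i]) (i := k)) => //; last by split=> //=; rewrite sn kE.
move=> c s' ck [[e1 e2] [e3 e4] e5 e6 e7].
split; first by safe e1.
rewrite /= e3; case: ifP => ik; last by split=> //; rewrite e4; congr (2 ^ _); lia.
split; first lia.
have p2 : 2 * 2 ^ sv s' vi <= N by rewrite -expnS leq_exp2l.
vc; [by safe e4; rewrite e4; lia|by safe e4; lia|].
exists c.-1; first lia; split=> //=; last lia.
by rewrite e3 e4 addn1 expnS.
Qed.

Lemma p_allP s : 0 < m -> k = (n + 3) %/ 4 -> sv s vm = m -> sv s vn = n -> rv s rZ = 0%R ->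
  (forall i, i < M -> iv s i = f i) -> sv s vhm = 0 -> sv s vhb = 0 ->
  wp (p_all m k N) (fun s' =>
    sv s' vm = 1 /\ (exists x : nat -> bool, [/\ solution m n f x,
        forall i, i < n -> iv s' i = (x i)%:R%R, iv s' n = xsum n f (m * n + m) x &
        forall y, solution m n f y -> (xsum n f (m * n + m) x <= xsum n f (m * n + m) y)%R]) \/
    sv s' vm = 0 /\ forall x, ~ solution m n f x) s.
Proof.
move=> m0 kE sm sn sz si shm shb; rewrite /p_all; vc.
apply: (wp_call (p_setupP kE sm sn sz si)) => s1 I1 F1.
vc; apply: (wp_call (p_initP nk ME k_le BE I1)) => s2 [st2 nx2 t2] F2.
have I2 : inp s2 by apply: (inp_frm _ F2).
have CN l : l < 2 * N -> av s2 acur l <= N by case/st2.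
vc; apply: (wp_call (p_buildP nk ME k_le BE I2 t2 CN)) => s3 [C3 N3 T3] F3.
have I3 : inp s3 by apply: (inp_frm _ F3).
(* Every leaf starts at its minimum, so nothing counts as enumerated and both invariants of the
   merge hold vacuously. *)
have nodone l q : ~ done m n k f (av s2 acur) l q.
  by case=> lN qN; have [_ /(_ q qN)] := st2 l lN; rewrite leNgt => /negbTE ->.
have [hm3 hb3] : sv s3 vhm = 0 /\ sv s3 vhb = 0.
  by rewrite !(frmS F3) // !(frmS F2) // !(frmS F1).
vc; apply: (wp_call (p_mainP I3 _ _ _ _ _)); rewrite ?C3 ?N3 ?hm3 ?hb3 //.
- exact: memI0.
- exact: bestI0.
move=> s4 [all4 b4] F4; have I4 : inp s4 by apply: (inp_frm _ F4).
apply: (wp_call (p_outP I4 m0 _)).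
  by move=> hb; have [_ /(_ hb)[]] := b4; case=> _ [? ?] [? ?].
move=> s5 [-> H5] _; have := bestI_final nk b4 all4 => -[[hb [sx cE opt]]|[hb no]].
  left; split=> //; have [|x5 c5] := H5; first by rewrite hb.
  exists (xof k (sv s4 vl3) (sv s4 vq3) (sv s4 vl4 - N) (sv s4 vq4)); split=> //.
    by rewrite c5 cE.
  by move=> y sy; rewrite -cE; apply: opt.
by right.
Qed.

End Correctness.

(** * Running time *)

Section Cost.

(* The arguments are the number of constraints, [k] and [N = 2 ^ k]. *)
Definition bounded (p : nat -> nat -> nat -> cmd) (h : nat -> nat -> nat -> nat) :=
  exists c, forall m k N, 0 < m -> 0 < N -> time (p m k N) <= c * h m k N.

Lemma bounded_const p h : (forall m k N, 0 < m -> 0 < N -> 0 < h m k N) ->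
  bounded (fun _ _ _ => p) h.
Proof.
by move=> h0; exists (time p) => m k N m0 N0; rewrite leq_pmulr ?h0.
Qed.

Lemma bounded_seq p q h : bounded p h -> bounded q h ->
  bounded (fun m k N => p m k N ;; q m k N) h.
Proof.
move=> [c Hc] [d Hd]; exists (c + d) => m k N m0 N0 /=.
by rewrite mulnDl leq_add ?Hc ?Hd.
Qed.

Lemma bounded_if b p q h : (forall m k N, 0 < m -> 0 < N -> 0 < h m k N) ->
  bounded p h -> bounded q h ->
  bounded (fun m k N => If b (p m k N) (q m k N)) h.
Proof.
move=> h0 [c Hc] [d Hd]; exists (cond_size b + 1 + c + d) => m k N m0 N0 /=.
have := Hc m k N m0 N0; have := Hd m k N m0 N0; have := h0 m k N m0 N0.
rewrite !mulnDl mul1n; move: (h m k N) => y y0.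
have := leq_pmulr (cond_size b) y0; lia.
Qed.

(** The successor of [it] pays for the final test. Since [h] is positive, the overhead of a round is
    absorbed into the constant. *)
Lemma bounded_while it b p h h' : (forall m k N, 0 < m -> 0 < N -> 0 < h m k N) ->
  (exists a, forall m k N, 0 < m -> 0 < N -> (it m k N).+1 * h m k N <= a * h' m k N) ->
  bounded p h -> bounded (fun m k N => While (it m k N) b (p m k N)) h'.
Proof.
move=> h0 [a Ha] [c Hc]; exists ((cond_size b + 1 + c) * a) => m k N m0 N0 /=.
apply: (@leq_trans ((cond_size b + 1 + c) * ((it m k N).+1 * h m k N))); last first.
  by rewrite -mulnA leq_mul2l Ha ?orbT.
apply: (@leq_trans ((it m k N).+1 * ((cond_size b + 1 + c) * h m k N))); last first.
  by rewrite mulnCA.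
have H : cond_size b + (time (p m k N) + 1) <= (cond_size b + 1 + c) * h m k N.
  have := Hc m k N m0 N0; have := h0 m k N m0 N0; rewrite !mulnDl mul1n.
  by move: (h m k N) => y y0; have := leq_pmulr (cond_size b) y0; lia.
have H2 : cond_size b <= (cond_size b + 1 + c) * h m k N by lia.
by rewrite mulSn addnC leq_add // leq_mul2l H orbT.
Qed.

Lemma bounded_weak a p h h' : bounded p h ->
  (forall m k N, 0 < m -> 0 < N -> h m k N <= a * h' m k N) -> bounded p h'.
Proof.
move=> [c Hc] H; exists (c * a) => m k N m0 N0.
by apply: leq_trans (Hc _ _ _ m0 N0) _; rewrite -mulnA leq_mul2l H ?orbT.
Qed.

Ltac bd :=
  let pos := (by move=> *; rewrite ?muln_gt0; lia) in
  repeat first [eassumption | lazymatch goal with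
  | |- bounded (fun m k N => Seq _ _) _ => apply: bounded_seq
  | |- bounded (fun m k N => If _ _ _) _ => apply: bounded_if; [pos| |]
  | |- bounded (fun m k N => While _ _ _) _ => fail
  | |- bounded _ _ => apply: bounded_const; pos
  end].

(** [k.+1] rather than [k] keeps the bound positive when [k = 0]. *)
Lemma bounded_add : bounded (fun m k N => p_add k) (fun m k N => k.+1).
Proof.
rewrite /p_add; apply: (@bounded_while _ _ _ (fun _ _ _ => 1) _) => //.
  by exists 1 => *; lia.
by bd.
Qed.

Lemma bounded_key : bounded (fun m k N => p_key k) (fun m k N => k.+1).
Proof. by have H := bounded_add; rewrite /p_key /p_val; bd. Qed.

Lemma bounded_rows : bounded (fun m k N => p_rows m k) (fun m k N => m * k.+1).
Proof.
have H := bounded_key; rewrite /p_rows; bd.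
apply: (@bounded_while _ _ _ (fun m k N => k.+1) _) => //; last by bd.
by exists 2 => m k N m0 _; rewrite mulnA leq_mul2r; lia.
Qed.

Lemma bounded_less : bounded (fun m k N => p_less m k) (fun m k N => m * k.+1).
Proof. by have H := bounded_rows; rewrite /p_less; bd. Qed.

Lemma bounded_minq : bounded (fun m k N => p_minq m k N) (fun m k N => m * k.+1 * N).
Proof.
have H := bounded_less; rewrite /p_minq; bd.
apply: (@bounded_while _ _ _ (fun m k N => m * k.+1) _); last by bd.
  by move=> *; rewrite muln_gt0; lia.
by exists 2 => m k N m0 N0; rewrite mulnC [2 * _]mulnCA leq_mul2l; lia.
Qed.

Lemma bounded_init : bounded (fun m k N => p_init m k N)
  (fun m k N => m * k.+1 * N * N).
Proof.
have H := bounded_minq; rewrite /p_init; bd.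
apply: (@bounded_while _ _ _ (fun m k N => m * k.+1 * N) _); last by bd.
  by move=> *; rewrite !muln_gt0; lia.
by exists 3 => m k N m0 N0; rewrite mulnC [3 * _]mulnCA leq_mul2l; lia.
Qed.

Lemma bounded_fix : bounded (fun m k N => p_fix m k) (fun m k N => m * k.+1).
Proof. by have H := bounded_less; rewrite /p_fix; bd. Qed.

Lemma bounded_build : bounded (fun m k N => p_build m k N) (fun m k N => m * k.+1 * N).
Proof.
have H := bounded_fix; rewrite /p_build; bd.
apply: (@bounded_while _ _ _ (fun m k N => m * k.+1) _); last by bd.
  by move=> *; rewrite muln_gt0; lia.
by exists 3 => m k N m0 N0; rewrite mulnC [3 * _]mulnCA leq_mul2l; lia.
Qed.

(** One factor [k.+1] counts the levels of the tree, the other the terms recomputed for each of the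
    [m] rows of a comparison. *)
Lemma bounded_pop : bounded (fun m k N => p_pop m k) (fun m k N => m * k.+1 * k.+1).
Proof.
have H := bounded_fix; rewrite /p_pop; bd.
apply: (@bounded_while _ _ _ (fun m k N => m * k.+1) _); last by bd.
  by move=> *; rewrite muln_gt0; lia.
by exists 2 => m k N m0 N0; rewrite mulnC [2 * _]mulnCA leq_mul2l; lia.
Qed.

Lemma bounded_side :
  bounded (fun m k N => If (CLt (V vcl) (V vN)) (p_side0 m k) (p_side1 m k))
    (fun m k N => m * k.+1 * k.+1).
Proof.
have H1 : bounded (fun m k N => p_rows m k) (fun m k N => m * k.+1 * k.+1).
  by apply: (@bounded_weak 1 _ _ _ bounded_rows) => *; rewrite mul1n leq_pmulr.
have H2 : bounded (fun m k N => p_val k) (fun m k N => m * k.+1 * k.+1).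
  have H := bounded_add; apply: (@bounded_weak 1 _ (fun m k N => k.+1) _).
    by rewrite /p_val; bd.
  by move=> *; rewrite mul1n leq_pmull ?muln_gt0 //; lia.
by rewrite /p_side0 /p_side1 /p_cost; bd.
Qed.

Lemma bounded_main : bounded (fun m k N => p_main m k N)
  (fun m k N => m * k.+1 * k.+1 * (N * N)).
Proof.
have H1 := bounded_side; have H2 := bounded_pop; rewrite /p_main.
apply: (@bounded_while _ _ _ (fun m k N => m * k.+1 * k.+1) _); last by bd.
  by move=> *; rewrite !muln_gt0; lia.
exists 3 => m k N m0 N0; rewrite mulnC [3 * _]mulnCA leq_mul2l -mulnA.
by have : 0 < N * N; [rewrite muln_gt0 N0|lia].
Qed.

Lemma bounded_bits h j : bounded (fun m k N => p_bits k h j) (fun m k N => k.+1).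
Proof.
rewrite /p_bits; bd; apply: (@bounded_while _ _ _ (fun _ _ _ => 1) _) => //; last by bd.
by exists 1 => *; lia.
Qed.

Lemma bounded_all : bounded (fun m k N => p_all m k N)
  (fun m k N => m * k.+1 ^ 2 * N ^ 2).
Proof.
have up h p : bounded p h ->
    (forall m k N, 0 < m -> 0 < N -> h m k N <= m * k.+1 * k.+1 * (N * N)) ->
    bounded p (fun m k N => m * k.+1 ^ 2 * N ^ 2).
  move=> Hp Hh; apply: (@bounded_weak 1 _ _ _ Hp) => m k N m0 N0.
  by rewrite mul1n -!mulnn (mulnA m); apply: Hh.
have k1 m k N : 0 < m -> 0 < N -> k.+1 <= m * k.+1 * k.+1 * (N * N).
  by move=> m0 N0; rewrite mulnAC leq_pmull // !muln_gt0 m0 N0.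
have Hs : bounded (fun m k N => p_setup k) (fun m k N => k.+1).
  rewrite /p_setup; bd; apply: (@bounded_while _ _ _ (fun _ _ _ => 1) _) => //; last by bd.
  by exists 1 => *; lia.
have Ho : bounded (fun m k N => p_out k) (fun m k N => k.+1).
  have Hb := bounded_bits; rewrite /p_out; bd; exact: Hb.
have := up _ _ Hs k1; have := up _ _ Ho k1.
have := up _ _ bounded_main (fun _ _ _ _ _ => leqnn _).
have H1 m k N : 0 < m -> 0 < N -> m * k.+1 * N * N <= m * k.+1 * k.+1 * (N * N).
  by move=> m0 N0; rewrite -mulnA leq_mul2r leq_pmulr ?orbT.
have H2 m k N : 0 < m -> 0 < N -> m * k.+1 * N <= m * k.+1 * k.+1 * (N * N).
  by move=> m0 N0; apply: leq_trans (H1 m k N m0 N0); rewrite leq_pmulr.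
have := up _ _ bounded_init H1; have := up _ _ bounded_build H2.
by move=> *; rewrite /p_all; bd.
Qed.

End Cost.

Arguments along : simpl never.

(** * The machine program *)

Section Link.
Variable R : realType.

(** Fills the pointer cells required by [simB]: the length [m * n + m + n] of an optimization input,
    and the three addresses behind it. *)
Definition prelude :=
  [:: WOp Mul (Dir rbase) (Dir vm) (Dir vn);
      WOp Add (Dir rbase) (Dir rbase) (Dir vm);
      WOp Add (Dir rbase) (Dir rbase) (Dir vn);
      WConst (Dir rbase.+1) 1; WOp Add (Dir rbase.+1) (Dir rbase) (Dir rbase.+1);
      WConst (Dir rbase.+2) 2; WOp Add (Dir rbase.+2) (Dir rbase) (Dir rbase.+2);
      WConst (Dir rbase.+3) 3; WOp Add (Dir rbase.+3) (Dir rbase) (Dir rbase.+3)].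

(* The same program serves both problems: cells behind the input read as 0, so a
   feasibility instance is an optimization instance with a zero objective. *)
Definition prog : program :=
  prelude ++ compile (size prelude) (p_all 0 0 0).

Lemma along_offset B d i M code (c : config R) Q : fit B c -> 100 <= B -> M + i <= B ->
  d < abase -> d != rbase -> wget c rbase = M ->
  (forall c', fit B c' -> rmem c' = rmem c ->
     (forall x, wget c' x = if x == d then M + i else wget c x) -> along B code c' Q) ->
  along B (WConst (Dir d) i :: WOp Add (Dir d) (Dir rbase) (Dir d) :: code) c Q.
Proof.
move=> fc B100 MiB da dr cM H.
apply: along_wconst => //=; [lia|lia|move=> c1 f1 r1 E1].
have V : wval c1 (Dir rbase) + wval c1 (Dir d) = M + i.
  by rewrite /wval /= !E1 eqxx eq_sym (negbTE dr) cM.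
apply: along_wop => //=; [lia|by rewrite V|rewrite V => c2 f2 r2 E2].
apply: H => //; first by rewrite r2 r1.
by move=> x; rewrite E2 E1; case: eqP.
Qed.

(** Cells never written read as [0], so arrays, scalars and real scalars need no clearing; in
    particular [rZ], [vhm] and [vhb] start at zero. *)
Lemma prelude_ok m n M B (rm : seq R) :
  M = m * n + m + n -> 100 <= B -> M + 4 <= B -> size rm <= M ->
  let c := Config 0 [:: m; n] rm in
  let st := HS (nth 0 [:: m; n]) (fun _ _ => 0) (fun=> 0%R) (nth 0%R rm) in
  fit B c /\ along B prelude c (fun c' => sim M B c' st).
Proof.
move=> ME B100 MB sr c st.
have fc : fit B c by split=> //=; [lia|lia|rewrite !andbT; lia].
split=> //; rewrite /prelude.
have V0 : wval c (Dir 0) * wval c (Dir 1) = m * n by [].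
apply: along_wop => //=; [lia|by rewrite V0; lia|rewrite V0 => c1 f1 r1 E1].
have V1 : wval c1 (Dir rbase) + wval c1 (Dir 0) = m * n + m by rewrite /wval /= !E1.
apply: along_wop => //=; [lia|by rewrite V1; lia|rewrite V1 => c2 f2 r2 E2].
have V2 : wval c2 (Dir rbase) + wval c2 (Dir 1) = M.
  by rewrite /wval /= !E2 /= E1 ME.
apply: along_wop => //=; [lia|by rewrite V2; lia|rewrite V2 => c3 f3 r3 E3].
apply: (along_offset (M := M)) => //; [lia|move=> c4 f4 r4 E4].
have M4 : wget c4 rbase = M by rewrite E4 E3.
apply: (along_offset (M := M)) => //; [lia|move=> c5 f5 r5 E5].
have M5 : wget c5 rbase = M by rewrite E5.
apply: (along_offset (M := M)) => //; [lia|move=> c6 f6 r6 E6].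
have rmE : rmem c6 = rm by rewrite r6 r5 r4 r3 r2 r1.
have low x : x < rbase \/ rbase + 4 <= x -> wget c6 x = nth 0 [:: m; n] x.
  by move=> xr; rewrite E6 E5 E4 E3 E2 E1 !ifN //; apply/eqP; lia.
apply: along_nil; split=> //.
- by move=> x xr; apply: low; left.
- by move=> [|[|[|[|]]]] // _; rewrite E6 E5 E4 E3 ?addn0.
- move=> a i a3; rewrite low; last by right; rewrite /cell; lia.
  by rewrite nth_default // /cell /=; lia.
- by move=> x x4; rewrite /rget rmE nth_default //; apply: leq_trans sr (leq_addr _ _).
- by move=> i iM; rewrite /rget rmE.
Qed.

Lemma prelude_sound p code m n M B (rm : seq R) Q :
  M = m * n + m + n -> 100 <= B -> M + 4 <= B -> size rm <= M ->
  cmd_wf p -> compile (size prelude) p = code ->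
  wp M B p Q (HS (nth 0 [:: m; n]) (fun _ _ => 0) (fun=> 0%R) (nth 0%R rm)) ->
  computes_within (prelude ++ code) (size prelude + time p) (B + B)
    (Config 0 [:: m; n] rm) (fun c => exists2 s, sim M B c s & Q s).
Proof.
move=> ME B100 MB sr wf <- H; have [fc Hpre] := prelude_ok ME B100 MB sr.
set P := prelude ++ _.
have Pc : at_pos P (pc (Config 0 [:: m; n] rm)) prelude by exists [::], (compile (size prelude) p).
have Pm : at_pos P (size prelude) (compile (size prelude) p).
  by exists prelude, [::]; rewrite cats0.
have H' : reach B P (Config 0 [:: m; n] rm) (size prelude + time p)
    (fun c' => pc c' = size prelude + size (compile (size prelude) p) /\
               exists2 s, sim M B c' s & Q s).
  by apply: (along_reach Pc fc Hpre) => c1 f1 pc1 s1; apply: (wp_sound B100 MB wf H pc1 Pm s1).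
apply: (reach_computes H').
by move=> c2 [pc2 H2]; rewrite pc2 /P size_cat.
Qed.

Lemma prog_run m n k M B (rm : seq R) : 0 < m -> k = (n + 3) %/ 4 ->
  M = m * n + m + n -> 12 * 2 ^ k + M + 200 <= B -> size rm <= M ->
  let f := nth 0%R rm in
  computes_within prog (size prelude + time (p_all m k (2 ^ k))) (B + B)
    (Config 0 [:: m; n] rm) (fun c' =>
    wget c' 0 = 1 /\ (exists x : nat -> bool, [/\ solution m n f x,
        forall i, i < n -> rget c' i = (x i)%:R%R, rget c' n = xsum n f (m * n + m) x &
        forall y, solution m n f y -> (xsum n f (m * n + m) x <= xsum n f (m * n + m) y)%R]) \/
    wget c' 0 = 0 /\ forall x, ~ solution m n f x).
Proof.
move=> m0 kE ME BE sr f.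
have B100 : 100 <= B by lia.
have MB : M + 4 <= B by lia.
have nk : n <= 4 * k by lia.
have k_le : 4 * k <= n + 3 by lia.
set st := HS (nth 0 [:: m; n]) (fun _ _ => 0) (fun=> 0%R) (nth 0%R rm).
have H := p_allP nk ME k_le BE (s := st) m0 kE erefl erefl erefl (fun _ _ => erefl) erefl erefl.
have [h1 h2 [s2 S2 H2]] := prelude_sound ME B100 MB sr (p_all_wf _ _ _) (comp_p_all _ _ _ _) H.
split=> //.
have nM : n < M by rewrite ME; lia.
rewrite (simS S2) //; case: H2 => [[-> [x [sx xE cE opt]]]|[-> no]]; [left|right]; split=> //.
exists x; split=> // [i ni|]; last by rewrite (simI S2) ?cE.
by rewrite (simI S2) ?xE //; lia.
Qed.

Lemma nth_allpairs (S T U : Type) (g : S -> T -> U) x0 y0 z0 s t i j :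
  i < size s -> j < size t ->
  nth z0 [seq g x y | x <- s, y <- t] (i * size t + j) = g (nth x0 s i) (nth y0 t j).
Proof.
elim: s i => //= x s IH [|i] si tj; rewrite nth_cat size_map.
  by rewrite mul0n add0n tj (nth_map y0).
by rewrite ifF ?mulSn -?addnA ?addKn ?IH //; lia.
Qed.

(** * From memory contents to matrices *)

Section Instance.
Variables (m n : nat) (A : 'M[R]_(m, n)) (b : 'cV[R]_m) (c : 'cV[R]_n) (rm : seq R).
Let f := nth 0%R rm.
Hypothesis fA : forall (i : 'I_m) (j : 'I_n), f (i * n + j) = A i j.
Hypothesis fb : forall i : 'I_m, f (m * n + i) = b i 0%R.
Hypothesis fc : forall j : 'I_n, f (m * n + m + j) = c j 0%R.

Definition vec (x : nat -> bool) : 'cV[R]_n := (\col_j (x j)%:R)%R.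

Lemma vec_objective x : objective c (vec x) = xsum n f (m * n + m) x.
Proof.
rewrite /objective mxE; apply: eq_bigr => j _; rewrite !mxE fc.
by case: (x j); rewrite ?mulr1 ?mulr0.
Qed.

Lemma vec_feasible x : feasible A b (vec x) <-> solution m n f x.
Proof.
have row (i : 'I_m) : (A *m vec x)%R i 0%R = xsum n f (i * n) x.
  rewrite mxE; apply: eq_bigr => j _; rewrite !mxE fA.
  by case: (x j); rewrite ?mulr1 ?mulr0.
split=> [[_ e] r rm'|sx].
  by rewrite -(row (Ordinal rm')) e -fb.
split; first by move=> j; rewrite mxE; case: (x j); [right|left].
by apply/colP => i; rewrite row sx // fb.
Qed.

(** Carries optimality and infeasibility from boolean functions over to arbitrary feasible
    vectors. *)
Lemma feasible_vec v : feasible A b v -> exists x, v = vec x.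
Proof.
move=> [v01 _]; exists (fun j => if insub j is Some j' then v j' 0%R == 1%R else false).
apply/colP => j; rewrite mxE valK.
by case: (v01 j) => ->; rewrite ?eqxx // eq_sym oner_eq0.
Qed.

Lemma answer_of (g : config R) :
  (wget g 0 = 1 /\ (exists x : nat -> bool, [/\ solution m n f x,
        forall i, i < n -> rget g i = (x i)%:R%R, rget g n = xsum n f (m * n + m) x &
        forall y, solution m n f y -> (xsum n f (m * n + m) x <= xsum n f (m * n + m) y)%R]) \/
    wget g 0 = 0 /\ forall x, ~ solution m n f x) ->
  optimization_answer A b c g.
Proof.
case=> [[w1 [x [sx xE cE opt]]]|[w0 no]]; [left|right].
  have -> : out_vector n g = vec x by apply/colP => j; rewrite !mxE xE.
  split=> //; last by rewrite vec_objective.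
  split=> [|y fy]; first exact/vec_feasible.
  have [z yz] := feasible_vec fy; rewrite yz !vec_objective; apply: opt.
  by apply/vec_feasible; rewrite -yz.
split=> // -[y fy]; have [z yz] := feasible_vec fy.
by apply: (no z); apply/vec_feasible; rewrite -yz.
Qed.

End Instance.

Lemma size_entries m n (A : 'M[R]_(m, n)) : size (mx_entries A) = m * n.
Proof. by rewrite /mx_entries size_allpairs !size_enum_ord. Qed.

Lemma nth_entries m n (A : 'M[R]_(m, n)) s (i : 'I_m) (j : 'I_n) :
  nth 0%R (mx_entries A ++ s) (i * n + j) = A i j.
Proof.
have lt : i * n + j < m * n.
  by apply: (@leq_trans (i.+1 * n)); rewrite ?leq_mul2r ?ltn_ord ?orbT // mulSn addnC ltn_add2r.
rewrite nth_cat size_entries lt /mx_entries.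
have := nth_allpairs (fun i j => A i j) i j 0%R (s := enum 'I_m) (t := enum 'I_n) (i := i) (j := j).
by rewrite !size_enum_ord !nth_ord_enum; apply.
Qed.

Lemma size_col k (v : 'cV[R]_k) : size (col_entries v) = k.
Proof. by rewrite size_map size_enum_ord. Qed.

Lemma nth_col k (v : 'cV[R]_k) s (i : 'I_k) :
  nth 0%R (col_entries v ++ s) i = v i 0%R.
Proof.
by rewrite nth_cat size_col ltn_ord (nth_map i) ?size_enum_ord // nth_ord_enum.
Qed.

Lemma size_bounds : exists pT pS : {poly nat}, forall m n, 0 < m ->
  let k := (n + 3) %/ 4 in let B := 12 * 2 ^ k + (m * n + m + n) + 200 in
  time_bound R pT m n (size prelude + time (p_all m k (2 ^ k))) /\
  space_bound R pS m n (B + B).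
Proof.
have [C HC] := bounded_all; set d := size prelude.
(* [4] is the loss in [N ^ 2 <= 4 * 2 ^ (n / 2)], which follows from [4 * k <= n + 3]; [C + d]
   covers program and prelude, and [(n + 1) ^ 2] dominates [k.+1 ^ 2]. *)
pose pT : {poly nat} := ((4 * (C + d))%N%:P * ('X + 1%:P) ^+ 2)%R.
(* This is [2 * (4 * n + 426)]. The [2] is the loss in [N <= 2 * 2 ^ (n / 4)]; each term of [B + B =
   24 * N + 2 * m * n + 2 * m + 2 * n + 400] is at most a multiple of [m * N], and
   [426 = 24 + 2 + 400]. *)
pose pS : {poly nat} := (8%:P * 'X + 852%:P)%R.
have pTE n : pT.[n]%R = 4 * ((C + d) * (n + 1) ^ 2).
  rewrite /pT hornerM hornerC horner_exp hornerD hornerX hornerC.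
  exact: esym (mulnA _ _ _).
have pSE n : pS.[n]%R = 8 * n + 852 by rewrite /pS hornerD hornerM !hornerC hornerX.
exists pT, pS => m n m0 k B.
have N0 := N_gt0 k; set N := 2 ^ k in N0 *.
have kn : k <= n by rewrite /k; lia.
have pow e (x : R) : (e%:R <= x)%R -> ((2 ^ e)%:R <= 2 `^ x :> R)%R.
  move=> ex; rewrite natrX -powR_mulrn //; apply: ler_powR => //.
  by rewrite ler1n.
have k4 : ((4 * k)%N%:R <= (n + 3)%N%:R :> R)%R by rewrite ler_nat /k; lia.
rewrite natrM natrD in k4.
have n0 : (0 <= n%:R :> R)%R by [].
have NT : ((N ^ 2)%:R <= 4 * 2 `^ (n%:R / 2) :> R)%R.
  rewrite -expnM; apply: (le_trans (pow _ (n%:R / 2 + 2)%R _)).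
    by rewrite natrM; lra.
  rewrite powRD ?pnatr_eq0 ?implybT // mulrC ler_wpM2r ?powR_ge0 //.
  by rewrite powR_mulrn // expr2 -natrM.
have NS : (N%:R <= 2 * 2 `^ (n%:R / 4) :> R)%R.
  apply: (le_trans (pow _ (n%:R / 4 + 1)%R _)); first lra.
  rewrite powRD ?pnatr_eq0 ?implybT // mulrC ler_wpM2r ?powR_ge0 //.
  by rewrite powRr1.
split; rewrite /time_bound /space_bound.
  have le1 : d + time (p_all m k N) <= (C + d) * (n + 1) ^ 2 * m * N ^ 2.
    apply: (@leq_trans ((C + d) * (m * k.+1 ^ 2 * N ^ 2))).
      by rewrite mulnDl addnC leq_add ?HC // leq_pmulr // !muln_gt0 m0 !expn_gt0.
    have : k.+1 ^ 2 <= (n + 1) ^ 2 by rewrite leq_exp2r //; lia.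
    move: (k.+1 ^ 2) ((n + 1) ^ 2) (N ^ 2) => x y z xy.
    by rewrite -!mulnA leq_mul2l (mulnCA m) leq_mul2r xy !orbT.
  rewrite pTE.
  apply: (@le_trans _ _ ((C + d) * (n + 1) ^ 2 * m * N ^ 2)%:R%R); first by rewrite ler_nat.
  move: ((C + d) * (n + 1) ^ 2) (N ^ 2) NT => a N2 NT.
  rewrite (mulnC a m) (natrM _ (m * a)) (natrM _ m a) (natrM _ 4 a).
  have M0 : (0 <= m%:R * a%:R :> R)%R by rewrite mulr_ge0.
  apply: (le_trans (ler_wpM2l M0 NT)); rewrite le_eqVlt; apply/orP; left.
  by apply/eqP; ring.
rewrite pSE.
have le2 : B + B <= m * N * (4 * n + 426).
  have mN : m <= m * N by rewrite leq_pmulr.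
  have mN2 : N <= m * N by rewrite leq_pmull.
  have mN3 : 1 <= m * N by rewrite muln_gt0 m0.
  have mn : m * n <= m * N * n by rewrite leq_mul2r mN orbT.
  have nn : n <= m * N * n by rewrite leq_pmull.
  rewrite /B -/N mulnDr (mulnCA _ 4); lia.
apply: (@le_trans _ _ (m * N * (4 * n + 426))%:R%R); first by rewrite ler_nat.
have -> : 8 * n + 852 = 2 * (4 * n + 426) by lia.
move: (4 * n + 426) N NS {N0 HC le2 NT} => a N NS.
rewrite (mulnAC m N) (natrM _ (m * a)) (natrM _ m a) (natrM _ 2 a).
have M0 : (0 <= m%:R * a%:R :> R)%R by rewrite mulr_ge0.
apply: (le_trans (ler_wpM2l M0 NS)); rewrite le_eqVlt; apply/orP; left.
by apply/eqP; ring.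
Qed.

End Link.

Local Close Scope nat_scope.

Theorem theorem2 (R : realType) :
  (exists P : program,
    forall q : {poly nat}, exists pT pS : {poly nat},
    forall (m n : nat) (A : 'M[R]_(m, n)) (b : 'cV[R]_m),
      (0 < m)%N -> (m <= q.[n])%N ->
      exists t s : nat,
        [/\ time_bound R pT m n t, space_bound R pS m n s
          & computes_within P t s (feasibility_input A b)
              (feasibility_answer A b)])
  /\
  (exists P : program,
    forall q : {poly nat}, exists pT pS : {poly nat},
    forall (m n : nat) (A : 'M[R]_(m, n)) (b : 'cV[R]_m) (c : 'cV[R]_n),
      (0 < m)%N -> (m <= q.[n])%N ->
      exists t s : nat,
        [/\ time_bound R pT m n t, space_bound R pS m n s
          & computes_within P t s (optimization_input A b c)
              (optimization_answer A b c)]).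
Proof.
have [pT [pS bounds]] := size_bounds R.
have fb m n (A : 'M[R]_(m, n)) (b : 'cV[R]_m) s (i : 'I_m) :
    nth 0 (mx_entries A ++ col_entries b ++ s) (m * n + i)%N = b i 0.
  by rewrite nth_cat size_entries ltnNge leq_addr addKn nth_col.
split; exists prog => q; exists pT, pS => m n A b.
  move=> m0 _; have [tb sb] := bounds m n m0.
  eexists; eexists; split; [exact: tb|exact: sb|].
  have sz : (size (mx_entries A ++ col_entries b) <= m * n + m + n)%N.
    by rewrite size_cat size_entries size_col leq_addr.
  have [h1 h2 h3] := prog_run m0 erefl erefl (leqnn _) sz.
  split=> //; case: (@answer_of R m n A b 0 _ _ _ _ _ h3).
  - exact: nth_entries.
  - by move=> i; rewrite -[col_entries b]cats0 fb.
  (* No cells hold [c] here: reading behind the input yields [0], the entry of the zero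
     objective. *)
  - move=> j; rewrite mxE nth_default // size_cat size_entries size_col.
    exact: leq_addr.
  - by case=> w1 [fx _] _; left.
  by right.
move=> c m0 _; have [tb sb] := bounds m n m0.
eexists; eexists; split; [exact: tb|exact: sb|].
have sz : (size (mx_entries A ++ col_entries b ++ col_entries c) <= m * n + m + n)%N.
  by rewrite !size_cat size_entries !size_col addnA.
have [h1 h2 h3] := prog_run m0 erefl erefl (leqnn _) sz.
split=> //; apply: (answer_of _ _ _ h3).
- exact: nth_entries.
- exact: fb.
- move=> j; rewrite catA nth_cat size_cat size_entries size_col.
  by rewrite ltnNge leq_addr addKn -[col_entries c]cats0 nth_col.
Qed.
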